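(* Assume the setting of the context (two-dimensional multiplicative exponential covariance model on a regular grid, without measurement error) with $\delta\in[0,1)$, $\Theta\subseteq(0,\infty)^2$ compact, and $\boldsymbol\theta_0=(\sigma_0^2,\kappa_0)'\in\Theta$ the true covariance parameter vector, i.e. $\operatorname{var}(\mathbf Z)=\boldsymbol\Sigma(\boldsymbol\theta_0)$. Suppose that for each $\alpha\in\mathcal A$, $\hat{\boldsymbol\theta}(\alpha)\to\boldsymbol\theta_\alpha$ in probability for some $\boldsymbol\theta_\alpha\in\Theta$, and that $$\min_{\alpha\in\mathcal A\setminus\mathcal A^0}R(\alpha;\boldsymbol\theta_\alpha)\to\infty\quad\text{as }n\to\infty.$$ Then $\hat\alpha_2$ (GIC with $\tau_n=2$) is asymptotically loss efficient if $|\mathcal A^0|\le1$. In addition, suppose that $\lim_{n\to\infty}\tau_n=\infty$ and $\tau_n=o\big(\min_{\alpha\in\mathcal A\setminus\mathcal A^0}R(\alpha;\boldsymbol\theta_\alpha)\big)$. Then: (i) if $|\mathcal A^0|=0$, $\hat\alpha_{\tau_n}$ is asymptotically loss efficient; (ii) if $|\mathcal A^0|\ge1$, $\hat\alpha_{\tau_n}$ is consistent.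
   Context: Data. $n=m^2$ with $m$ a positive integer, $D=[0,n^{\delta/2}]^2\subset\mathbb R^2$, and the sites are $\mathbf s_k=(i\,m^{-(1-\delta)},\,j\,m^{-(1-\delta)})$ with $k=i+(j-1)m$, $i,j=1,\dots,m$. Data: $Z(\mathbf s_k)=\mu_0(\mathbf s_k)+\eta(\mathbf s_k)$ (the measurement error variance is $v^2=0$), where $\mu_0(\cdot)$ is the mean function and $\eta(\cdot)$ a zero-mean Gaussian process. $\mathbf Z$ is the $n$-vector of data and $\boldsymbol\mu_0=\mathrm E(\mathbf Z)$. Dependence on $n$ is mostly suppressed; limits are as $n=m^2\to\infty$. Covariance model. $\boldsymbol\theta=(\sigma^2,\kappa)'$ and $\boldsymbol\Sigma(\boldsymbol\theta)$ is the $n\times n$ matrix with $(k,l)$ entry $\sigma^2\exp\big(-\kappa\{|s_{k,1}-s_{l,1}|+|s_{k,2}-s_{l,2}|\}\big)$, where $\mathbf s_k=(s_{k,1},s_{k,2})$. Models. The number $p$ of explanatory variables $x_1(\cdot),\dots,x_p(\cdot)$, the set $\mathcal A\subseteq2^{\{1,\dots,p\}}$ of candidate models, the set $\mathcal A^0\subseteq\mathcal A$ of correct models and the smallest correct model $\alpha^0$ do not depend on $n$. $\mathbf X$ is the nonrandom $n\times(p+1)$ matrix with rows $(1,x_1(\mathbf s_k),\dots,x_p(\mathbf s_k))$; $p(\alpha)$ is the number of elements of $\alpha$; $\mathbf X(\alpha)$ consists of the column $\mathbf 1$ and the columns of $\mathbf X$ indexed by $\alpha$. Model $\alpha$ postulates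 mean $\mathbf X(\alpha)\boldsymbol\beta(\alpha)$ and covariance $\boldsymbol\Sigma(\boldsymbol\theta)$; $(\mathbf X'\boldsymbol\Sigma^{-1}(\boldsymbol\theta)\mathbf X)^{-1}$ exists for all $\boldsymbol\theta\in\Theta$. Model $\alpha$ is correct if $\mu_0(\mathbf s)$ can be written as $\beta_0+\sum_{j\in\alpha}\beta_jx_j(\mathbf s)$ for all $\mathbf s\in D$; $\alpha^0=\arg\min_{\alpha\in\mathcal A^0}p(\alpha)$ when $\mathcal A^0\ne\varnothing$. Likelihood and GIC. $\hat{\boldsymbol\mu}(\alpha;\boldsymbol\theta)=\mathbf X(\alpha)(\mathbf X(\alpha)'\boldsymbol\Sigma^{-1}(\boldsymbol\theta)\mathbf X(\alpha))^{-1}\mathbf X(\alpha)'\boldsymbol\Sigma^{-1}(\boldsymbol\theta)\mathbf Z$, $$\ell(\alpha;\boldsymbol\theta)=-\tfrac n2\log(2\pi)-\tfrac12\log\det\boldsymbol\Sigma(\boldsymbol\theta)-\tfrac12(\mathbf Z-\hat{\boldsymbol\mu}(\alpha;\boldsymbol\theta))'\boldsymbol\Sigma^{-1}(\boldsymbol\theta)(\mathbf Z-\hat{\boldsymbol\mu}(\alpha;\boldsymbol\theta)),$$ the ML estimate $\hat{\boldsymbol\theta}(\alpha)\in\Theta$ satisfies $\ell(\alpha;\hat{\boldsymbol\theta}(\alpha))=\sup_{\boldsymbol\theta\in\Theta}\ell(\alpha;\boldsymbol\theta)$. For a tuning parameter $\tau_n$, GIC is $\Gamma_{\tau_n}(\alpha)=-2\ell(\alpha;\hat{\boldsymbol\theta}(\alpha))+\tau_np(\alpha)$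 and $\hat\alpha_{\tau_n}=\arg\min_{\alpha\in\mathcal A}\Gamma_{\tau_n}(\alpha)$. Losses. With $\boldsymbol\Sigma_0=\operatorname{var}(\mathbf Z)$, the Kullback–Leibler loss is $$L(\alpha;\boldsymbol\theta)=\tfrac12\{\log\det\boldsymbol\Sigma(\boldsymbol\theta)-\log\det\boldsymbol\Sigma_0+\operatorname{tr}(\boldsymbol\Sigma_0\boldsymbol\Sigma^{-1}(\boldsymbol\theta))-n\}+\tfrac12(\hat{\boldsymbol\mu}(\alpha;\boldsymbol\theta)-\boldsymbol\mu_0)'\boldsymbol\Sigma^{-1}(\boldsymbol\theta)(\hat{\boldsymbol\mu}(\alpha;\boldsymbol\theta)-\boldsymbol\mu_0),$$ and for fixed $\boldsymbol\theta$, $R(\alpha;\boldsymbol\theta)=\mathrm E(L(\alpha;\boldsymbol\theta))$. $\hat\alpha$ is consistent if $\lim_{n\to\infty}P\{\hat\alpha=\alpha^0\}=1$, and asymptotically loss efficient if $L(\hat\alpha;\hat{\boldsymbol\theta}(\hat\alpha))/\min_{\alpha\in\mathcal A}L(\alpha;\hat{\boldsymbol\theta}(\alpha))\to1$ in probability. *)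

(* Defs.v *)
From HB Require Import structures.
From mathcomp Require Import all_boot all_order all_algebra.
From mathcomp Require Import all_classical all_reals all_analysis.

Set Implicit Arguments.
Unset Strict Implicit.
Unset Printing Implicit Defensive.

Import Order.TTheory GRing.Theory Num.Theory.
Import numFieldNormedType.Exports.

Local Open Scope classical_set_scope.
Local Open Scope ring_scope.

(* Everything is indexed by m; the sample size is n = m ^ 2.  A covariance
   parameter is a pair th = (sigma^2, kappa), so th.1 is the variance. *)

Section Probability.
Context {d : measure_display} {T : measurableType d} {R : realType}.
Variable P : probability T R.

Definition cvg_in_prob {V : normedModType R} (X : nat -> T -> V) (l : V) :=
  forall e : R, 0 < e -> P [set w | e < `|X m w - l|] @[m --> \oo] --> 0%E.

(* The library's [normal_prob mu 0] is the uniform law on [0, 1], so the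
   degenerate case has to be treated separately. *)
Definition gaussian_law (mu s : R) (V : set R) : \bar R :=
  if s == 0 then \d_mu V else normal_prob mu s V.

Definition gaussian_rv (X : T -> R) :=
  exists mu s : R,
    forall V : set R, measurable V -> P (X @^-1` V) = gaussian_law mu s V.

Definition gaussian_process (I : Type) (D : set I) (eta : I -> {RV P >-> R}) :=
  forall (N : nat) (t : 'I_N -> I) (c : 'I_N -> R),
    (forall i, D (t i)) -> gaussian_rv (fun w => \sum_(i < N) c i * eta (t i) w).

Definition centered (I : Type) (D : set I) (eta : I -> {RV P >-> R}) :=
  forall t, D t -> ('E_P[eta t] = 0)%E.

Definition dispersion (n : nat) (Z : T -> 'cV[R]_n) : 'M[R]_n :=
  \matrix_(k, l) fine (covariance P (fun w => Z w k 0) (fun w => Z w l 0)).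

End Probability.

Section Gaussian_regression.
Context {R : realType} {n q : nat}.
Implicit Types (X : 'M[R]_(n, q)) (S : 'M[R]_n) (z : 'cV[R]_n).

Definition qform S z : R := (z^T *m invmx S *m z) 0 0.

Definition gls_mean X S z : 'cV[R]_n :=
  X *m invmx (X^T *m invmx S *m X) *m X^T *m invmx S *m z.

Definition loglik X S z : R :=
  - (n%:R / 2) * ln (2 * pi) - ln (\det S) / 2 - qform S (z - gls_mean X S z) / 2.

Definition kl_loss X S S0 (mu : 'cV[R]_n) z : R :=
  (ln (\det S) - ln (\det S0) + \tr (S0 *m invmx S) - n%:R) / 2
  + qform S (gls_mean X S z - mu) / 2.

End Gaussian_regression.

(* Over the empty set the minimum is +oo. *)
Definition min_over {R : realType} {I : finType} (A : {set I}) (F : I -> \bar R)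
  : \bar R := \big[Order.min/+oo%E]_(a in A) F a.

Section Grid.
Context {R : realType}.
Variable delta : R.

Definition domain (m : nat) : set (R * R) :=
  [set s | 0 <= s.1 <= (m ^ 2)%:R `^ (delta / 2) /\
           0 <= s.2 <= (m ^ 2)%:R `^ (delta / 2)].

(* With 0-based k, the 1-based grid coordinates are i = k %% m + 1 and
   j = k %/ m + 1. *)
Definition site (m : nat) (k : 'I_(m ^ 2)) : R * R :=
  ((k %% m).+1%:R * m%:R `^ (- (1 - delta)),
   (k %/ m).+1%:R * m%:R `^ (- (1 - delta))).

Definition expcov (th s t : R * R) : R :=
  th.1 * expR (- th.2 * (`|s.1 - t.1| + `|s.2 - t.2|)).

Definition Sigma (m : nat) (th : R * R) : 'M[R]_(m ^ 2) :=
  \matrix_(k, l) expcov th (site k) (site l).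

End Grid.

(* The mean function, the covariates and the noise process may vary with m
   (triangular array); functions not depending on n are constant in m. *)
Section Model.
Context {d : measure_display} {T : measurableType d} {R : realType}.
Context (P : probability T R) {p : nat}.
Variables (delta : R) (mu0 : nat -> R * R -> R).
Variables (x : nat -> 'I_p -> R * R -> R) (eta : nat -> R * R -> {RV P >-> R}).

Definition mean_vec (m : nat) : 'cV[R]_(m ^ 2) := \col_k mu0 m (site delta k).

Definition data (m : nat) (w : T) : 'cV[R]_(m ^ 2) :=
  \col_k (mu0 m (site delta k) + eta m (site delta k) w).

Definition covariates (m : nat) : 'M[R]_(m ^ 2, p) :=
  \matrix_(k, j) x m j (site delta k).

Definition full_design (m : nat) : 'M[R]_(m ^ 2, 1 + p) :=
  row_mx (const_mx 1) (covariates m).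

Definition design (m : nat) (a : {set 'I_p}) : 'M[R]_(m ^ 2, 1 + #|a|) :=
  row_mx (const_mx 1) (colsub (fun j : 'I_#|a| => enum_val j) (covariates m)).

Definition correct (m : nat) (a : {set 'I_p}) :=
  exists (b0 : R) (b : 'I_p -> R), forall s, domain delta m s ->
    mu0 m s = b0 + \sum_(j in a) b j * x m j s.

Definition ell (m : nat) (a : {set 'I_p}) (th : R * R) (w : T) : R :=
  loglik (design m a) (Sigma delta m th) (data m w).

Definition loss (m : nat) (a : {set 'I_p}) (th : R * R) (w : T) : R :=
  kl_loss (design m a) (Sigma delta m th) (dispersion P (data m))
    (mean_vec m) (data m w).

Definition risk (m : nat) (a : {set 'I_p}) (th : R * R) : \bar R :=
  'E_P[loss m a th]%E.

Definition ml_estimate (Theta : set (R * R)) (m : nat) (a : {set 'I_p})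
    (thhat : T -> R * R) :=
  forall w, Theta (thhat w) /\
    (ell m a (thhat w) w)%:E = ereal_sup [set (ell m a th w)%:E | th in Theta].

Variable thhat : nat -> {set 'I_p} -> T -> R * R.

Definition gic (tau : nat -> R) (m : nat) (a : {set 'I_p}) (w : T) : R :=
  - 2 * ell m a (thhat m a w) w + tau m * #|a|%:R.

(* [ahat] is a measurable selection of minimizers of the criterion, ties
   being broken arbitrarily. *)
Definition gic_selector (A : {set {set 'I_p}}) (tau : nat -> R)
    (ahat : nat -> T -> {set 'I_p}) :=
  (forall m a, measurable (ahat m @^-1` [set a])) /\
  \forall m \near \oo, forall w, ahat m w \in A /\
    forall a, a \in A -> gic tau m (ahat m w) w <= gic tau m a w.

Definition loss_efficient (A : {set {set 'I_p}})
    (ahat : nat -> T -> {set 'I_p}) :=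
  cvg_in_prob P (fun m w =>
    loss m (ahat m w) (thhat m (ahat m w) w) w
    / fine (min_over A (fun a => (loss m a (thhat m a w) w)%:E))) 1.

End Model.

(* [a0] is the arg min of the model size over [A0]: as it is spoken of as a
   single model, the minimizer is required to be unique. *)
Definition smallest_model {p : nat} (A0 : {set {set 'I_p}}) (a0 : {set 'I_p}) :=
  a0 \in A0 /\ forall a, a \in A0 -> a != a0 -> (#|a0| < #|a|)%N.

Definition consistent {d} {T : measurableType d} {R : realType}
    (P : probability T R) {p : nat} (a0 : {set 'I_p})
    (ahat : nat -> T -> {set 'I_p}) :=
  P [set w | ahat m w = a0] @[m --> \oo] --> 1%E.

(* Main.v *)
(** Whitening the data with the true covariance replaces the precision matrix
  of the model by a relative precision matrix [H], whose eigenvalues are bounded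
  above and below uniformly in the parameters and in [n].  For a separable AR(1)
  covariance on a grid, [H] always lies in the span of 64 fixed matrices.

  Twice the loss is the entropy [tr H - n - ln (det H)] plus a squared bias plus
  a squared fitted noise.  The criterion [-2 ell] differs from twice the loss,
  up to a constant, by a quadratic chaos in [H - 1] and a linear chaos in the
  bias.  On a span of bounded dimension, [sup_C (chaos C)^2 / |C|^2] has bounded
  expectation, and [|H - 1|^2] is at most a constant times the entropy; so the
  difference is at most [e * loss + W / e] with [W] bounded in probability,
  uniformly in the model and the parameters.

  The true parameter competes in the maximisation, so the loss of a correct
  model is [O(W)].  The loss of an incorrect model at its estimate is at least
  a constant times its risk at the limit parameter, because the entropy is
  explicit and its order of magnitude near a given parameter is controlled by
  its value there.  Hence incorrect models are separated from correct ones, and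
  on a good event the theorem is a deterministic comparison of criteria. *)
Require Import Defs.
From HB Require Import structures.
From mathcomp Require Import all_boot all_order all_algebra.
From mathcomp Require Import all_classical all_reals all_analysis.
From mathcomp Require Import measurable_realfun mxtens zify ring lra.

Set Implicit Arguments.
Unset Strict Implicit.
Unset Printing Implicit Defensive.

Import Order.TTheory GRing.Theory Num.Theory.
Import numFieldNormedType.Exports.

Local Open Scope classical_set_scope.
Local Open Scope ring_scope.

(** * Gaussian moments *)

(** The obstacle is uniformity. On a refining grid the correlation of neighbours tends to 1 and
    every precision matrix degenerates; only quotients such as [(1 - rho) / (1 - rho')] stay
    bounded, which is why everything is measured relative to the true covariance. Moreover the
    criteria are evaluated at random parameters, so bounds at a fixed parameter do not suffice: the
    bounded dimension of the span yields a bound that holds outcome by outcome for all its elements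
    at once, random ones included. The number 64 is [8 * 8], an AR(1) precision being a combination
    of 8 fixed matrices along each axis.

    With [n = m ^ 2] and mesh [h], the entropy has three regimes: order [n] when [sigma^2 kappa^2]
    is wrong, at most order [n h] when this product is right but [kappa] is wrong, and 0 at the
    truth. Near a limit parameter the order can jump, but only upwards, and a lower bound at the
    estimate is all that is needed.

    Finally, ratios of losses require positive losses. A loss can vanish only if the noise is
    orthogonal to the whitened intercept, an event of probability zero. *)

Section gaussian_integrals.
Variable R : realType.
Notation mu := (@lebesgue_measure R).
(** The exponential dominates the term of degree [k + 1] of its series, so the function is at most a
    constant times [x^-1] for [x >= 1]. *)
Lemma cvg_pow_expR (c : R) (k : nat) : 0 < c ->
  (x ^+ k * expR (- (c * x ^+ 2))) @[x --> +oo] --> (0:R).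
Proof.
move=> c0.
pose C := (k.+1)`!%:R / c ^+ k.+1.
have C0 : 0 < C by rewrite divr_gt0 ?exprn_gt0// ltr0n fact_gt0.
apply: (@squeeze_cvgr _ _ _ _ (cst 0) (fun x => C * x^-1)).
- near=> x.
  have x1 : 1 <= x by near: x; exact: nbhs_pinfty_ge.
  have x0 : 0 < x by exact: lt_le_trans x1.
  rewrite /= mulr_ge0 ?expR_ge0 ?exprn_ge0 ?(ltW x0)//=.
  have h : (c * x ^+ 2) ^+ k.+1 / k.+1`!%:R <= expR (c * x ^+ 2).
    apply: le_trans (expR_ge1Dxn k _); first by rewrite lerDr.
    by rewrite mulr_ge0 ?sqr_ge0// ltW.
  rewrite expRN ler_pdivrMr ?expR_gt0//.
  apply: (@le_trans _ _ (C / x * ((c * x ^+ 2) ^+ k.+1 / k.+1`!%:R))); last first.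
    by rewrite ler_pM2l// divr_gt0.
  have -> : C / x * ((c * x ^+ 2) ^+ k.+1 / k.+1`!%:R) = x ^+ (k + k.+1).
    rewrite /C exprMn -exprM mulnC muln2 -addnn addSn (exprSr x).
    have : c ^+ k.+1 != 0 by rewrite expf_neq0// gt_eqF.
    have : k.+1`!%:R != 0 :> R by rewrite pnatr_eq0 -lt0n fact_gt0.
    move: (_`!%:R) (c ^+ _) (x ^+ _) => f e y f0 e0.
    by field; rewrite f0 e0 gt_eqF.
  by rewrite exprD ler_peMr ?exprn_ge0 ?(ltW x0)// exprn_ege1.
- exact: cvg_cst.
- rewrite -[X in _ --> X](mulr0 C); apply: cvgMr.
  apply/gtr0_cvgV0; last exact: cvg_id.
  by near=> x; near: x; exact: nbhs_pinfty_gt.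
Unshelve. all: by end_near. Qed.

Lemma derive_pow_expR (c : R) (k : nat) (x : R) :
  is_derive x 1 (fun x => - (x ^+ k.+1 * expR (- (c * x ^+ 2))))
   (x ^+ k * (2 * c * x ^+ 2 - k.+1%:R) * expR (- (c * x ^+ 2))).
Proof.
have h : is_derive x 1 (fun x => expR (- (c * x ^+ 2))) (- (2 * c * x) * expR (- (c * x ^+ 2))).
  apply: is_derive_eq => /=.
  rewrite /GRing.scale/=. ring.
have hX : is_derive x 1 (fun x : R => x ^+ k.+1) (k.+1%:R * x ^+ k).
  apply: DeriveDef; first exact: exprn_derivable.
  by rewrite exp_derive /GRing.scale/= mulr1.
apply: (is_derive_eq (is_deriveN (is_deriveM hX h))); rewrite /GRing.scale/= exprS. ring.
Qed.

Lemma continuous_pow_expR (a c : R) (k : nat) :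
  continuous (fun x : R => a * x ^+ k * expR (- (c * x ^+ 2))).
Proof.
move=> x; apply: cvgM.
  by apply: cvgMr; exact: exprn_continuous.
apply: (@continuous_comp _ _ _ (fun x : R => - (c * x ^+ 2)) expR).
  by apply: cvgN; apply: cvgMr; exact: exprn_continuous.
exact: continuous_expR.
Qed.

Lemma measurable_pow_expR (D : set R) (a c : R) (k : nat) : measurable D ->
  measurable_fun D (EFin \o (fun x : R => a * x ^+ k * expR (- (c * x ^+ 2)))).
Proof.
move=> mD; apply/measurable_EFinP/measurable_funTS.
apply: continuous_measurable_fun. exact: continuous_pow_expR.
Qed.

(** Integration by parts with nonnegative integrals only. The derivative [f] of [F] changes sign
    once, at [a]; it is integrated separately on both sides, and up to sign each side gives [- F a]
    because [F] vanishes at 0 and at infinity. *)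
Lemma integral0y_pow_expR (c : R) (k : nat) : 0 < c ->
  (\int[mu]_(x in `[0%R, +oo[) (2 * c * x ^+ k.+2 * expR (- (c * x ^+ 2)))%:E =
  \int[mu]_(x in `[0%R, +oo[) (k.+1%:R * x ^+ k * expR (- (c * x ^+ 2)))%:E)%E.
Proof.
move=> c0.
pose e x : R := expR (- (c * x ^+ 2)).
pose a := Num.sqrt (k.+1%:R / (2 * c)).
have a0 : 0 < a by rewrite sqrtr_gt0 divr_gt0// mulr_gt0.
have a2 : 2 * c * a ^+ 2 = k.+1%:R.
  rewrite sqr_sqrtr ?divr_ge0 ?mulr_ge0 ?(ltW c0)//; field; exact: lt0r_neq0.
pose g1 x := 2 * c * x ^+ k.+2 * e x.
pose g0 x := k.+1%:R * x ^+ k * e x.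
pose f x := x ^+ k * (2 * c * x ^+ 2 - k.+1%:R) * e x.
pose F x := - (x ^+ k.+1 * e x).
have fE : f = g1 \- g0.
  by apply/funext => x; rewrite /f/g1/g0/= -[in RHS](addn2 k) exprD; ring.
have e0 x : 0 < e x by exact: expR_gt0.
have cf : continuous f.
  move=> x; rewrite fE; apply: cvgB; exact: continuous_pow_expR.
have dF (x : R) : is_derive x 1 F (f x) by exact: derive_pow_expR.
have dF1 (x : R) : derivable F x 1 by case: (dF x).
have cF : continuous F.
  by move=> x; apply/differentiable_continuous/derivable1_diffP.
have F'E (x : R) : derive1 F x = f x by rewrite derive1E; case: (dF x).
have g1_ge0 (x : R) : 0 <= x -> 0 <= g1 x.
  by move=> x0; apply: mulr_ge0 (ltW (e0 _)); rewrite mulr_ge0 ?exprn_ge0// mulr_ge0 ?(ltW c0).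
have g0_ge0 (x : R) : 0 <= x -> 0 <= g0 x.
  by move=> x0; apply: mulr_ge0 (ltW (e0 _)); rewrite mulr_ge0 ?exprn_ge0.
have f_ge0 (x : R) : a <= x -> 0 <= f x.
  move=> ax; have x0 : 0 <= x by rewrite (le_trans (ltW a0)).
  apply: mulr_ge0 (ltW (e0 _)); rewrite mulr_ge0 ?exprn_ge0// -a2 -mulrBr mulr_ge0 ?mulr_ge0 ?(ltW c0)//.
  by rewrite subr_ge0 lerXn2r ?nnegrE ?(ltW a0).
have f_le0 (x : R) : 0 <= x <= a -> f x <= 0.
  move=> /andP[x0 ax].
  rewrite mulr_le0_ge0 ?(ltW (e0 _))// mulr_ge0_le0 ?exprn_ge0// -a2 -mulrBr.
  rewrite mulr_ge0_le0 ?mulr_ge0 ?(ltW c0)// subr_le0 lerXn2r ?nnegrE ?(ltW a0)//.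
have mf D : measurable D -> measurable_fun D (EFin \o f).
  by move=> mD; apply/measurable_EFinP/measurable_funTS; exact: continuous_measurable_fun.
have tail : (\int[mu]_(x in `[a, +oo[) (f x)%:E = (- F a)%:E)%E.
  rewrite (@ge0_continuous_FTC2y _ f F a 0)//.
  - by rewrite -EFinB sub0r.
  - exact/continuous_subspaceT.
  - rewrite -oppr0; apply: cvgN; exact: cvg_pow_expR.
  - by apply: cvg_at_right_filter; exact: cF.
have head : (\int[mu]_(x in `[0%R, a]) (- f x)%:E = (- F a)%:E)%E.
  rewrite (@continuous_FTC2 _ (\- f) (\- F) 0 a)//=.
  - have F0 : F 0 = 0 by rewrite /F expr0n/= mul0r oppr0.
    by rewrite -EFinB F0 oppr0 subr0.
  - by apply: continuous_subspaceT => x; apply: cvgN; exact: cf.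
  - split.
    + move=> x _; exact: derivableN.
    + by apply: cvg_at_right_filter; apply: cvgN; exact: cF.
    + by apply: cvg_at_left_filter; apply: cvgN; exact: cF.
  - move=> x _; rewrite derive1E deriveN// -derive1E F'E//.
have U : `[0%R, +oo[%classic = `[0%R, a[ `|` `[a, +oo[ :> set R.
  by apply: (@itv_bndbnd_setU _ _ (BLeft 0%R) (BLeft a) +oo%O); rewrite bnd_simp// ltW.
have D : [disjoint `[0%R, a[%classic & `[a, +oo[%classic : set R].
  apply/disj_setPS => x/=; rewrite !in_itv/= andbT => -[/andP[_]].
  by rewrite ltNge => /negP.
have tl : (\int[mu]_(x in `[a, +oo[) (g1 x)%:E =
    \int[mu]_(x in `[a, +oo[) (g0 x)%:E + (- F a)%:E)%E.
  rewrite -tail -ge0_integralD//=.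
  - by apply: eq_integral => x _; rewrite -EFinD fE/=; congr EFin; ring.
  - move=> x; rewrite in_itv/= andbT => ax; rewrite lee_fin g0_ge0//.
    by rewrite (le_trans (ltW a0)).
  - exact: measurable_pow_expR.
  - by move=> x; rewrite in_itv/= andbT => ax; rewrite lee_fin f_ge0.
  - exact: mf.
have hd : (\int[mu]_(x in `[0%R, a]) (g0 x)%:E =
    \int[mu]_(x in `[0%R, a]) (g1 x)%:E + (- F a)%:E)%E.
  rewrite -head -ge0_integralD//=.
  - by apply: eq_integral => x _; rewrite -EFinD fE/=; congr EFin; ring.
  - move=> x; rewrite in_itv/= => /andP[x0 _]; rewrite lee_fin g1_ge0//.
  - exact: measurable_pow_expR.
  - by move=> x; rewrite in_itv/= => ax; rewrite lee_fin oppr_ge0 f_le0.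
  - by apply/measurable_EFinP/measurable_funTS/measurableT_comp => //;
      exact: continuous_measurable_fun.
have S (b : R) (j : nat) : 0 <= b ->
    (\int[mu]_(x in `[0%R, +oo[) (b * x ^+ j * e x)%:E =
     \int[mu]_(x in `[0%R, a]) (b * x ^+ j * e x)%:E +
     \int[mu]_(x in `[a, +oo[) (b * x ^+ j * e x)%:E)%E.
  move=> b0; rewrite U ge0_integral_setU//=.
  - rewrite integral_itv_bndo_bndc//; exact: measurable_pow_expR.
  - by rewrite -U; exact: measurable_pow_expR.
  - move=> x /=; rewrite !in_itv/= andbT => xa.
    have x0 : 0 <= x by case: xa => [/andP[]|] // ax; rewrite (le_trans (ltW a0)).
    by rewrite lee_fin; apply: mulr_ge0 (ltW (e0 _)); rewrite mulr_ge0 ?exprn_ge0.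
rewrite (S _ k.+2) ?mulr_ge0 ?(ltW c0)// S//.
by rewrite [X in (_ + X)%E]tl [X in _ = (X + _)%E]hd addeA addeAC.
Qed.
End gaussian_integrals.

Section normal_moments.
Variable R : realType.
Notation mu := (@lebesgue_measure R).

(** The Radon-Nikodym derivative and [normal_pdf] have the same integral over every measurable set,
    hence agree almost everywhere. *)
Lemma ge0_integral_normal_prob (m s : R) (f : R -> \bar R) :
  measurable_fun [set: R] f -> (forall x, 0 <= f x)%E ->
  (\int[normal_prob m s]_x f x = \int[mu]_x (f x * (normal_pdf m s x)%:E))%E.
Proof.
move=> mf f0; have dom := normal_prob_dominates m s.
rewrite -(Radon_Nikodym_SigmaFinite.change_of_variables dom)//.
have ig := Radon_Nikodym_SigmaFinite.f_integrable dom.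
apply: ae_eq_integral => //.
- by apply: emeasurable_funM => //; exact: measurable_int ig.
- apply: emeasurable_funM => //; apply/measurable_EFinP; exact: measurable_normal_pdf.
- apply: ae_eqe_mul2l => /=.
  apply: integral_ae_eq => //=.
  + by apply/measurable_EFinP; exact: measurable_normal_pdf.
  + by move=> E E01 mE; rewrite -Radon_Nikodym_SigmaFinite.f_integral.
Qed.

Lemma integral_even_pow_expR (c : R) (j : nat) : 0 < c ->
  (\int[mu]_x (2 * c * x ^+ j.*2.+2 * expR (- (c * x ^+ 2)))%:E =
  \int[mu]_x (j.*2.+1%:R * x ^+ j.*2 * expR (- (c * x ^+ 2)))%:E)%E.
Proof.
move=> c0.
have S (b : R) (i : nat) : 0 <= b -> ~~ odd i ->
    (\int[mu]_x (b * x ^+ i * expR (- (c * x ^+ 2)))%:E =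
    2%:E * \int[mu]_(x in `[0%R, +oo[) (b * x ^+ i * expR (- (c * x ^+ 2)))%:E)%E.
  move=> b0 oi; rewrite ge0_symfun_integralT//.
  - by rewrite set_itvcy.
  - by move=> x; rewrite mulr_ge0 ?expR_ge0// mulr_ge0// exprn_even_ge0.
  - exact: continuous_pow_expR.
  - move=> x /=; rewrite sqrrN; congr (_ * _ * _).
    by rewrite -[X in _ = X ^+ _]mulN1r exprMn -signr_odd (negbTE oi) mul1r.
rewrite (S _ j.*2.+2) ?mulr_ge0 ?(ltW c0)//=; last by rewrite negbK odd_double.
by rewrite integral0y_pow_expR// S// odd_double.
Qed.

Lemma normal_pdf0E (s x : R) : s != 0 ->
  normal_pdf 0 s x = normal_peak s * expR (- ((s ^+ 2 *+ 2)^-1 * x ^+ 2)).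
Proof.
move=> s0; rewrite normal_pdfE// /= /normal_fun subr0.
by rewrite mulNr (mulrC (x ^+ 2)).
Qed.

(** The recursion [integral_even_pow_expR] with [2 c = 1 / s^2]: two more powers of [x] multiply the
    moment by [(2 j + 1) s^2]. *)
Lemma integral_normal_even (s : R) (j : nat) (r : R) : s != 0 ->
  (\int[mu]_x (x ^+ j.*2 * normal_pdf 0 s x)%:E = r%:E)%E ->
  (\int[mu]_x (x ^+ j.*2.+2 * normal_pdf 0 s x)%:E = (j.*2.+1%:R * s ^+ 2 * r)%:E)%E.
Proof.
move=> s0 h; pose c := (s ^+ 2 *+ 2)^-1.
have s20 : 0 < s ^+ 2 by rewrite exprn_even_gt0.
have c0 : 0 < c by rewrite invr_gt0 pmulrn_lgt0.
have p0 := normal_peak_gt0 s0.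
pose K i := (\int[mu]_x (x ^+ i * expR (- (c * x ^+ 2)))%:E)%E.
have pos i (x : R) : ~~ odd i -> (0 <= (x ^+ i * expR (- (c * x ^+ 2)))%:E)%E.
  by move=> oi; rewrite lee_fin mulr_ge0 ?expR_ge0// exprn_even_ge0.
have mK i : measurable_fun [set: R] (EFin \o (fun x : R => x ^+ i * expR (- (c * x ^+ 2)))).
  apply: eq_measurable_fun (@measurable_pow_expR R setT 1 c i measurableT).
  by move=> x _ /=; rewrite mul1r.
have A (b : R) (i : nat) : 0 <= b -> ~~ odd i ->
   (\int[mu]_x (b * x ^+ i * expR (- (c * x ^+ 2)))%:E = b%:E * K i)%E.
  move=> b0 oi; rewrite -ge0_integralZl_EFin//; [|by move=> x _; exact: pos|exact: mK].
  by apply: eq_integral => x _; rewrite -EFinM -mulrA.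
have B (i : nat) : ~~ odd i ->
   (\int[mu]_x (x ^+ i * normal_pdf 0 s x)%:E = (normal_peak s)%:E * K i)%E.
  move=> oi; rewrite -ge0_integralZl_EFin// ?(ltW p0)//; [|by move=> x _; exact: pos|exact: mK].
  by apply: eq_integral => x _; rewrite normal_pdf0E// -EFinM mulrCA.
have o1 : ~~ odd j.*2 by rewrite odd_double.
have o2 : ~~ odd j.*2.+2 by rewrite /= negbK odd_double.
have := integral_even_pow_expR j c0.
rewrite !A// ?mulr_ge0 ?(ltW c0)// => E1.
move: h; rewrite !B// => E2.
have Kj : K j.*2 = (r / normal_peak s)%:E.
  rewrite mulrC EFinM -E2 muleA -EFinM mulVf ?mul1e// gt_eqF//.
have Kj2 : K j.*2.+2 = (s ^+ 2 * (j.*2.+1%:R * (r / normal_peak s)))%:E.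
  rewrite [RHS]EFinM [X in (_ * X)%E]EFinM -Kj -E1 muleA -EFinM.
  rewrite (_ : s ^+ 2 * _ = 1) ?mul1e// /c mulr2n; field.
  exact: s0.
by rewrite Kj2 -EFinM; congr EFin; field; rewrite gt_eqF.
Qed.

Lemma normal_second_moment (s : R) : s != 0 ->
  (\int[mu]_x (x ^+ 2 * normal_pdf 0 s x)%:E = (s ^+ 2)%:E)%E.
Proof.
move=> s0; rewrite (@integral_normal_even s 0 1)//; first by rewrite mul1r mulr1.
by rewrite -(integral_normal_pdf 0 s); apply: eq_integral => x _; rewrite mul1r.
Qed.

Lemma normal_fourth_moment (s : R) : s != 0 ->
  (\int[mu]_x (x ^+ 4 * normal_pdf 0 s x)%:E = (3 * (s ^+ 2) ^+ 2)%:E)%E.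
Proof.
move=> s0; rewrite (@integral_normal_even s 1 (s ^+ 2))//; last exact: normal_second_moment.
by congr EFin; rewrite -[1.*2.+1]/3%N; ring.
Qed.

Lemma integral_normal_shift (m s : R) (f : R -> R) : continuous f ->
  (forall x, 0 <= f x) -> s != 0 ->
  (\int[mu]_x (f (x - m) * normal_pdf m s x)%:E =
   \int[mu]_x (f x * normal_pdf 0 s x)%:E)%E.
Proof.
move=> cf f0 s0.
have D : derive1 (fun x : R => x + m) = cst 1.
  by apply/funext => x; rewrite derive1E deriveD// derive_id derive_cst addr0.
rewrite (@increasing_ge0_integration_by_substitutionT _ (fun x => x + m))//=.
- apply: eq_integral => x _; rewrite D fctE/= mulr1 addrK; congr (_ * _)%:E.
  by rewrite !normal_pdfE//= /normal_fun addrK subr0.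
- by move=> x y; rewrite ltrD2r.
- by rewrite D; move=> x; exact: cvg_cst.
- by rewrite D; exact: is_cvg_cst.
- by rewrite D; exact: is_cvg_cst.
- exact: cvg_addrr_Ny.
- exact: cvg_addrr.
- move=> x; apply: cvgM; last exact: continuous_normal_pdf.
  apply: (@continuous_comp _ _ _ (fun x => x - m) f); last exact: cf.
  by apply: cvgB; [exact: cvg_id|exact: cvg_cst].
- by move=> x; rewrite mulr_ge0// normal_pdf_ge0.
Qed.

Lemma integral_normal_opp (s : R) (f : R -> R) : continuous f ->
  (forall x, 0 <= f x) -> s != 0 ->
  (\int[mu]_x (f (- x) * normal_pdf 0 s x)%:E =
   \int[mu]_x (f x * normal_pdf 0 s x)%:E)%E.
Proof.
move=> cf f0 s0.
pose h (x : R) := (f x * normal_pdf 0 s x)%:E.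
have mh : measurable_fun [set: R] h.
  apply/measurable_EFinP; apply: continuous_measurable_fun => x.
  by apply: cvgM; [exact: cf|exact: continuous_normal_pdf].
transitivity (\int[mu]_x h (- x)%R)%E.
  by apply: eq_integral => x _; rewrite /h !normal_pdf0E// sqrrN.
have h0 x : (0 <= h x)%E by rewrite lee_fin mulr_ge0// normal_pdf_ge0.
transitivity (\int[pushforward mu (-%R : measurableTypeR R -> measurableTypeR R)]_x h x)%E.
  by rewrite ge0_integral_pushforward.
by apply: eq_measure_integral => //= A mA _; exact: lebesgue_measureN.
Qed.
End normal_moments.

Section expectation_of.
Context {d : measure_display} {T : measurableType d} {R : realType}.
Variable P : probability T R.

(** Integrability and the value of the mean travel together, so that linear combinations of
    expectations need no side conditions. *)
Definition hasE (f : T -> R) (r : R) :=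
  P.-integrable [set: T] (EFin \o f) /\ (\int[P]_w (f w)%:E = r%:E)%E.

Lemma hasE_ge0 (f : T -> R) r : measurable_fun [set: T] f ->
  (forall w, 0 <= f w) -> (\int[P]_w (f w)%:E = r%:E)%E -> hasE f r.
Proof.
move=> mf f0 h; split => //; apply/integrableP; split; first exact/measurable_EFinP.
under eq_integral => w _ do rewrite /= ger0_norm//.
by rewrite h ltry.
Qed.

Lemma hasE_D f g a b : hasE f a -> hasE g b -> hasE (fun w => f w + g w) (a + b).
Proof.
move=> [If Ef] [Ig Eg]; split.
  by have := integrableD measurableT If Ig; apply: eq_integrable => // w _.
under eq_integral => w _ do rewrite EFinD.
by rewrite integralD// Ef Eg.
Qed.

Lemma hasE_Z k f a : hasE f a -> hasE (fun w => k * f w) (k * a).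
Proof.
move=> [If Ef]; split.
  by have := integrableZl measurableT k If; apply: eq_integrable => // w _.
under eq_integral => w _ do rewrite EFinM.
by rewrite integralZl// Ef.
Qed.

Lemma hasE_cst k : hasE (fun=> k) k.
Proof.
split.
  by apply: finite_measure_integrable_cst.
by rewrite integral_cst//= probability_setT mule1.
Qed.

Lemma hasE_sum (I : Type) (s : seq I) (Q : pred I) (F : I -> T -> R) (a : I -> R) :
  (forall i, Q i -> hasE (F i) (a i)) ->
  hasE (fun w => \sum_(i <- s | Q i) F i w) (\sum_(i <- s | Q i) a i).
Proof.
move=> h; elim: s => [|i s ih].
  by rewrite big_nil; under eq_fun do rewrite big_nil; exact: hasE_cst.
rewrite big_cons; under eq_fun do rewrite big_cons.
by case: ifP => // Qi; apply: hasE_D => //; exact: h.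
Qed.

Lemma hasE_ext f g a : (forall w, f w = g w) -> hasE f a -> hasE g a.
Proof. by move=> /funext ->. Qed.

Lemma hasE_uniq f a b : hasE f a -> hasE f b -> a = b.
Proof. by move=> [_ h1] [_ h2]; apply: EFin_inj; rewrite -h1 h2. Qed.

Lemma hasE_le f g a b : (forall w, f w <= g w) -> hasE f a -> hasE g b -> a <= b.
Proof.
move=> fg [If Ef] [Ig Eg]; rewrite -lee_fin -Ef -Eg.
by apply: le_integral => // w _; rewrite lee_fin.
Qed.

Lemma integral_law (X : T -> R) (nu : probability (measurableTypeR R) R) (f : R -> \bar R) :
  measurable_fun [set: T] X -> measurable_fun [set: R] f -> (forall x, 0 <= f x)%E ->
  (forall V : set R, measurable V -> P (X @^-1` V) = nu V) ->
  (\int[P]_w f (X w) = \int[nu]_x f x)%E.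
Proof.
move=> mX mf f0 h.
pose Y : {mfun T >-> measurableTypeR R} :=
  HB.pack X (isMeasurableFun.Build _ _ _ (measurableTypeR R) X mX).
transitivity (\int[pushforward P Y]_x f x)%E.
  by rewrite ge0_integral_pushforward.
by apply: eq_measure_integral => //= A mA _; rewrite -h.
Qed.

(** [X - m] is its positive part minus its negative part, and both have the finite integral [r].
    This identifies the location parameter of a Gaussian law with its mean. *)
Lemma law_mean (X : T -> R) (nu : probability (measurableTypeR R) R) (m r : R) :
  measurable_fun [set: T] X ->
  (forall V : set R, measurable V -> P (X @^-1` V) = nu V) ->
  (\int[nu]_x (Num.max (x - m) 0)%:E = r%:E)%E ->
  (\int[nu]_x (Num.max (- (x - m)) 0)%:E = r%:E)%E ->
  hasE X m.
Proof.
move=> mX law h1 h2.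
have mp (f : R -> R) : measurable_fun [set: R] f -> measurable_fun [set: R] (fun x => Num.max (f x) 0).
  by move=> mf; apply: measurable_maxr.
have mf1 : measurable_fun [set: R] (fun x : R => Num.max (x - m) 0).
  by apply: mp; apply: measurable_funB.
have mf2 : measurable_fun [set: R] (fun x : R => Num.max (- (x - m)) 0).
  by apply: mp; apply: measurableT_comp => //; apply: measurable_funB.
have H (f : R -> R) : measurable_fun [set: R] f -> (forall x, 0 <= f x) ->
   (\int[nu]_x (f x)%:E = r%:E)%E -> hasE (fun w => f (X w)) r.
  move=> mf f0 h; apply: hasE_ge0 => //; first exact: measurableT_comp.
  rewrite -h; apply: (@integral_law X nu (EFin \o f)) => //; first exact/measurable_EFinP.
have E1 := H _ mf1 (fun x => ltac:(by rewrite le_max lexx orbT)) h1.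
have E2 := H _ mf2 (fun x => ltac:(by rewrite le_max lexx orbT)) h2.
have := hasE_D (hasE_D E1 (hasE_Z (-1) E2)) (hasE_cst m).
rewrite mulN1r subrr add0r; apply: hasE_ext => w.
case: (leP (X w - m) 0) => h.
  by rewrite maxEle oppr_le0; case: ifP; lra.
by rewrite maxEle oppr_le0; case: ifP; lra.
Qed.

(** The law comes with some location [m], which has to be shown to be 0 before the moments can be
    read off. The last item, the absence of an atom, is what later makes the losses positive. *)
Lemma gaussian_moments (X : T -> R) : measurable_fun [set: T] X ->
  gaussian_rv P X -> 'E_P[X]%E = 0%E ->
  exists v : R, [/\ 0 <= v, hasE (fun w => X w ^+ 2) v,
    hasE (fun w => X w ^+ 4) (3 * v ^+ 2) &
    (v != 0 -> P (X @^-1` [set 0]) = 0%E)].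
Proof.
move=> mX [m [s h]] EX.
have mXn n : measurable_fun [set: R] (EFin \o (fun x : R => x ^+ n)).
  by apply/measurable_EFinP; exact: measurable_funX.
have mp : measurable_fun [set: R] (EFin \o (fun x : R => Num.max (x - m) 0)).
  by apply/measurable_EFinP; apply: measurable_maxr => //; apply: measurable_funB.
have mq : measurable_fun [set: R] (EFin \o (fun x : R => Num.max (- (x - m)) 0)).
  apply/measurable_EFinP; apply: measurable_maxr => //.
  by apply: measurableT_comp => //; apply: measurable_funB.
have pos n (x : R) : ~~ odd n -> (0 <= (x ^+ n)%:E)%E.
  by move=> on; rewrite lee_fin exprn_even_ge0.
have mean0 : hasE X m -> m = 0.
  by move=> [_]; rewrite -[LHS]/(\int[P]_w (X w)%:E)%E; move: EX; rewrite unlock => -> [].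
have E n (nu : probability (measurableTypeR R) R) r : ~~ odd n ->
    (forall V : set R, measurable V -> P (X @^-1` V) = nu V) ->
    (\int[nu]_x (x ^+ n)%:E = r%:E)%E -> hasE (fun w => X w ^+ n) r.
  move=> on law hn; apply: hasE_ge0.
  - exact: measurable_funX.
  - by move=> w; rewrite exprn_even_ge0.
  - by rewrite -hn; apply: (@integral_law X nu (EFin \o (fun x : R => x ^+ n))) => // x; exact: pos.
have [s0|s0] := eqVneq s 0.
  pose nu0 : probability (measurableTypeR R) R := @dirac _ (measurableTypeR R) m R.
  have law (V : set R) : measurable V -> P (X @^-1` V) = nu0 V.
    by move=> mV; rewrite h// /gaussian_law s0 eqxx.
  have m0 : m = 0.
    apply: mean0; apply: (law_mean (r := 0) mX law).
      by rewrite integral_dirac//= ?diracT ?mul1e ?subrr ?maxxx//; exact: mp.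
    by rewrite integral_dirac//= ?diracT ?mul1e ?subrr ?oppr0 ?maxxx//; exact: mq.
  exists 0; split => //.
  - by apply: (E 2%N _ 0 _ law) => //; rewrite integral_dirac ?diracT ?mul1e ?m0 ?expr0n//; exact: mXn.
  - by apply: (E 4%N _ _ _ law) => //; rewrite integral_dirac ?diracT ?mul1e ?m0 ?expr0n/= ?mulr0//; exact: mXn.
  - by rewrite eqxx.
have law (V : set R) : measurable V -> P (X @^-1` V) = (normal_prob m s) V.
  by move=> mV; rewrite h// /gaussian_law (negbTE s0).
have cm : continuous (fun x : R => Num.max x 0).
  by move=> x; apply: continuous_max; [exact: cvg_id|exact: cvg_cst].
have m0 : m = 0.
  apply: mean0.
  pose r := (\int[@lebesgue_measure R]_x (Num.max x 0 * normal_pdf 0 s x)%:E)%E.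
  have rf : r \is a fin_num.
    rewrite ge0_fin_numE; last first.
      by apply: integral_ge0 => x _; rewrite lee_fin mulr_ge0 ?normal_pdf_ge0// le_max lexx orbT.
    (* The positive part of [x] is at most [1 + x ^ 2], which makes [r] finite. *)
    apply: (@le_lt_trans _ _ (\int[@lebesgue_measure R]_x
        ((normal_pdf 0 s x)%:E + (x ^+ 2 * normal_pdf 0 s x)%:E))%E).
      apply: ge0_le_integral => //.
      - by move=> x _; rewrite lee_fin mulr_ge0 ?normal_pdf_ge0// le_max lexx orbT.
      - apply/measurable_EFinP/measurable_funM; last exact: measurable_normal_pdf.
        exact: continuous_measurable_fun.
      - apply/measurable_EFinP/measurable_funD; first exact: measurable_normal_pdf.
        by apply: measurable_funM; [exact: measurable_funX|exact: measurable_normal_pdf].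
      - move=> x _; rewrite -EFinD lee_fin -[X in X + _]mul1r -mulrDl.
        rewrite ler_wpM2r ?normal_pdf_ge0// ge_max; apply/andP; split; nra.
    rewrite ge0_integralD//.
    - by rewrite integral_normal_pdf normal_second_moment// -EFinD ltry.
    - by move=> x _; rewrite lee_fin normal_pdf_ge0.
    - by apply/measurable_EFinP; exact: measurable_normal_pdf.
    - by move=> x _; rewrite lee_fin mulr_ge0 ?sqr_ge0// normal_pdf_ge0.
    - by apply/measurable_EFinP/measurable_funM; [exact: measurable_funX|exact: measurable_normal_pdf].
  have cn : continuous (fun x : R => Num.max (- x) 0).
    by move=> x; apply: continuous_max; [apply: cvgN; exact: cvg_id|exact: cvg_cst].
  apply: (law_mean (r := fine r) mX law); rewrite fineK// ge0_integral_normal_prob//=.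
  - under eq_integral do rewrite -EFinM.
    rewrite (@integral_normal_shift _ m s (fun x => Num.max x 0))//.
    by move=> x; rewrite le_max lexx orbT.
  - by move=> x; rewrite lee_fin le_max lexx orbT.
  - under eq_integral do rewrite -EFinM.
    rewrite (@integral_normal_shift _ m s (fun x => Num.max (- x) 0))//; last first.
      by move=> x; rewrite le_max lexx orbT.
    rewrite (@integral_normal_opp _ s (fun x => Num.max x 0))//.
    by move=> x; rewrite le_max lexx orbT.
  - by move=> x; rewrite lee_fin le_max lexx orbT.
subst m.
exists (s ^+ 2); split.
- exact: sqr_ge0.
- apply: (E 2%N _ _ _ law) => //; rewrite ge0_integral_normal_prob//.
    by rewrite -normal_second_moment.
    exact: mXn.
  by move=> x; rewrite lee_fin exprn_even_ge0.
- apply: (E 4%N _ _ _ law) => //; rewrite ge0_integral_normal_prob//.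
    by rewrite -normal_fourth_moment.
    exact: mXn.
  by move=> x; rewrite lee_fin exprn_even_ge0.
- move=> _; rewrite law//.
  have /null_content_dominatesP := normal_prob_dominates 0 s; apply => //.
  exact: lebesgue_measure_set1.
Qed.
End expectation_of.

(** * Gaussian chaos of order one and two *)

Lemma eq_lew (disp : Order.disp_t) (U : porderType disp) (x y : U) : x = y -> (x <= y)%O.
Proof. by move->. Qed.

Lemma mul2_le_add (R : realFieldType) (x y z : R) : 0 <= x -> 0 <= y ->
  z ^+ 2 <= x * y -> 2 * z <= x + y.
Proof.
move=> x0 y0 h; apply: le_trans (ler_norm _) _.
rewrite -(@ler_pXn2r _ 2)// ?nnegrE ?addr_ge0// real_normK ?num_real//.
by have := sqr_ge0 (x - y); rewrite !expr2 in h *; nra.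
Qed.

Section gaussian_chaos.
Context {d : measure_display} {T : measurableType d} {R : realType}.
Variable P : probability T R.
Local Notation hasE := (hasE P).

Section isserlis.
Variables (n : nat) (Y : 'I_n -> T -> R).
Local Notation delta i j := ((i == j)%:R : R).
Hypothesis Y2 : forall i j, hasE (fun w => Y i w * Y j w) (delta i j).
Hypothesis YG : forall c : 'I_n -> R, exists v,
  hasE (fun w => (\sum_i c i * Y i w) ^+ 2) v /\
  hasE (fun w => (\sum_i c i * Y i w) ^+ 4) (3 * v ^+ 2).

Lemma sum_delta (i : 'I_n) (f : 'I_n -> R) : \sum_j delta j i * f j = f i.
Proof.
rewrite (bigD1 i)//= eqxx mul1r big1 ?addr0// => j /negbTE ->.
by rewrite mul0r.
Qed.

(** A centred Gaussian combination has fourth moment three times its squared variance, and the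
    variance expands through [Y2]. The first coefficient may stay 1, since polarization varies only
    the three other signs. *)
Lemma fourth_moment4 (i j k l : 'I_n) (b c e : R) :
  hasE (fun w => (Y i w + b * Y j w + c * Y k w + e * Y l w) ^+ 4)
   (3 * (delta i i + b ^+ 2 * delta j j + c ^+ 2 * delta k k + e ^+ 2 * delta l l
     + 2 * b * delta i j + 2 * c * delta i k + 2 * e * delta i l
     + 2 * b * c * delta j k + 2 * b * e * delta j l + 2 * c * e * delta k l) ^+ 2).
Proof.
have [v] := YG (fun m => delta m i + b * delta m j + c * delta m k + e * delta m l).
have E w : \sum_m (delta m i + b * delta m j + c * delta m k + e * delta m l) * Y m w =
    Y i w + b * Y j w + c * Y k w + e * Y l w.
  under eq_bigr => m _ do rewrite !mulrDl -!mulrA.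
  by rewrite !big_split/= -!mulr_sumr !sum_delta.
under eq_fun do rewrite E.
under [X in _ /\ hasE X _]eq_fun do rewrite E.
move=> [E2 E4].
suff <- : v = (delta i i + b ^+ 2 * delta j j + c ^+ 2 * delta k k + e ^+ 2 * delta l l
     + 2 * b * delta i j + 2 * c * delta i k + 2 * e * delta i l
     + 2 * b * c * delta j k + 2 * b * e * delta j l + 2 * c * e * delta k l) by [].
apply: hasE_uniq E2 _.
apply: hasE_ext; last first.
  do 9 (apply: hasE_D; last by apply: hasE_Z; exact: Y2). exact: Y2.
by move=> w /=; ring.
Qed.

(* polarization: 192 abcd is the alternating sum of the (a +- b +- c +- d)^4 *)
Lemma isserlis (i j k l : 'I_n) :
  hasE (fun w => Y i w * Y j w * (Y k w * Y l w))
    (delta i j * delta k l + delta i k * delta j l + delta i l * delta j k).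
Proof.
have E b c e := hasE_Z (b * c * e / 192) (fourth_moment4 i j k l b c e).
have := hasE_D (hasE_D (hasE_D (E 1 1 1) (E 1 1 (-1))) (hasE_D (E 1 (-1) 1) (E 1 (-1) (-1))))
  (hasE_D (hasE_D (E (-1) 1 1) (E (-1) 1 (-1))) (hasE_D (E (-1) (-1) 1) (E (-1) (-1) (-1)))).
set a := (X in hasE _ X); set f := (X in hasE X _).
suff -> : a = delta i j * delta k l + delta i k * delta j l + delta i l * delta j k.
  by apply: hasE_ext => w; rewrite /f; field.
by rewrite /a; field.
Qed.

Definition chaos1 (g : 'cV[R]_n) (w : T) : R := \sum_i g i 0 * Y i w.

Definition chaos2 (C : 'M[R]_n) (w : T) : R :=
  \sum_i \sum_j C i j * (Y i w * Y j w - delta i j).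

Lemma chaos1_sq (g : 'cV[R]_n) :
  hasE (fun w => chaos1 g w ^+ 2) (\sum_i g i 0 ^+ 2).
Proof.
have -> : \sum_i g i 0 ^+ 2 = \sum_i \sum_j (g i 0 * g j 0) * delta i j.
  apply: eq_bigr => i _; under eq_bigr => j _ do rewrite mulrC eq_sym.
  by rewrite sum_delta expr2.
apply: hasE_ext; last first.
  by apply: hasE_sum => i _; apply: hasE_sum => j _; apply: hasE_Z; exact: Y2.
move=> w; rewrite expr2 /chaos1 big_distrlr/=; apply: eq_bigr => i _; apply: eq_bigr => j _.
by rewrite /=; ring.
Qed.

(** By [isserlis] two centred products have covariance [delta i k * delta j l + delta i l * delta j
    k]; the first term yields the squared norm of [C], the second its product with its transpose. *)
Lemma chaos2_sq (C : 'M[R]_n) :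
  hasE (fun w => chaos2 C w ^+ 2)
    (\sum_i \sum_j C i j ^+ 2 + \sum_i \sum_j C i j * C j i).
Proof.
have K i j k l : hasE (fun w => (Y i w * Y j w - delta i j) * (Y k w * Y l w - delta k l))
    (delta i k * delta j l + delta i l * delta j k).
  have := hasE_D (hasE_D (isserlis i j k l) (hasE_Z (- delta k l) (Y2 i j)))
    (hasE_D (hasE_Z (- delta i j) (Y2 k l)) (hasE_cst P (delta i j * delta k l))).
  set a := (X in hasE _ X); set f := (X in hasE X _).
  suff -> : a = delta i k * delta j l + delta i l * delta j k.
    by apply: hasE_ext => w; rewrite /f; ring.
  by rewrite /a; ring.
have -> : \sum_i \sum_j C i j ^+ 2 + \sum_i \sum_j C i j * C j i =
   \sum_i \sum_j \sum_k \sum_l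
     (C i j * C k l) * (delta i k * delta j l + delta i l * delta j k).
  rewrite -big_split/=; apply: eq_bigr => i _.
  rewrite -big_split/=; apply: eq_bigr => j _.
  transitivity (\sum_k (delta k i * (C i j * C k j) + delta k j * (C i j * C k i))).
    by rewrite big_split/= !sum_delta expr2.
  apply: eq_bigr => k _; rewrite -[in LHS](sum_delta j (fun l => delta k i * (C i j * C k l))).
  rewrite -[X in _ + X](sum_delta i (fun l => delta k j * (C i j * C k l))).
  rewrite -big_split/=; apply: eq_bigr => l _.
  rewrite (eq_sym i k) (eq_sym j l) (eq_sym i l) (eq_sym j k); ring.
apply: hasE_ext; last first.
  apply: hasE_sum => i _; apply: hasE_sum => j _; apply: hasE_sum => k _; apply: hasE_sum => l _.
  by apply: hasE_Z; exact: K.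
move=> w; rewrite expr2 /chaos2 big_distrlr/=; apply: eq_bigr => i _.
under [RHS]eq_bigr => k _ do rewrite big_distrlr/=.
rewrite [RHS]exchange_big/=; apply: eq_bigr => j _; apply: eq_bigr => k _; apply: eq_bigr => l _.
ring.
Qed.
End isserlis.

Section gram_schmidt.
Variables (p q : nat).
Implicit Types A B : 'M[R]_(p, q).

Definition mxdot A B : R := \sum_i \sum_j A i j * B i j.

Lemma mxdotC A B : mxdot A B = mxdot B A.
Proof. by apply: eq_bigr => i _; apply: eq_bigr => j _; rewrite mulrC. Qed.

Lemma mxdotDl A B C : mxdot (A + B) C = mxdot A C + mxdot B C.
Proof.
rewrite -big_split/=; apply: eq_bigr => i _; rewrite -big_split/=.
by apply: eq_bigr => j _; rewrite mxE mulrDl.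
Qed.

Lemma mxdotZl k A C : mxdot (k *: A) C = k * mxdot A C.
Proof.
rewrite mulr_sumr; apply: eq_bigr => i _; rewrite mulr_sumr.
by apply: eq_bigr => j _; rewrite mxE mulrA.
Qed.

Lemma mxdotDr A B C : mxdot C (A + B) = mxdot C A + mxdot C B.
Proof. by rewrite mxdotC mxdotDl !(mxdotC _ C). Qed.

Lemma mxdotZr k A C : mxdot C (k *: A) = k * mxdot C A.
Proof. by rewrite mxdotC mxdotZl mxdotC. Qed.

Lemma mxdot_ge0 A : 0 <= mxdot A A.
Proof. by apply: sumr_ge0 => i _; apply: sumr_ge0 => j _; rewrite -expr2 sqr_ge0. Qed.

Lemma mxdot_eq0 A : mxdot A A = 0 -> A = 0.
Proof.
move=> /eqP; rewrite psumr_eq0 => [|i _]; last first.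
  by apply: sumr_ge0 => j _; rewrite -expr2 sqr_ge0.
move=> /allP h; apply/matrixP => i j; rewrite mxE.
have := h i (mem_index_enum i); rewrite /= psumr_eq0 => [/allP|k _]; last first.
  by rewrite -expr2 sqr_ge0.
by move=> /(_ j (mem_index_enum j))/=; rewrite -expr2 sqrf_eq0 => /eqP.
Qed.

(** Encoded by recursion on the generators, so that peeling off one generator is one step of
    Gram-Schmidt orthogonalisation. *)
Fixpoint mxspan (s : seq 'M[R]_(p, q)) A : Prop :=
  if s is B :: s' then exists a, mxspan s' (A - a *: B) else A = 0.

Lemma mxspan0 s : mxspan s 0.
Proof. by elim: s => //= B s ih; exists 0; rewrite scale0r subr0. Qed.

Lemma mxspanD s A B : mxspan s A -> mxspan s B -> mxspan s (A + B).
Proof.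
elim: s A B => [A B /= -> ->|C s ih A B /= [a ha] [b hb]]; first by rewrite addr0.
by exists (a + b); have := ih _ _ ha hb; rewrite scalerDl opprD addrACA.
Qed.

Lemma mxspanZ s k A : mxspan s A -> mxspan s (k *: A).
Proof.
elim: s A => [A /= ->|C s ih A /= [a ha]]; first by rewrite scaler0.
by exists (k * a); have := ih _ ha; rewrite scalerBr scalerA.
Qed.

Lemma mxspan_mem s A : A \in s -> mxspan s A.
Proof.
elim: s => // B s ih; rewrite inE => /orP[/eqP <-|/ih h] /=.
  by exists 1; rewrite scale1r subrr; exact: mxspan0.
by exists 0; rewrite scale0r subr0.
Qed.

Lemma mxspan_sum (I : Type) (r : seq I) (Q : pred I) (F : I -> 'M[R]_(p, q)) s :
  (forall i, Q i -> mxspan s (F i)) -> mxspan s (\sum_(i <- r | Q i) F i).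
Proof. by move=> h; apply: big_ind => //; [exact: mxspan0|exact: mxspanD]. Qed.

Variable (F : 'M[R]_(p, q) -> T -> R) (K : R).
Hypothesis K0 : 0 <= K.
Hypothesis FD : forall A B w, F (A + B) w = F A w + F B w.
Hypothesis FZ : forall k A w, F (k *: A) w = k * F A w.
Hypothesis FE : forall A, exists2 r, hasE (fun w => F A w ^+ 2) r & r <= K * mxdot A A.

(* the supremum over [A] of [F A ^ 2 / mxdot A A] is a sum of squares over an
   orthonormal basis of the span, which has bounded expectation *)
Lemma mxspan_sup (s : seq 'M[R]_(p, q)) :
  (forall A, exists B, mxspan s B /\ forall C, mxspan s C -> mxdot (A - B) C = 0) /\
  exists W : T -> R, [/\ forall w, 0 <= W w,
     exists2 r, hasE W r & r <= K * (size s)%:R &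
     forall w A, mxspan s A -> F A w ^+ 2 <= W w * mxdot A A].
Proof.
(* The induction carries orthogonal projections onto the span along with [W], because the next step
   needs the component [E] of the new generator orthogonal to the span. *)
elim: s => [|B s [proj [W [W0 [r rE rK] WF]]]].
  split=> [A|].
    exists 0; split => // C /= ->; rewrite -(scale0r A) mxdotZr mul0r//.
  exists (fun=> 0); split => //; first by exists 0; [exact: hasE_cst|rewrite mulr0].
  move=> w A /= ->; have F0 : F 0 w = 0 by rewrite -(scale0r 0) FZ mul0r.
  by rewrite F0 expr0n/= mul0r.
have [B0 [sB0 oB0]] := proj B; set E := B - B0 in oB0.
have split_span A : mxspan (B :: s) A -> exists a A', mxspan s A' /\ A = a *: E + A'.
  move=> /= [a ha]; exists a, ((A - a *: B) + a *: B0); split.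
    by apply: mxspanD => //; exact: mxspanZ.
  by rewrite /E; apply/matrixP => i j; rewrite !mxE; ring.
(* If [E] vanishes, the span has not grown and the old [W] still serves. *)
have [EE0|EE0] := eqVneq (mxdot E E) 0.
  have E0 := mxdot_eq0 EE0.
  have sub A : mxspan (B :: s) A -> mxspan s A.
    by move=> /split_span[a [A' [sA' ->]]]; rewrite E0 scaler0 add0r.
  split=> [A|].
    have [C [sC oC]] := proj A; exists C; split; last by move=> D /sub; exact: oC.
    by exists 0; rewrite scale0r subr0.
  exists W; split => //; last by move=> w A /sub; exact: WF.
  exists r => //; rewrite (le_trans rK)//= -natr1 mulrDr lerDl mulr1//.
split=> [A|].
  have [C [sC oC]] := proj A.
  exists (C + (mxdot A E / mxdot E E) *: E); split.
    exists (mxdot A E / mxdot E E).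
    rewrite (_ : _ - _ = C + (- (mxdot A E / mxdot E E)) *: B0).
      by apply: mxspanD => //; exact: mxspanZ.
    by rewrite /E; apply/matrixP => i j; rewrite !mxE; ring.
  move=> D /split_span[a [D' [sD' ->]]].
  have N X Y : mxdot (- X) Y = - mxdot X Y by rewrite -scaleN1r mxdotZl mulN1r.
  have oED' : mxdot E D' = 0 by exact: oB0.
  have CE : mxdot C E = 0 by rewrite mxdotC; exact: oB0.
  have := oC _ sD'.
  clearbody E; rewrite !mxdotDr !mxdotZr !mxdotDl !N !mxdotDl !mxdotZl oED' CE => h.
  have -> : mxdot A D' = mxdot C D' by apply/eqP; rewrite -subr_eq0; apply/eqP; rewrite -h.
  by field.
have [r' h1 h2] := FE E.
(* The new orthogonal direction contributes [(F E)^2 / |E|^2], whose expectation is at most [K]. *)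
exists (fun w => W w + (mxdot E E)^-1 * F E w ^+ 2); split.
- by move=> w; rewrite addr_ge0// mulr_ge0 ?sqr_ge0// invr_ge0 mxdot_ge0.
- exists (r + (mxdot E E)^-1 * r'); first by apply: hasE_D => //; exact: hasE_Z.
  rewrite /= -natr1 mulrDr mulr1 lerD//.
  by rewrite mulrC ler_pdivrMr// lt_neqAle eq_sym EE0 mxdot_ge0.
- move=> w A /split_span[a [A' [sA' ->]]].
  have o : mxdot E A' = 0 by exact: oB0.
  clearbody E; rewrite FD FZ mxdotDl !mxdotDr !mxdotZl !mxdotZr o (mxdotC A') o !mulr0 !addr0 add0r.
  have := WF w _ sA'.
  have := mxdot_ge0 A'; have : 0 < mxdot E E by rewrite lt_neqAle eq_sym EE0 mxdot_ge0.
  move: (mxdot E E) (mxdot A' A') (F E w) (F A' w) (W w) (W0 w) => e m f g ww ww0 e0 m0 gw.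
  set h := e^-1 * f ^+ 2.
  have fh : f ^+ 2 = e * h by rewrite /h mulrA divff ?mul1r// gt_eqF.
  have h0 : 0 <= h by rewrite mulr_ge0 ?sqr_ge0// invr_ge0 ltW.
  have ae0 : 0 <= a ^+ 2 * e by rewrite mulr_ge0 ?sqr_ge0 ?(ltW e0).
  (* Cauchy-Schwarz for the cross term of the square of [a * F E + F A']. *)
  have z : (a * f * g) ^+ 2 <= (ww * (a ^+ 2 * e)) * (h * m).
    rewrite !exprMn fh [leLHS](_ : _ = (a ^+ 2 * e * h) * g ^+ 2); last by ring.
    rewrite [leRHS](_ : _ = (a ^+ 2 * e * h) * (ww * m)); last by ring.
    by rewrite ler_wpM2l// mulr_ge0.
  have := mul2_le_add _ _ z.
  move=> /(_ (mulr_ge0 ww0 ae0) (mulr_ge0 h0 m0)) z2.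
  rewrite [leLHS](_ : _ = a ^+ 2 * f ^+ 2 + 2 * (a * f * g) + g ^+ 2); last by ring.
  rewrite fh [leRHS](_ : _ = a ^+ 2 * (e * h) + (ww * (a ^+ 2 * e) + h * m) + ww * m); last by ring.
  by rewrite !lerD.
Qed.
End gram_schmidt.
End gaussian_chaos.

(** * Entropy and generalised least squares *)

(** With [b] the square root of [a], [ln a = 2 ln b <= 2 (b - 1)] gives [a - 1 - ln a >= (b - 1)^2],
    while [(a - 1)^2 = (b + 1)^2 (b - 1)^2] and [(b + 1)^2 <= 2 (1 + C)]. *)
Lemma sub1_ln_ge (R : realType) (C a : R) : 0 < a -> a <= C ->
  (a - 1) ^+ 2 <= 2 * (1 + C) * (a - 1 - ln a).
Proof.
move=> a0 aC; set b := Num.sqrt a.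
have b0 : 0 < b by rewrite sqrtr_gt0.
have ab : a = b ^+ 2 by rewrite sqr_sqrtr// ltW.
have h : ln a <= 2 * (b - 1).
  have : ln b <= b - 1 by have := @le_ln1Dx R (b - 1); rewrite (addrC 1) subrK; apply; lra.
  by rewrite ab lnXn// mulr2n; lra.
apply: (@le_trans _ _ (2 * (1 + C) * (b - 1) ^+ 2)).
  have : b ^+ 2 <= C by rewrite -ab.
  rewrite ab; move: (b) b0 => t t0 tC.
  have -> : (t ^+ 2 - 1) ^+ 2 = (1 + t) ^+ 2 * (t - 1) ^+ 2 by ring.
  rewrite ler_wpM2r ?sqr_ge0//.
  by have := sqr_ge0 (t - 1); rewrite !expr2 in tC *; nra.
rewrite ler_wpM2l ?mulr_ge0 ?addr_ge0// ?(le_trans (ltW a0))//.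
by rewrite ab in h *; rewrite expr2 in h *; nra.
Qed.

Section entropy_bound.
Variable R : realType.

Definition dot (n : nat) (x y : 'cV[R]_n) : R := (x^T *m y) 0 0.

Lemma dotE n (x y : 'cV[R]_n) : dot x y = mxdot x y.
Proof. by rewrite /dot mxE; apply: eq_bigr => i _; rewrite big_ord1 mxE. Qed.

Section dot_bilinear.
Variable n : nat.
Implicit Types x y z : 'cV[R]_n.

Lemma dotC x y : dot x y = dot y x. Proof. by rewrite !dotE mxdotC. Qed.
Lemma dotDl x y z : dot (x + y) z = dot x z + dot y z.
Proof. by rewrite !dotE mxdotDl. Qed.
Lemma dotDr x y z : dot z (x + y) = dot z x + dot z y.
Proof. by rewrite !dotE mxdotDr. Qed.
Lemma dotZl k x y : dot (k *: x) y = k * dot x y.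
Proof. by rewrite !dotE mxdotZl. Qed.
Lemma dotZr k x y : dot x (k *: y) = k * dot x y.
Proof. by rewrite !dotE mxdotZr. Qed.
Lemma dotNr x y : dot x (- y) = - dot x y.
Proof. by rewrite -scaleN1r dotZr mulN1r. Qed.
End dot_bilinear.

Lemma mxdot_tr m n (A B : 'M[R]_(m, n)) : mxdot A B = \tr (A^T *m B).
Proof.
rewrite /mxdot exchange_big /mxtrace; apply: eq_bigr => j _.
by rewrite mxE; apply: eq_bigr => i _; rewrite mxE.
Qed.

Lemma mxdot_mulr m n p (A : 'M[R]_(m, n)) (B : 'M[R]_(m, p)) (C : 'M[R]_(p, n)) :
  mxdot A (B *m C) = mxdot (B^T *m A) C.
Proof. by rewrite !mxdot_tr trmx_mul trmxK mulmxA. Qed.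

Lemma mxdot_trmx m n (A B : 'M[R]_(m, n)) : mxdot A^T B^T = mxdot A B.
Proof.
rewrite /mxdot exchange_big; apply: eq_bigr => i _; apply: eq_bigr => j _.
by rewrite !mxE.
Qed.

Lemma mxdot_block m1 m2 n1 n2 (a a' : 'M[R]_(m1, n1)) (b b' : 'M[R]_(m1, n2))
    (c c' : 'M[R]_(m2, n1)) (d d' : 'M[R]_(m2, n2)) :
  mxdot (block_mx a b c d) (block_mx a' b' c' d') =
  mxdot a a' + mxdot b b' + mxdot c c' + mxdot d d'.
Proof.
rewrite /mxdot big_split_ord/= -[RHS]addrA -!big_split/=; congr (_ + _).
  apply: eq_bigr => i _; rewrite big_split_ord/=; congr (_ + _).
    by apply: eq_bigr => j _; rewrite !block_mxEul.
  by apply: eq_bigr => j _; rewrite !block_mxEur.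
apply: eq_bigr => i _; rewrite big_split_ord/=; congr (_ + _).
  by apply: eq_bigr => j _; rewrite !block_mxEdl.
by apply: eq_bigr => j _; rewrite !block_mxEdr.
Qed.

Lemma mxdot_mx11 (a b : 'M[R]_1) : mxdot a b = a 0 0 * b 0 0.
Proof. by rewrite /mxdot !big_ord1. Qed.

Definition quad (n : nat) (H : 'M[R]_n) (x : 'cV[R]_n) : R := dot x (H *m x).

Definition entropy (n : nat) (H : 'M[R]_n) : R := \tr H - n%:R - ln (\det H).

(** The matrix version of [sub1_ln_ge], by induction on the dimension through Schur complements
    rather than eigenvalues. Let [a] be the first diagonal entry, [B] the squared norm of the column
    below it and [r = B / a]. Splitting them off, the entropy loses [a - 1 - ln a + r], and the
    squared norm loses [(a - 1)^2] plus terms that add up to at most [5 C r]; hence the factor 5. *)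
Lemma entropy_ge (n : nat) (C : R) (H : 'M[R]_n) : 0 <= C -> H^T = H ->
  (forall x, x != 0 -> 0 < quad H x) -> (forall x, quad H x <= C * dot x x) ->
  0 < \det H /\ mxdot (H - 1%:M) (H - 1%:M) <= 5 * (1 + C) * entropy H.
Proof.
move=> C0; elim: n H => [|n ih].
  move=> H _ _ _; rewrite det_mx00 ltr01; split => //.
  by rewrite /entropy det_mx00 ln1 /mxtrace /mxdot !big_ord0; lra.
rewrite -[n.+1]/(1 + n)%N => H Hs Hp HC.
pose a := H 0 0; pose b := dlsubmx H; pose D := drsubmx H.
have HE : H = block_mx a%:M b^T b D.
  rewrite -[LHS]submxK; congr block_mx.
    by apply/matrixP => i j; rewrite !ord1 !mxE eqxx mulr1n; congr (H _ _); apply/val_inj.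
  by rewrite /b trmx_dlsub Hs.
have Ds : D^T = D by rewrite /D trmx_drsub Hs.
have mxb (y : 'cV_n) : b^T *m y = (dot b y)%:M by rewrite [LHS]mx11_scalar.
have dotcol s (y : 'cV_n) s' (y' : 'cV_n) :
    dot (col_mx s%:M y : 'cV_(1 + n)) (col_mx s'%:M y') = s * s' + dot y y'.
  by rewrite /dot tr_col_mx mul_row_col mxE tr_scalar_mx -scalar_mxM mxE eqxx mulr1n.
have quadH s y : quad H (col_mx s%:M y) = a * s ^+ 2 + 2 * s * dot b y + quad D y.
  rewrite /quad HE mul_block_col mxb -scalar_mxM -raddfD/= dotcol mul_mx_scalar.
  by rewrite dotDr dotZr (dotC y b); ring.
have z0 : dot (0 : 'cV[R]_n) 0 = 0 by rewrite /dot mulmx0 mxE.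
have D0 : quad D 0 = 0 by rewrite /quad mulmx0.
have b00 : dot b 0 = 0 by rewrite /dot mulmx0 mxE.
have a0 : 0 < a.
  have := Hp (col_mx 1%:M 0); rewrite quadH b00 D0 mulr0 !addr0 expr1n mulr1; apply.
  by rewrite col_mx_eq0 negb_and -scalemx1 scaler_eq0 !oner_eq0.
(* The Schur complement. Its form at [y] is that of [H] at the lift of [y] with the best first
   coordinate, so it is positive; it is also at most the form of [D]. *)
pose D' := D - a^-1 *: (b *m b^T).
have D'D y : quad D' y = quad D y - a^-1 * dot b y ^+ 2.
  rewrite /quad /D' mulmxBl -scalemxAl -mulmxA mxb mul_mx_scalar scalerA.
  by rewrite dotDr dotNr dotZr (dotC y b); ring.
have schur y : quad D' y = quad H (col_mx (- (a^-1 * dot b y))%:M y).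
  by rewrite D'D quadH; field; rewrite gt_eqF.
have D's : D'^T = D' by rewrite /D' linearB/= linearZ/= trmx_mul trmxK Ds.
have D'p y : y != 0 -> 0 < quad D' y.
  by move=> y0; rewrite schur; apply: Hp; rewrite col_mx_eq0 negb_and y0 orbT.
have quadD y : quad D y <= C * dot y y.
  have := HC (col_mx 0%:M y); rewrite quadH dotcol.
  by rewrite expr0n/= !mulr0 !mul0r !add0r.
have D'C y : quad D' y <= C * dot y y.
  by rewrite (le_trans _ (quadD y))// D'D lerBlDr lerDl mulr_ge0 ?sqr_ge0// invr_ge0 ltW.
have [dD' IH] := ih _ D's D'p D'C.
have detE : \det H = a * \det D'.
  have -> : H = block_mx 1%:M 0 (a^-1 *: b) 1%:M *m block_mx a%:M b^T 0 D'.
    rewrite mulmx_block !mul1mx !mul0mx !addr0 mul_mx_scalar scalerA divff ?gt_eqF//.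
    by rewrite scale1r -scalemxAl /D' addrC subrK.
  by rewrite det_mulmx det_lblock det_ublock !det1 !mul1r det_scalar expr1.
split; first by rewrite detE mulr_gt0.
have aC : a <= C.
  have := HC (col_mx 1%:M 0); rewrite quadH dotcol b00 D0 z0.
  by rewrite mulr0 !addr0 expr1n !mulr1.
set B := dot b b.
have B0 : 0 <= B by rewrite /B dotE mxdot_ge0.
(* Positivity of the Schur complement at [b] bounds [B^2 / a] by [quad D b <= C B]. *)
have BaC : B <= a * C.
  have [->|Bn0] := eqVneq B 0; first by rewrite mulr_ge0// ltW.
  have Bp : 0 < B by rewrite lt_neqAle eq_sym Bn0.
  have : 0 <= quad D' b.
    by have [->|/D'p/ltW//] := eqVneq b 0; rewrite /quad mulmx0 z0.
  rewrite D'D -/B subr_ge0 => /le_trans/(_ (quadD b)); rewrite -/B.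
  by rewrite expr2 mulrA ler_pM2r// ler_pdivrMl.
have trE : \tr H = a + \tr D' + a^-1 * B.
  rewrite HE mxtrace_block mxtrace_scalar mulr1n /D' linearB/= linearZ/= mxtrace_mulC mxb mxtrace_scalar mulr1n -/B.
  by rewrite -addrA subrK.
have nE : mxdot (H - 1%:M) (H - 1%:M) = (a - 1) ^+ 2 + 2 * B +
    (mxdot (D' - 1%:M) (D' - 1%:M) + 2 * a^-1 * (quad D' b - B) + (a^-1 * B) ^+ 2).
  have rank1 (M : 'M[R]_n) : M^T = M -> mxdot M (b *m b^T) = quad M b.
    move=> Ms; rewrite mxdot_mulr -{1}Ms -trmx_mul mxdot_trmx mxdotC /quad dotE//.
  have -> : H - 1%:M = block_mx (a - 1)%:M b^T b (D - 1%:M).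
    rewrite HE (@scalar_mx_block _ 1 n) opp_block_mx add_block_mx !subr0.
    by rewrite [in RHS]raddfB.
  have -> : D - 1%:M = (D' - 1%:M) + a^-1 *: (b *m b^T).
    by rewrite /D' addrAC subrK.
  rewrite mxdot_block mxdot_mx11 mxdot_trmx -!dotE -/B mxE eqxx mulr1n.
  have -> : quad D' b - B = quad (D' - 1%:M) b.
    by rewrite /quad [in RHS]mulmxBl mul1mx /B !dotE -[in RHS]scaleN1r [in RHS]mxdotDr mxdotZr mulN1r.
  have Ms : (D' - 1%:M)^T = D' - 1%:M by rewrite linearB/= D's trmx1.
  have qbb : quad (b *m b^T) b = B ^+ 2.
    by rewrite /quad -mulmxA mxb mul_mx_scalar dotZr expr2.
  move: (D' - 1%:M) Ms => M Ms.
  rewrite !mxdotDl !mxdotDr !mxdotZl !mxdotZr (mxdotC (b *m b^T) M) !rank1 ?qbb//; last first.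
    by rewrite trmx_mul trmxK.
  ring.
rewrite nE /entropy detE lnM ?posrE// trE.
have h1 := sub1_ln_ge a0 aC.
have h2 := D'C b; rewrite -/B in h2.
move: IH; rewrite /entropy.
rewrite -[(1 + n)%:R]/((1 + n)%N%:R) natrD.
set N := (mxdot _ _); set l := ln a; set l' := ln _; set q := quad D' b in h2 *.
move: (\tr D') => t.
set r := a^-1 * B.
have Br : B = a * r by rewrite /r mulrA divff ?mul1r// gt_eqF.
have r0 : 0 <= r by rewrite mulr_ge0// invr_ge0 ltW.
have rC : r <= C by rewrite -(ler_pM2l a0) -Br.
have -> : 2 * a^-1 * (q - B) = 2 * (a^-1 * q) - 2 * r by rewrite /r; ring.
have qr : a^-1 * q <= C * r.
  by rewrite /r mulrCA ler_wpM2l// invr_ge0 ltW.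
rewrite Br => IH.
have -> : 5 * (1 + C) * (a + t + r - (1%:R + n%:R) - (l + l')) =
   5 * (1 + C) * (t - n%:R - l') + 5 * (1 + C) * r + 5 * (1 + C) * (a - 1 - l) by ring.
have p : 0 <= a - 1 - l.
  have := sqr_ge0 (a - 1); move/le_trans => /(_ _ h1).
  by rewrite pmulr_rge0// mulr_gt0//; lra.
have rr : r * r <= C * r by rewrite ler_wpM2r.
have ar : a * r <= C * r by rewrite ler_wpM2r.
have : 2 * (1 + C) * (a - 1 - l) <= 5 * (1 + C) * (a - 1 - l).
  by rewrite ler_wpM2r// ler_wpM2r//; lra.
rewrite (expr2 r) => h5; have := le_trans h1 h5; lra.
Qed.
End entropy_bound.

Section dot_theory.
Variables (R : realType) (n : nat).
Implicit Types (x y z : 'cV[R]_n) (H : 'M[R]_n).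

Lemma dot_ge0 x : 0 <= dot x x. Proof. by rewrite dotE mxdot_ge0. Qed.
Lemma dot_eq0 x : dot x x = 0 -> x = 0. Proof. by rewrite dotE => /mxdot_eq0. Qed.

Lemma dot_mulmx m (M : 'M[R]_(n, m)) x (y : 'cV[R]_m) :
  dot x (M *m y) = dot (M^T *m x) y.
Proof. by rewrite /dot trmx_mul trmxK mulmxA. Qed.

Lemma dot_symm H x y : H^T = H -> dot x (H *m y) = dot y (H *m x).
Proof. by move=> Hs; rewrite dot_mulmx Hs dotC. Qed.

Lemma quadD H x y : H^T = H ->
  quad H (x + y) = quad H x + 2 * dot x (H *m y) + quad H y.
Proof.
move=> Hs; rewrite /quad mulmxDr dotDl !dotDr (dot_symm y x Hs); ring.
Qed.

Lemma quadZ H k x : quad H (k *: x) = k ^+ 2 * quad H x.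
Proof. by rewrite /quad -scalemxAr dotZl dotZr mulrA expr2. Qed.

Lemma quadN H x : quad H (- x) = quad H x.
Proof. by rewrite -scaleN1r quadZ sqrrN expr1n mul1r. Qed.

Lemma quad_cauchy H x y : H^T = H -> (forall z, 0 <= quad H z) ->
  dot x (H *m y) ^+ 2 <= quad H x * quad H y.
Proof.
move=> Hs Hp; set b := dot x (H *m y).
have h t : 0 <= t ^+ 2 * quad H x + 2 * t * b + quad H y.
  have := Hp (t *: x + y); rewrite quadD// quadZ dotZl -/b.
  by rewrite mulrA.
have [x0|x0] := eqVneq (quad H x) 0.
  have [->|b0] := eqVneq b 0; first by rewrite expr0n/= x0 mul0r.
  have := h (- (quad H y + 1) / (2 * b)).
  rewrite x0 mulr0 add0r (_ : 2 * _ * b = - (quad H y + 1)); first by lra.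
  by field.
have xp : 0 < quad H x by rewrite lt_neqAle eq_sym x0 Hp.
have := h (- b / quad H x).
rewrite (_ : _ + quad H y = quad H y - b ^+ 2 / quad H x); last by field.
by rewrite subr_ge0 ler_pdivrMr// mulrC.
Qed.

(** Cauchy-Schwarz for the form of [H] at the vectors [H x] and [x] gives
    [|H x|^4 <= C |H x|^2 * quad H x], and a factor [|H x|^2] cancels. *)
Lemma dot_mul_le H C x : H^T = H -> (forall z, 0 <= quad H z) -> 0 <= C ->
  (forall z, quad H z <= C * dot z z) ->
  dot (H *m x) (H *m x) <= C * quad H x.
Proof.
move=> Hs Hp C0 HC; set y := H *m x; set N := dot y y.
have [->|N0] := eqVneq N 0; first by rewrite mulr_ge0.
have Np : 0 < N by rewrite lt_neqAle eq_sym N0 dot_ge0.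
have := quad_cauchy y x Hs Hp; rewrite -/y -/N => /le_trans.
move=> /(_ (C * N * quad H x)); rewrite ler_wpM2r ?HC// => /(_ isT).
by rewrite expr2 (mulrC C) -mulrA ler_pM2l.
Qed.
End dot_theory.

(** * Generalised least squares in whitened coordinates *)

Section whitened_gls.
Variables (R : realType) (n q : nat) (H : 'M[R]_n) (A : 'M[R]_(n, q)).
Hypothesis Hs : H^T = H.
Hypothesis GA : A^T *m H *m A \in unitmx.

(** The projection onto the column space of [A] that is orthogonal for the inner product of [H]. *)
Definition gls_proj : 'M[R]_n := A *m invmx (A^T *m H *m A) *m A^T *m H.

Lemma gls_projA : gls_proj *m A = A.
Proof. by rewrite /gls_proj -!mulmxA [A^T *m _]mulmxA mulVmx ?mulmx1// -mulmxA. Qed.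

Lemma gls_orth (v : 'cV[R]_n) (b : 'cV[R]_q) :
  dot (A *m b) (H *m (v - gls_proj *m v)) = 0.
Proof.
rewrite dotC dot_mulmx; rewrite (_ : _ *m _ = 0) ?/dot ?trmx0 ?mul0mx ?mxE//.
rewrite mulmxBr mulmxBr /gls_proj !mulmxA mulmxV// mul1mx subrr//.
Qed.

Lemma gls_projE (v : 'cV[R]_n) :
  gls_proj *m v = A *m (invmx (A^T *m H *m A) *m A^T *m H *m v).
Proof. by rewrite /gls_proj !mulmxA. Qed.

Variables (nu eps : 'cV[R]_n).
Let a := nu - gls_proj *m nu.
Let e := gls_proj *m eps.

Lemma gls_orth_bias_fit : dot a (H *m e) = 0.
Proof. by rewrite dot_symm// /e gls_projE gls_orth. Qed.

Lemma quad_gls_fit : quad H e = dot (H *m e) eps.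
Proof.
have := gls_orth eps (invmx (A^T *m H *m A) *m A^T *m H *m eps).
rewrite -gls_projE -/e mulmxBr dotDr dotNr => /eqP; rewrite subr_eq0 => /eqP.
by rewrite /quad => <-; rewrite dot_mulmx Hs.
Qed.

(** The fitted noise enters here with a minus sign and in [quad_gls_error] with a plus sign:
    overfitting lowers the criterion by as much as it raises the loss. This is the origin of the
    term [- 2 quad H e] in [loglik_kl_loss]. *)
Lemma quad_gls_residual :
  quad H (nu + eps - gls_proj *m (nu + eps)) =
  quad H a + 2 * dot (H *m a) eps + quad H eps - quad H e.
Proof.
have -> : nu + eps - gls_proj *m (nu + eps) = a + (eps - e).
  by rewrite mulmxDr opprD addrACA.
rewrite (quadD a _ Hs) (quadD eps _ Hs) (quadN _ e) (mulmxBr H) dotDr dotNr gls_orth_bias_fit subr0.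
have -> : dot eps (H *m - e) = - quad H e.
  by rewrite mulmxN dotNr quad_gls_fit dotC.
by rewrite dot_mulmx Hs; ring.
Qed.

Lemma quad_gls_error :
  quad H (gls_proj *m (nu + eps) - nu) = quad H a + quad H e.
Proof.
have -> : gls_proj *m (nu + eps) - nu = - (a - e).
  by rewrite mulmxDr opprB /a opprB [RHS]addrCA addrA.
by rewrite quadN (quadD a _ Hs) quadN mulmxN dotNr gls_orth_bias_fit oppr0 mulr0 addr0.
Qed.
End whitened_gls.

Section gaussian_regression_whitened.
Variables (R : realType) (n q : nat) (W S S0 H : 'M[R]_n) (X : 'M[R]_(n, q)).
Hypothesis Hs : H^T = H.
Hypothesis SH : invmx S = W^T *m H *m W.
Hypothesis S0W : W *m S0 *m W^T = 1%:M.
Let A := W *m X.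
Hypothesis GA : A^T *m H *m A \in unitmx.

Lemma qform_whiten (y : 'cV[R]_n) : qform S y = quad H (W *m y).
Proof. by rewrite /qform SH /quad /dot trmx_mul !mulmxA. Qed.

Lemma gls_mean_whiten (z : 'cV[R]_n) : W *m gls_mean X S z = gls_proj H A *m (W *m z).
Proof. by rewrite /gls_mean SH /gls_proj /A trmx_mul !mulmxA. Qed.

Lemma trace_whiten : \tr (S0 *m invmx S) = \tr H.
Proof.
rewrite SH !mulmxA mxtrace_mulC !mulmxA S0W mul1mx//.
Qed.

Variables (mu z eps : 'cV[R]_n).
Hypothesis zE : W *m z = W *m mu + eps.
Let nu := W *m mu.
Let a := nu - gls_proj H A *m nu.
Let e := gls_proj H A *m eps.

Lemma kl_loss_whiten : kl_loss X S S0 mu z =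
  (ln (\det S) - ln (\det S0) + \tr H - n%:R) / 2 + (quad H a + quad H e) / 2.
Proof.
rewrite /kl_loss trace_whiten qform_whiten mulmxBr gls_mean_whiten zE.
by rewrite quad_gls_error.
Qed.

(** The log determinant of [S] and the squared bias cancel. Apart from terms common to all models
    and parameters, only two centred noise terms and the fitted noise remain. *)
Lemma loglik_kl_loss :
  - 2 * loglik X S z - 2 * kl_loss X S S0 mu z =
  n%:R * ln (2 * pi) + ln (\det S0) + n%:R + (quad H eps - \tr H)
  + 2 * dot (H *m a) eps - 2 * quad H e.
Proof.
rewrite kl_loss_whiten /loglik qform_whiten mulmxBr gls_mean_whiten zE.
by rewrite quad_gls_residual// -/nu -/a -/e; field.
Qed.

End gaussian_regression_whitened.

(** * Separable AR(1) covariances *)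

Section mxspan_closure.
Variable R : realType.

Lemma mxspanN (p q : nat) (s : seq 'M[R]_(p, q)) A : mxspan s A -> mxspan s (- A).
Proof. by move=> h; rewrite -scaleN1r; exact: mxspanZ. Qed.

Lemma mxspan_min (p q : nat) (s : seq 'M[R]_(p, q)) (Q : 'M[R]_(p, q) -> Prop) A :
  Q 0 -> (forall B C, Q B -> Q C -> Q (B + C)) -> (forall k B, Q B -> Q (k *: B)) ->
  (forall B, B \in s -> Q B) -> mxspan s A -> Q A.
Proof.
move=> Q0 QD QZ; elim: s A => [A _ -> //|B s ih A Qs /= [a ha]].
rewrite -(subrK (a *: B) A); apply: QD; last by apply: QZ; apply: Qs; rewrite mem_head.
by apply: ih ha => C Cs; apply: Qs; rewrite inE Cs orbT.
Qed.

Lemma mxspan_bilinear (p1 q1 p2 q2 p3 q3 : nat)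
    (f : 'M[R]_(p1, q1) -> 'M[R]_(p2, q2) -> 'M[R]_(p3, q3)) s1 s2 A B :
  (forall x x' y, f (x + x') y = f x y + f x' y) ->
  (forall k x y, f (k *: x) y = k *: f x y) ->
  (forall x y y', f x (y + y') = f x y + f x y') ->
  (forall k x y, f x (k *: y) = k *: f x y) ->
  mxspan s1 A -> mxspan s2 B -> mxspan [seq f x y | x <- s1, y <- s2] (f A B).
Proof.
move=> fDl fZl fDr fZr sA sB.
apply: (@mxspan_min _ _ s1 (fun A => mxspan _ (f A B)) A _ _ _ _ sA).
- by rewrite -(scale0r 0) fZl scale0r; exact: mxspan0.
- by move=> C D hC hD; rewrite fDl; exact: mxspanD.
- by move=> k C hC; rewrite fZl; exact: mxspanZ.
move=> C Cs.
apply: (@mxspan_min _ _ s2 (fun B => mxspan _ (f C B)) B _ _ _ _ sB).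
- by rewrite -(scale0r 0) fZr scale0r; exact: mxspan0.
- by move=> D E hD hE; rewrite fDr; exact: mxspanD.
- by move=> k D hD; rewrite fZr; exact: mxspanZ.
by move=> D Ds; apply: mxspan_mem; exact: allpairs_f.
Qed.
End mxspan_closure.

Section tensor.
Variable R : realType.

Lemma tens_scalar1 m n : (1%:M : 'M[R]_m) *t (1%:M : 'M[R]_n) = 1%:M.
Proof.
apply/matrixP => k l.
case: (mxtens_indexP k) => i j; case: (mxtens_indexP l) => i' j'.
rewrite tensmxE !mxE (can_eq (@mxtens_indexK _ _)) xpair_eqE.
by case: (i == i'); case: (j == j'); rewrite ?mulr0n ?mulr1n ?mulr0 ?mulr1.
Qed.

Lemma mxtrace_tens m n (A : 'M[R]_m) (B : 'M[R]_n) : \tr (A *t B) = \tr A * \tr B.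
Proof. by rewrite /mxtrace mulr_sum; apply: eq_bigr => k _; rewrite mxE. Qed.

Lemma sum_tens_index m n (F : 'I_(m * n) -> R) :
  \sum_k F k = \sum_i \sum_j F (mxtens_index (i, j)).
Proof.
rewrite pair_big; apply: reindex => /=.
exists (@mxtens_unindex m n) => k _; first by case: k => ? ?; rewrite mxtens_indexK.
by rewrite -[RHS]mxtens_unindexK.
Qed.

Lemma prod_tens_index m n (F : 'I_(m * n) -> R) :
  \prod_k F k = \prod_i \prod_j F (mxtens_index (i, j)).
Proof.
rewrite pair_big; apply: reindex => /=.
exists (@mxtens_unindex m n) => k _; first by case: k => ? ?; rewrite mxtens_indexK.
by rewrite -[RHS]mxtens_unindexK.
Qed.

(** In this form a tensor product acts by multiplication from the left and from the right, one
    factor for each axis. *)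
Definition unvec m n (y : 'cV[R]_(m * n)) : 'M[R]_(m, n) :=
  \matrix_(i, j) y (mxtens_index (i, j)) 0.

Lemma unvec_tens m n (A : 'M[R]_m) (B : 'M[R]_n) y :
  unvec ((A *t B) *m y) = A *m unvec y *m B^T.
Proof.
apply/matrixP => i j; rewrite mxE mxE sum_tens_index [RHS]mxE exchange_big/=.
apply: eq_bigr => l _; rewrite mxE big_distrl/=; apply: eq_bigr => k _.
by rewrite tensmxE !mxE; ring.
Qed.

Lemma dot_unvec m n (x y : 'cV[R]_(m * n)) : dot x y = mxdot (unvec x) (unvec y).
Proof.
rewrite /dot mxE sum_tens_index; apply: eq_bigr => i _; apply: eq_bigr => j _.
by rewrite !mxE.
Qed.

Lemma mxdot_col m n (A B : 'M[R]_(m, n)) : mxdot A B = \sum_j dot (col j A) (col j B).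
Proof.
rewrite /mxdot exchange_big/=; apply: eq_bigr => j _; rewrite /dot mxE.
by apply: eq_bigr => i _; rewrite !mxE.
Qed.

Lemma mxdot_mul_le m n (A A' : 'M[R]_m) (c : R) :
  (forall v, dot (A *m v) (A *m v) <= c * dot (A' *m v) (A' *m v)) ->
  forall M : 'M[R]_(m, n), mxdot (A *m M) (A *m M) <= c * mxdot (A' *m M) (A' *m M).
Proof.
move=> h M; rewrite !mxdot_col mulr_sumr; apply: ler_sum => j _.
by rewrite !colE -!mulmxA; exact: h.
Qed.

(** The one-dimensional bound is used once along columns and once, after transposition, along rows;
    each use costs a factor [c]. *)
Lemma dot_tens_le m (A A' : 'M[R]_m) (c : R) : 0 <= c ->
  (forall v, dot (A *m v) (A *m v) <= c * dot (A' *m v) (A' *m v)) ->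
  forall y, dot ((A *t A) *m y) ((A *t A) *m y) <=
    c ^+ 2 * dot ((A' *t A') *m y) ((A' *t A') *m y).
Proof.
move=> c0 h y; rewrite !dot_unvec !unvec_tens; set Y := unvec y.
rewrite -!mulmxA; apply: le_trans (mxdot_mul_le h _) _.
rewrite expr2 -mulrA ler_wpM2l// !mulmxA -[leLHS]mxdot_trmx -[X in _ * X]mxdot_trmx.
by rewrite !trmx_mul !trmxK; exact: mxdot_mul_le.
Qed.
End tensor.

(** * AR(1) sequences: energies, covariances and whitening *)

Section ar1.
Variables (R : realType).

(** The quadratic form of the precision matrix of [N + 1] successive values of a stationary AR(1)
    sequence with unit variance. *)
Definition ar1_energy (rho : R) (N : nat) (f : nat -> R) : R :=
  f 0%N ^+ 2 + \sum_(i < N) (f i.+1 - rho * f i) ^+ 2 / (1 - rho ^+ 2).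

(** For an innovation [e] one has [f_{i+1}^2 <= rho f_i^2 + 2 e^2 / (1 - rho^2)]. Summation
    telescopes, and the additional term [f N ^ 2] carries the induction. *)
Lemma ar1_energy_ge (rho : R) N (f : nat -> R) : 0 < rho < 1 ->
  (1 - rho) * \sum_(i < N) f i ^+ 2 <= 2 * ar1_energy rho N f.
Proof.
move=> /andP[r0 r1].
have r2 : 0 < 1 - rho ^+ 2 by rewrite subr_gt0 expr_lt1// ltW.
suff h : (1 - rho) * \sum_(i < N) f i ^+ 2 + f N ^+ 2 <=
    f 0%N ^+ 2 + 2 * \sum_(i < N) (f i.+1 - rho * f i) ^+ 2 / (1 - rho ^+ 2).
  rewrite /ar1_energy; have := sqr_ge0 (f N); have := sqr_ge0 (f 0%N); lra.
elim: N => [|N ih]; first by rewrite !big_ord0 !mulr0 addr0 add0r.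
rewrite !big_ord_recr/= !mulrDr.
suff : f N.+1 ^+ 2 <= rho * f N ^+ 2 + 2 * ((f N.+1 - rho * f N) ^+ 2 / (1 - rho ^+ 2)) by lra.
move: (f N) (f N.+1) => x y.
set e := y - rho * x; have -> : y = rho * x + e by rewrite /e; ring.
set E := e ^+ 2 / _; have eE : e ^+ 2 = (1 - rho ^+ 2) * E by rewrite /E mulrC divfK// gt_eqF.
have E0 : 0 <= E by rewrite divr_ge0 ?sqr_ge0// ltW.
have -> : (rho * x + e) ^+ 2 = rho ^+ 2 * x ^+ 2 + 2 * (rho * (x * e)) + e ^+ 2 by ring.
have z : (x * e) ^+ 2 <= ((1 - rho) * x ^+ 2) * ((1 + rho) * E).
  by rewrite exprMn eE le_eqVlt; apply/orP; left; apply/eqP; ring.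
have p1 : 0 <= (1 - rho) * x ^+ 2 by rewrite mulr_ge0 ?sqr_ge0// subr_ge0 ltW.
have p2 : 0 <= (1 + rho) * E by rewrite mulr_ge0// addr_ge0// ltW.
have h := mul2_le_add p1 p2 z; rewrite eE.
have := ler_wpM2l (ltW r0) h; rewrite !mulrDr.
have : 0 <= (1 - rho) * E by rewrite mulr_ge0// subr_ge0 ltW.
rewrite !expr2; lra.
Qed.

(** The constant may depend only on the ratio of [1 - rho] and [1 - rho'], since both coefficients
    tend to 1. Changing the coefficient shifts an innovation by [(rho' - rho) f_i], and [(rho' -
    rho)^2 <= r^2 (1 - rho) (1 - rho')] lets [ar1_energy_ge] absorb the shift. The innovations
    contribute a factor [4 r] and the shift [4 r^2], together at most [8 r^2]. *)
Lemma ar1_energy_le (rho rho' r : R) N (f : nat -> R) : 0 < rho < 1 -> 0 < rho' < 1 ->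
  1 <= r -> 1 - rho <= r * (1 - rho') -> 1 - rho' <= r * (1 - rho) ->
  ar1_energy rho N f <= 8 * r ^+ 2 * ar1_energy rho' N f.
Proof.
move=> rho01 rho'01 r1 h1 h2.
have := ar1_energy_ge N f rho'01.
case/andP: rho01 => a0 a1; case/andP: rho'01 => b0 b1.
set G := \sum_(i < N) f i ^+ 2; set E' := ar1_energy rho' N f => GE.
have a2 : 0 < 1 - rho ^+ 2 by rewrite subr_gt0 expr_lt1// ltW.
have b2 : 0 < 1 - rho' ^+ 2 by rewrite subr_gt0 expr_lt1// ltW.
set D' := \sum_(i < N) (f i.+1 - rho' * f i) ^+ 2 / (1 - rho' ^+ 2).
have D'0 : 0 <= D' by apply: sumr_ge0 => i _; rewrite divr_ge0 ?sqr_ge0// ltW.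
have E'E : E' = f 0%N ^+ 2 + D' by [].
have step : \sum_(i < N) (f i.+1 - rho * f i) ^+ 2 / (1 - rho ^+ 2) <=
    4 * r * D' + 2 * (rho' - rho) ^+ 2 / (1 - rho ^+ 2) * G.
  rewrite /D' /G !mulr_sumr -big_split/=; apply: ler_sum => i _.
  move: (f i) (f i.+1) => x y; rewrite ler_pdivrMr//.
  set e := y - rho' * x.
  have -> : y - rho * x = e + (rho' - rho) * x by rewrite /e; ring.
  set E := e ^+ 2 / _; have eE : e ^+ 2 = (1 - rho' ^+ 2) * E by rewrite /E mulrC divfK// gt_eqF.
  have E0 : 0 <= E by rewrite divr_ge0 ?sqr_ge0// ltW.
  rewrite [leRHS]mulrDl [X in _ <= _ + X](_ : _ = 2 * ((rho' - rho) * x) ^+ 2); last first.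
    by field; rewrite gt_eqF.
  have le2 : (1 - rho' ^+ 2) * E <= 2 * r * (1 - rho ^+ 2) * E.
    rewrite ler_wpM2r//.
    have -> : 1 - rho' ^+ 2 = (1 - rho') * (1 + rho') by ring.
    have -> : 1 - rho ^+ 2 = (1 - rho) * (1 + rho) by ring.
    apply: (@le_trans _ _ (r * (1 - rho) * 2)).
      by apply: ler_pM => //; lra.
    have : 0 <= r * (1 - rho) by apply: mulr_ge0; lra.
    by nra.
  have := sqr_ge0 (e - (rho' - rho) * x).
  have -> : (e - (rho' - rho) * x) ^+ 2 = e ^+ 2 - 2 * (e * ((rho' - rho) * x)) + ((rho' - rho) * x) ^+ 2 by ring.
  have -> : (e + (rho' - rho) * x) ^+ 2 = e ^+ 2 + 2 * (e * ((rho' - rho) * x)) + ((rho' - rho) * x) ^+ 2 by ring.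
  rewrite eE; lra.
have G0 : 0 <= G by apply: sumr_ge0 => i _; exact: sqr_ge0.
have E'0 : 0 <= E' by rewrite E'E addr_ge0 ?sqr_ge0.
have part2 : 2 * (rho' - rho) ^+ 2 / (1 - rho ^+ 2) * G <= 4 * r ^+ 2 * E'.
  have d1 : `|rho' - rho| <= r * (1 - rho) by rewrite ler_norml; apply/andP; split; nra.
  have d2 : `|rho' - rho| <= r * (1 - rho') by rewrite ler_norml; apply/andP; split; nra.
  have -> : (rho' - rho) ^+ 2 = `|rho' - rho| * `|rho' - rho|.
    by rewrite -normrM -expr2 ger0_norm ?sqr_ge0.
  have d3 : `|rho' - rho| * `|rho' - rho| <= (r * (1 - rho)) * (r * (1 - rho')).
    by apply: ler_pM.
  rewrite mulrAC ler_pdivrMr//.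
  apply: (@le_trans _ _ (2 * ((r * (1 - rho)) * (r * (1 - rho'))) * G)).
    by rewrite ler_wpM2r// ler_pM2l.
  have -> : 2 * (r * (1 - rho) * (r * (1 - rho'))) * G =
     2 * r ^+ 2 * (1 - rho) * ((1 - rho') * G) by ring.
  apply: (@le_trans _ _ (2 * r ^+ 2 * (1 - rho) * (2 * E'))).
    rewrite ler_wpM2l// mulr_ge0 ?subr_ge0 ?(ltW a1)//; apply: mulr_ge0 => //; exact: sqr_ge0.
  have -> : 4 * r ^+ 2 * E' * (1 - rho ^+ 2) =
    2 * r ^+ 2 * (1 - rho) * (2 * E') + 4 * (r ^+ 2 * (E' * (rho * (1 - rho)))) by ring.
  rewrite lerDl; apply: mulr_ge0 => //; apply: mulr_ge0; first exact: sqr_ge0.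
  by apply: mulr_ge0 => //; apply: mulr_ge0; lra.
rewrite /ar1_energy.
have f0 := sqr_ge0 (f 0%N).
have r2 : r <= r ^+ 2 by rewrite expr2; nra.
have : r * D' <= r ^+ 2 * D' by rewrite ler_wpM2r.
have : f 0%N ^+ 2 <= r ^+ 2 * f 0%N ^+ 2.
  by rewrite ler_peMl// expr2; nra.
move: part2 step; rewrite E'E !mulrDr; lra.
Qed.
End ar1.

Section ar1_matrices.
Variables (R : realType) (m : nat).
Implicit Types rho : R.

(** Subtraction is truncated, so the exponent is the distance between [i] and [j]. *)
Definition arK rho : 'M[R]_m := \matrix_(i, j) rho ^+ (i - j + (j - i)).

Definition ar_scale rho (i : nat) : R :=
  if i == 0%N then 1 else (Num.sqrt (1 - rho ^+ 2))^-1.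

(* [arW rho] whitens a stationary AR(1) sequence:
   [v |-> (v_0, (v_i - rho v_(i-1)) / sqrt (1 - rho^2))] *)
Definition arW rho : 'M[R]_m :=
  \matrix_(i, j) (ar_scale rho i * ((i == j)%:R - rho * (i == j.+1 :> nat)%:R)).

Lemma arW_sum rho (v : nat -> R) (i : 'I_m) :
  \sum_j arW rho i j * v j =
  ar_scale rho i * (v i - rho * (if i == 0%N :> nat then 0 else v i.-1)).
Proof.
under eq_bigr => j _ do rewrite mxE -mulrA mulrBl -mulrA.
rewrite -mulr_sumr sumrB -mulr_sumr; congr (_ * (_ - _ * _)).
  rewrite (bigD1 i)//= eqxx mul1r big1 ?addr0// => j /negbTE ji.
  by rewrite eq_sym ji mul0r.
case: eqP => [i0|/eqP i0].
  by rewrite big1// => j _; rewrite i0 mul0r.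
have im : (i.-1 < m)%N by rewrite (leq_ltn_trans (leq_pred _)).
rewrite (bigD1 (Ordinal im))//= prednK ?lt0n// eqxx mul1r big1 ?addr0// => j ji.
case: eqP => [ij|]; last by rewrite mul0r.
by case/eqP: ji; apply/val_inj; rewrite /= ij.
Qed.

Lemma arWKW_entry rho rho0 (i j : 'I_m) :
  let k (a b : nat) := rho0 ^+ (a - b + (b - a)) in
  let g (l : nat) := k i l - rho * (if i == 0%N :> nat then 0 else k i.-1 l) in
  (arW rho *m arK rho0 *m (arW rho)^T) i j =
  ar_scale rho i * (ar_scale rho j * (g j - rho * (if j == 0%N :> nat then 0 else g j.-1))).
Proof.
move=> k g; rewrite mxE -arW_sum mulr_sumr; apply: eq_bigr => l _.
rewrite (_ : (arW rho *m arK rho0) i l = ar_scale rho i * g l); last first.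
  rewrite mxE; under eq_bigr => j' _ do rewrite [arK _ _ _]mxE.
  exact: (arW_sum rho (fun a => k a l)).
by rewrite [_^T _ _]mxE; ring.
Qed.

Lemma ar_scale_sq rho i : 0 < rho < 1 -> (0 < i)%N ->
  ar_scale rho i * ar_scale rho i = (1 - rho ^+ 2)^-1.
Proof.
move=> /andP[r0 r1] i0; rewrite /ar_scale gtn_eqF// -invfM -expr2 sqr_sqrtr//.
by rewrite subr_ge0 expr_le1// ltW.
Qed.

Lemma arWKW_diag rho rho0 (i : 'I_m) : 0 < rho < 1 ->
  (arW rho *m arK rho0 *m (arW rho)^T) i i =
  if i == 0%N :> nat then 1
  else (1 - 2 * rho * rho0 + rho ^+ 2) / (1 - rho ^+ 2).
Proof.
move=> r01; rewrite arWKW_entry; case: eqP => [i0|/eqP].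
  by rewrite /ar_scale i0 /= subnn expr0; ring.
rewrite -lt0n => i0; rewrite mulrA ar_scale_sq// mulrC; congr (_ / _).
have -> : (i - i + (i - i) = 0)%N by lia.
have -> : (i.-1 - i + (i - i.-1) = 1)%N by lia.
have -> : (i - i.-1 + (i.-1 - i) = 1)%N by lia.
have -> : (i.-1 - i.-1 + (i.-1 - i.-1) = 0)%N by lia.
ring.
Qed.

Lemma arWKW rho : 0 < rho < 1 -> arW rho *m arK rho *m (arW rho)^T = 1%:M.
Proof.
move=> r01; apply/matrixP => i j; rewrite [RHS]mxE.
have [<-|ij] := eqVneq i j.
  rewrite arWKW_diag//; case: eqP => // _.
  rewrite (_ : 1 - 2 * rho * rho + _ = 1 - rho ^+ 2); last by ring.
  by rewrite divff//; case/andP: r01 => r0 r1; rewrite gt_eqF// subr_gt0 expr_lt1// ltW.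
have {}ij : i != j :> nat by [].
(* The filter [1 - rho * shift] annihilates a geometric progression of ratio [rho], so off the
   diagonal one of its two applications gives 0. *)
rewrite arWKW_entry; set z := (X in _ * (_ * X)); suff -> : z = 0 by rewrite !mulr0.
pose k (a b : nat) := rho ^+ (a - b + (b - a)).
have kS a b : k a.+1 b.+1 = k a b by [].
have kl a d : k a (a + d)%N = rho ^+ d.
  by rewrite /k (_ : (a - (a + d) + (a + d - a) = d)%N)//; lia.
have kr a d : k (a + d)%N a = rho ^+ d.
  by rewrite /k (_ : (a + d - a + (a - (a + d)) = d)%N)//; lia.
rewrite /z -!/(k _ _) => {z}; move: (i : nat) (j : nat) ij => {}i {}j; clearbody k.
case: i => [|i]; case: j => [|j] //= ij.
- by have := kl 0%N j; have := kl 0%N j.+1; rewrite !add0n => -> ->; rewrite exprS; ring.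
- by have := kr 0%N i; have := kr 0%N i.+1; rewrite !add0n => -> ->; rewrite exprS; ring.
rewrite !kS; case: (ltnP i j) => h.
  have [d ->] : exists d, j = (i + d.+1)%N by exists (j - i.+1)%N; lia.
  have := kl i d.+1; have := kl i d.+2; have := kl i.+1 d.
  by rewrite !addnS addSn !kS => -> -> ->; rewrite !exprS; ring.
have [d ->] : exists d, i = (j + d.+1)%N by exists (i - j.+1)%N; lia.
have := kr j d.+1; have := kr j d.+2; have := kr j.+1 d.
by rewrite !addnS addSn !kS => -> -> ->; rewrite !exprS; ring.
Qed.

Lemma trace_arWKW rho rho0 : 0 < rho < 1 -> (0 < m)%N ->
  \tr (arW rho *m arK rho0 *m (arW rho)^T) =
  1 + m.-1%:R * ((1 - 2 * rho * rho0 + rho ^+ 2) / (1 - rho ^+ 2)).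
Proof.
move=> r01 m0; rewrite /mxtrace.
under eq_bigr => i _ do rewrite arWKW_diag//.
move: m0; case: m => // N _.
rewrite big_ord_recl/=; congr (_ + _).
by rewrite sumr_const card_ord [RHS]mulr_natl.
Qed.

Definition arE : 'M[R]_m := \matrix_(i, j) ((i == j) && (i == 0%N :> nat))%:R.
Definition arN : 'M[R]_m := \matrix_(i, j) (i == j.+1 :> nat)%:R.
(** The products that arise when [(1 - rho arN)^T (1 - rho^2 arE) (1 - rho arN)] is expanded; this
    matrix is [1 - rho^2] times the AR(1) precision, and its eight building blocks do not depend on
    [rho]. *)
Definition ar_basis : seq 'M[R]_m :=
  [:: 1%:M; arE; arN; arN^T; arN^T *m arN; arE *m arN; arN^T *m arE; arN^T *m arE *m arN].

Lemma mxspan_arWW rho : 0 < rho < 1 -> mxspan ar_basis ((arW rho)^T *m arW rho).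
Proof.
move=> r01.
have r2 : 1 - rho ^+ 2 != 0.
  by case/andP: r01 => r0 r1; rewrite gt_eqF// subr_gt0 expr_lt1// ltW.
pose Q := 1%:M - rho *: arN; pose D := 1%:M - rho ^+ 2 *: arE.
have -> : (arW rho)^T *m arW rho = (1 - rho ^+ 2)^-1 *: (Q^T *m D *m Q).
  apply/matrixP => i j; rewrite mxE [RHS]mxE mxE mulr_sumr; apply: eq_bigr => l _.
  have DE : (Q^T *m D) i l = Q l i * (if l == 0%N :> nat then 1 - rho ^+ 2 else 1).
    rewrite mxE (bigD1 l)//= big1 => [|k kl].
      rewrite addr0 !mxE eqxx/=. case: (l == 0%N :> nat) => /=; ring.
    by rewrite !mxE (negbTE kl)/=; ring.
  rewrite DE !mxE; case: (eqVneq (nat_of_ord l) 0%N) => [l0|l0].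
    by rewrite /ar_scale l0 eqxx; field.
  have := ar_scale_sq r01 (_ : (0 < l)%N); rewrite lt0n => /(_ l0) h.
  by rewrite mulrACA h; ring.
apply: mxspanZ.
have M i : (i < 8)%N -> mxspan ar_basis (nth 0 ar_basis i).
  by move=> i8; apply: mxspan_mem; exact: mem_nth.
have -> : Q^T = 1%:M - rho *: arN^T by rewrite [LHS]linearB/= linearZ/= trmx1.
rewrite /Q /D !(mulmxBl, mulmxBr, mulmx1, mul1mx).
rewrite -?(scalemxAl, scalemxAr).
repeat match goal with
  | |- mxspan _ (_ + _) => apply: mxspanD
  | |- mxspan _ (_ *: _) => apply: mxspanZ
  | |- mxspan _ 1%:M => exact: (M 0%N isT)
  | |- mxspan _ arE => exact: (M 1%N isT)
  | |- mxspan _ arN => exact: (M 2%N isT)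
  | |- mxspan _ arN^T => exact: (M 3%N isT)
  | |- mxspan _ (arN^T *m arN) => exact: (M 4%N isT)
  | |- mxspan _ (arE *m arN) => exact: (M 5%N isT)
  | |- mxspan _ (arN^T *m arE) => exact: (M 6%N isT)
  | |- mxspan _ (arN^T *m arE *m arN) => exact: (M 7%N isT)
  | |- mxspan _ _ => apply: mxspanN
  end.
Qed.

Lemma arW_trig rho : is_trig_mx (arW rho).
Proof.
apply/is_trig_mxP => i j ij; rewrite mxE.
by rewrite -val_eqE !ltn_eqF ?ltnS ?(ltnW ij)// mulr0 subr0 mulr0.
Qed.

Lemma det_arW rho : (0 < m)%N ->
  \det (arW rho) = (Num.sqrt (1 - rho ^+ 2))^-1 ^+ m.-1.
Proof.
rewrite det_trig ?arW_trig//.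
under eq_bigr => i _ do rewrite mxE eqxx (ltn_eqF (ltnSn i)) mulr0 subr0 mulr1.
case: m => // N _; rewrite big_ord_recl/= {1}/ar_scale/= mul1r.
by under eq_bigr => i _ do rewrite /ar_scale/=; rewrite prodr_const card_ord.
Qed.

(** One sequence [f] serves all coefficients, so that energies for different coefficients can be
    compared. *)
Lemma arW_energy rho (v : 'cV[R]_m) : 0 < rho < 1 -> (0 < m)%N ->
  exists f : nat -> R, forall rho', 0 < rho' < 1 ->
    dot (arW rho' *m v) (arW rho' *m v) = ar1_energy rho' m.-1 f.
Proof.
move=> _ m0; pose f (k : nat) : R := if insub k is Some i then v i 0 else 0.
have fE (i : 'I_m) : v i 0 = f i by rewrite /f valK.
exists f => rho' r01.
have E (i : 'I_m) : (arW rho' *m v) i 0 =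
    ar_scale rho' i * (f i - rho' * (if i == 0%N :> nat then 0 else f i.-1)).
  by rewrite mxE -arW_sum; apply: eq_bigr => j _; rewrite fE.
rewrite /dot mxE; under eq_bigr => i _ do rewrite mxE E.
clear E fE; clearbody f; clear v; move: m0; case: m => // N _.
rewrite big_ord_recl /ar1_energy; congr (_ + _).
  by rewrite /ar_scale/= mulr0 subr0 mul1r expr2.
apply: eq_bigr => i _; rewrite mulrACA ar_scale_sq//= -expr2 mulrC.
by [].
Qed.
End ar1_matrices.

(** [1 - exp (- x)] is increasing, concave and 0 at 0, so it grows by at most the factor [r] when
    its argument does. *)
Lemma onem_expRN_le (R : realType) (x y r : R) : 0 < x -> 0 < y -> 1 <= r ->
  x <= r * y -> 1 - expR (- x) <= r * (1 - expR (- y)).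
Proof.
move=> x0 y0 r1 xy.
have e1 : 0 <= 1 - expR (- y) by rewrite subr_ge0 expR_le1 oppr_le0 ltW.
have [xley|yltx] := leP x y.
  apply: (@le_trans _ _ (1 - expR (- y))); last by rewrite ler_peMl.
  by rewrite lerD2l lerN2 ler_expR lerN2.
set d := x - y; have d0 : 0 < d by rewrite subr_gt0.
have -> : - x = - y + - d by rewrite /d; ring.
rewrite expRD; set e := expR (- y).
have e0 : 0 < e by exact: expR_gt0.
have h1 : y * e <= 1 - e.
  have : (1 + y) * e <= expR y * e by rewrite ler_wpM2r ?(ltW e0)// expR_ge1Dx.
  by rewrite /e -expRD subrr expR0 -/e; lra.
have h2 : e * (1 - d) <= e * expR (- d) by rewrite ler_wpM2l ?(ltW e0)// expR_ge1Dx.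
apply: (@le_trans _ _ ((1 - e) + d * e)); first by lra.
have h3 : d * (y * e) <= d * (1 - e) by rewrite ler_pM2l.
suff : y * (1 - e + d * e) <= y * (r * (1 - e)) by rewrite ler_pM2l.
have : x * (1 - e) <= r * y * (1 - e) by rewrite ler_wpM2r.
have -> : x = y + d by rewrite /d; ring.
by clear -h3; lra.
Qed.

(** * The covariance on the grid as a tensor product *)

Section covariance_structure.
Variables (R : realType) (delta : R).
Implicit Types th : R * R.

Definition mesh (m : nat) : R := m%:R `^ (- (1 - delta)).
Definition rho (m : nat) th : R := expR (- (th.2 * mesh m)).

Definition whitener (m : nat) th : 'M[R]_(m ^ 2) :=
  (Num.sqrt th.1)^-1 *: (arW m (rho m th) *t arW m (rho m th)).

(** The distance in the exponent is a sum over the coordinates, so the exponential factorises over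
    the two axes. *)
Lemma SigmaE m th :
  Sigma delta m th = th.1 *: (arK m (rho m th) *t arK m (rho m th)).
Proof.
apply/matrixP => k l; rewrite !mxE /expcov; congr (_ * _).
have D (a b : nat) : `|a.+1%:R * mesh m - b.+1%:R * mesh m| = mesh m * (a - b + (b - a))%:R.
  rewrite -mulrBl normrM [X in _ * X]ger0_norm ?powR_ge0// mulrC; congr (_ * _).
  have [ab|ba] := leqP a b.
    rewrite (_ : (a - b = 0)%N); last by lia.
    rewrite add0n natrB// distrC ger0_norm; first by rewrite -!natr1; ring.
    by rewrite subr_ge0 ler_nat; lia.
  rewrite [in RHS](_ : (b - a = 0)%N); last by lia.
  rewrite addn0 natrB ?(ltnW ba)// ger0_norm; first by rewrite -!natr1; ring.
  by rewrite subr_ge0 ler_nat; lia.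
rewrite /site/= -/(mesh m) !D -!expRM_natr -expRD; congr expR; ring.
Qed.

Section positive_grid.
Variable m : nat.
Hypothesis m0 : (0 < m)%N.

Lemma mesh_gt0 : 0 < mesh m.
Proof. by rewrite powR_gt0// ltr0n. Qed.

Lemma rho_in01 th : 0 < th.2 -> 0 < rho m th < 1.
Proof.
by move=> k0; rewrite expR_gt0 expR_lt1 oppr_lt0 mulr_gt0// mesh_gt0.
Qed.

(** The variance of the innovations formed with the coefficient of [th] when that of [th0] is true,
    relative to its nominal value. *)
Definition ar_ratio th0 th : R :=
  (1 - 2 * rho m th * rho m th0 + rho m th ^+ 2) / (1 - rho m th ^+ 2).

Lemma tens_congruence (n : nat) (a b : R) (A B : 'M[R]_n) :
  (a *: (A *t A)) *m (b *: (B *t B)) *m (a *: (A *t A))^T =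
  (a ^+ 2 * b) *: ((A *m B *m A^T) *t (A *m B *m A^T)).
Proof.
rewrite [_^T]linearZ/= trmx_tens -?(scalemxAl, scalemxAr) !tensmx_mul !scalerA.
by congr (_ *: _); ring.
Qed.

Lemma whitener_congruence th th0 : 0 < th.1 ->
  whitener m th *m Sigma delta m th0 *m (whitener m th)^T =
  (th0.1 / th.1) *: ((arW m (rho m th) *m arK m (rho m th0) *m (arW m (rho m th))^T)
    *t (arW m (rho m th) *m arK m (rho m th0) *m (arW m (rho m th))^T)).
Proof.
move=> s0; rewrite SigmaE; apply: etrans (tens_congruence _ _ _ _) _.
by rewrite exprVn sqr_sqrtr ?(ltW s0)// mulrC.
Qed.

Lemma whitener_trace th th0 : 0 < th.1 -> 0 < th.2 ->
  \tr (whitener m th *m Sigma delta m th0 *m (whitener m th)^T) =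
  th0.1 / th.1 * (1 + m.-1%:R * ar_ratio th0 th) ^+ 2.
Proof.
move=> s0 k0; rewrite whitener_congruence// [LHS]linearZ/=; congr (_ * _).
by apply: etrans (mxtrace_tens _ _) _; rewrite trace_arWKW ?rho_in01// -expr2.
Qed.

Lemma whitenerK th : 0 < th.1 -> 0 < th.2 ->
  whitener m th *m Sigma delta m th *m (whitener m th)^T = 1%:M.
Proof.
move=> s0 k0; rewrite whitener_congruence// arWKW ?rho_in01// divff ?gt_eqF// scale1r.
exact: tens_scalar1.
Qed.

Lemma whitener_unit th : 0 < th.1 -> 0 < th.2 -> whitener m th \in unitmx.
Proof.
by move=> s0 k0; have := whitenerK s0 k0; rewrite -mulmxA => /mulmx1_unit[].
Qed.

Lemma Sigma_unit th : 0 < th.1 -> 0 < th.2 -> Sigma delta m th \in unitmx.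
Proof.
move=> s0 k0; have := whitenerK s0 k0 => /mulmx1_unit[].
by rewrite unitmx_mul => /andP[].
Qed.

Lemma invmx_Sigma th : 0 < th.1 -> 0 < th.2 ->
  invmx (Sigma delta m th) = (whitener m th)^T *m whitener m th.
Proof.
move=> s0 k0; have WU := whitener_unit s0 k0; have SU := Sigma_unit s0 k0.
have := whitenerK s0 k0; rewrite -mulmxA => /mulmx1C; rewrite -mulmxA => h.
by rewrite -[LHS]mulmx1 -h mulKmx.
Qed.

Lemma ln_det_whitener th : 0 < th.1 -> 0 < th.2 ->
  0 < \det (whitener m th) /\
  ln (\det (whitener m th)) =
  - ((m ^ 2)%:R * ln th.1) / 2 - (m * m.-1)%:R * ln (1 - rho m th ^+ 2).
Proof.
move=> s0 k0; have /andP[r0 r1] := rho_in01 k0.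
have r2 : 0 < 1 - rho m th ^+ 2 by rewrite subr_gt0 expr_lt1// ltW.
set q := (Num.sqrt (1 - rho m th ^+ 2))^-1.
have q0 : 0 < q by rewrite invr_gt0 sqrtr_gt0.
have dA : \det (arW m (rho m th)) = q ^+ m.-1.
  exact: det_arW.
have dT : \det (arW m (rho m th) *t arW m (rho m th)) = (q ^+ m.-1) ^+ (m + m).
  (* A tensor product of lower triangular matrices is lower triangular in the lexicographic order of
     the indices. *)
  rewrite det_trig; last first.
    apply/is_trig_mxP => k l; case: (mxtens_indexP k) => i j; case: (mxtens_indexP l) => i' j' kl.
    rewrite tensmxE.
    have [ii'|] := ltnP i i'; first by rewrite (is_trig_mxP (arW_trig _ _) _ _ ii') mul0r.
    rewrite leq_eqVlt => /orP[/eqP ii'|ii'].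
      rewrite (is_trig_mxP (arW_trig _ _) j j') ?mulr0//.
      by move: kl; rewrite /= ii' ltn_add2l.
    move: kl; rewrite /= ltnNge => /negP; case.
    have := ltn_ord j'; nia.
  rewrite prod_tens_index.
  under eq_bigr => i _ do under eq_bigr => j _ do rewrite tensmxE.
  have E : \prod_(i < m) arW m (rho m th) i i = q ^+ m.-1.
    by rewrite -dA det_trig// arW_trig.
  under eq_bigr => i _ do rewrite big_split/= E prodr_const card_ord.
  by rewrite big_split/= prodrXl E prodr_const card_ord exprD.
have sq0 : 0 < Num.sqrt th.1 by rewrite sqrtr_gt0.
have dW : \det (whitener m th) = (Num.sqrt th.1)^-1 ^+ (m ^ 2) * (q ^+ m.-1) ^+ (m + m).
  by rewrite /whitener detZ; congr (_ * _).
have dp : 0 < (Num.sqrt th.1)^-1 ^+ (m ^ 2) by rewrite exprn_gt0// invr_gt0.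
have qp : 0 < (q ^+ m.-1) ^+ (m + m) by rewrite !exprn_gt0.
split; first by rewrite dW mulr_gt0.
rewrite dW lnM ?posrE// lnXn ?invr_gt0// lnXn ?exprn_gt0// lnXn// !lnV ?posrE ?sqrtr_gt0//.
have lnsq (x : R) : 0 < x -> ln x = 2 * ln (Num.sqrt x).
  by move=> x0; rewrite -{1}[x]sqr_sqrtr ?(ltW x0)// lnXn ?sqrtr_gt0// mulr_natl.
rewrite (lnsq _ s0) (lnsq _ r2); move: (ln _) (ln _) => b a.
rewrite -mulrnA -(mulr_natl (- a)) -(mulr_natl (- b)).
rewrite [(m.-1 * _)%:R]natrM natrD [(m * m.-1)%:R]natrM; by field.
Qed.
End positive_grid.
End covariance_structure.

Section relative_precision.
Variables (R : realType) (delta : R) (m : nat) (th0 : R * R).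
Hypotheses (m0 : (0 < m)%N) (s00 : 0 < th0.1) (k00 : 0 < th0.2).
Implicit Types th : R * R.
Let W0 := whitener delta m th0.
Let W0u : W0 \in unitmx. Proof. exact: whitener_unit. Qed.

(* the precision matrix of model [th] in the coordinates whitening [th0] *)
Definition rel_prec th : 'M[R]_(m ^ 2) :=
  (invmx W0)^T *m ((whitener delta m th)^T *m whitener delta m th) *m invmx W0.

Definition rel_prec_basis : seq 'M[R]_(m ^ 2) :=
  map (fun B => (invmx W0)^T *m B *m invmx W0)
    [seq (x *t y : 'M[R]_(m ^ 2)) | x <- ar_basis R m, y <- ar_basis R m].

Lemma size_rel_prec_basis : size rel_prec_basis = 64%N.
Proof. by rewrite size_map size_allpairs. Qed.

Lemma rel_prec_sym th : (rel_prec th)^T = rel_prec th.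
Proof. by rewrite /rel_prec !trmx_mul !trmxK !mulmxA. Qed.

Lemma rel_prec0 : rel_prec th0 = 1%:M.
Proof.
by rewrite /rel_prec -/W0 -!mulmxA mulmxV// mulmx1 -trmx_mul mulmxV// trmx1.
Qed.

Lemma mxspan_rel_prec th : 0 < th.2 -> mxspan rel_prec_basis (rel_prec th).
Proof.
move=> k0.
have h : mxspan [seq (x *t y : 'M[R]_(m ^ 2)) | x <- ar_basis R m, y <- ar_basis R m]
    ((whitener delta m th)^T *m whitener delta m th).
  have -> : (whitener delta m th)^T *m whitener delta m th =
    ((Num.sqrt th.1)^-1 * (Num.sqrt th.1)^-1) *:
     (((arW m (rho delta m th))^T *m arW m (rho delta m th)) *t
      ((arW m (rho delta m th))^T *m arW m (rho delta m th)) : 'M[R]_(m ^ 2)).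
    rewrite /whitener; set a := (Num.sqrt _)^-1; set A := arW _ _.
    have : (a *: (A *t A))^T *m (a *: (A *t A)) = (a * a) *: ((A^T *m A) *t (A^T *m A)).
      by rewrite [_^T]linearZ/= trmx_tens -?(scalemxAl, scalemxAr) tensmx_mul scalerA.
    exact.
  apply: mxspanZ; have w := mxspan_arWW m (rho_in01 delta m0 k0).
  have tDl (x x' y : 'M[R]_m) : (x + x') *t y = x *t y + x' *t y.
    by apply/matrixP => i j; rewrite !mxE mulrDl.
  have tDr (x y y' : 'M[R]_m) : x *t (y + y') = x *t y + x *t y'.
    by apply/matrixP => i j; rewrite !mxE mulrDr.
  have tZl k (x y : 'M[R]_m) : (k *: x) *t y = k *: (x *t y).
    by apply/matrixP => i j; rewrite !mxE mulrA.
  have tZr k (x y : 'M[R]_m) : x *t (k *: y) = k *: (x *t y).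
    by apply/matrixP => i j; rewrite !mxE mulrCA.
  exact: (mxspan_bilinear tDl tZl tDr tZr w w).
rewrite /rel_prec -/W0; move: (_^T *m whitener delta m th) h => B h.
pose Q (B : 'M[R]_(m ^ 2)) := mxspan rel_prec_basis ((invmx W0)^T *m B *m invmx W0).
apply: (mxspan_min (Q := Q) _ _ _ _ h); rewrite /Q.
- by rewrite mulmx0 mul0mx; exact: mxspan0.
- by move=> C D hC hD; rewrite mulmxDr mulmxDl; exact: mxspanD.
- by move=> k C hC; rewrite -scalemxAr -scalemxAl; exact: mxspanZ.
- move=> C sC; apply: mxspan_mem.
  exact: (map_f (fun B => (invmx W0)^T *m B *m invmx W0) sC).
Qed.

Lemma quad_rel_prec th x : quad (rel_prec th) x =
  dot (whitener delta m th *m (invmx W0 *m x)) (whitener delta m th *m (invmx W0 *m x)).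
Proof.
by rewrite /quad /rel_prec -!mulmxA dot_mulmx trmxK dot_mulmx trmxK.
Qed.

Lemma dot_whiten0 x : dot x x = dot (W0 *m (invmx W0 *m x)) (W0 *m (invmx W0 *m x)).
Proof. by rewrite mulKVmx. Qed.

Lemma rel_prec_gt0 th x : 0 < th.1 -> 0 < th.2 -> x != 0 -> 0 < quad (rel_prec th) x.
Proof.
move=> s0 k0 x0; rewrite lt_neqAle eq_sym quad_rel_prec dot_ge0 andbT.
apply: contraNneq x0 => /dot_eq0 /(congr1 (mulmx (invmx (whitener delta m th)))).
rewrite mulKmx ?whitener_unit// mulmx0 => /(congr1 (mulmx W0)).
by rewrite mulKVmx// mulmx0 => ->.
Qed.

Lemma invmx_Sigma_rel th : 0 < th.1 -> 0 < th.2 ->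
  invmx (Sigma delta m th) = W0^T *m rel_prec th *m W0.
Proof.
move=> s0 k0; rewrite invmx_Sigma// /rel_prec -/W0.
move: ((whitener delta m th)^T *m _) => B.
by rewrite -!mulmxA mulVmx// mulmx1 !mulmxA -trmx_mul mulVmx// trmx1 mul1mx.
Qed.

Lemma ln_det_Sigma th : 0 < th.1 -> 0 < th.2 ->
  ln (\det (Sigma delta m th)) = - 2 * ln (\det (whitener delta m th)).
Proof.
move=> s0 k0; have [d0 _] := ln_det_whitener delta m0 s0 k0.
have := congr1 determinant (whitenerK delta m0 s0 k0).
rewrite !det_mulmx det_tr det1 => h.
have dS : 0 < \det (Sigma delta m th).
  by rewrite -(pmulr_rgt0 _ d0) -(pmulr_lgt0 _ d0) h.
have := congr1 (@ln R) h; rewrite ln1 !lnM ?posrE ?mulr_gt0//; lra.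
Qed.

Lemma det_rel_prec th : \det (rel_prec th) = (\det (whitener delta m th) / \det W0) ^+ 2.
Proof.
by rewrite /rel_prec !det_mulmx !det_tr det_inv; field; move: W0u; rewrite unitmxE unitfE.
Qed.

Lemma ln_det_rel_prec th : 0 < th.1 -> 0 < th.2 ->
  ln (\det (rel_prec th)) = 2 * (ln (\det (whitener delta m th)) - ln (\det W0)).
Proof.
move=> s0 k0; have [d0 _] := ln_det_whitener delta m0 s0 k0.
have [d00 _] := ln_det_whitener delta m0 s00 k00.
by rewrite det_rel_prec lnXn ?divr_gt0// ln_div ?posrE// mulr_natl.
Qed.

Lemma trace_rel_prec th : 0 < th.1 -> 0 < th.2 ->
  \tr (rel_prec th) = th0.1 / th.1 * (1 + m.-1%:R * ar_ratio delta m th0 th) ^+ 2.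
Proof.
move=> s0 k0; rewrite -whitener_trace//.
have -> : Sigma delta m th0 = invmx W0 *m (invmx W0)^T.
  have := congr1 (fun M => invmx W0 *m M *m (invmx W0)^T) (whitenerK delta m0 s00 k00).
  by rewrite /= mulmx1 -/W0 -!mulmxA mulKmx// -trmx_mul mulVmx// trmx1 mulmx1.
rewrite (_ : rel_prec th = ((invmx W0)^T *m (whitener delta m th)^T) *m (whitener delta m th *m invmx W0)).
  by rewrite mxtrace_mulC !mulmxA.
by rewrite /rel_prec -/W0 !mulmxA.
Qed.

(** Trace and determinant are both explicit for a separable AR(1) covariance. From here on the
    entropy is a function of [m] and three scalar ratios. *)
Lemma entropy_rel_prec th : 0 < th.1 -> 0 < th.2 ->
  entropy (rel_prec th) =
  th0.1 / th.1 * (1 + m.-1%:R * ar_ratio delta m th0 th) ^+ 2 - (m ^ 2)%:R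
  - (m ^ 2)%:R * ln (th0.1 / th.1)
  - 2 * (m * m.-1)%:R * ln ((1 - rho delta m th0 ^+ 2) / (1 - rho delta m th ^+ 2)).
Proof.
move=> s0 k0; rewrite /entropy trace_rel_prec// ln_det_rel_prec//.
have [_ ->] := ln_det_whitener delta m0 s0 k0.
have [_ ->] := ln_det_whitener delta m0 s00 k00.
have r2 t : 0 < t.2 -> 0 < 1 - rho delta m t ^+ 2.
  move=> t0; have /andP[r0 r1] := rho_in01 delta m0 t0.
  by rewrite subr_gt0 expr_lt1// ltW.
rewrite !ln_div ?posrE ?r2//; by field; rewrite gt_eqF.
Qed.

Lemma kl_entropy th : 0 < th.1 -> 0 < th.2 ->
  ln (\det (Sigma delta m th)) - ln (\det (Sigma delta m th0)) + \tr (rel_prec th) - (m ^ 2)%:R =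
  entropy (rel_prec th).
Proof.
move=> s0 k0; rewrite (ln_det_Sigma s0 k0) (ln_det_Sigma s00 k00) /entropy ln_det_rel_prec//.
have alg (a b t n : R) : - 2 * a - - 2 * b + t - n = t - n - 2 * (a - b) by ring.
exact: alg.
Qed.
End relative_precision.

Section uniform_bounds.
Variables (R : realType) (delta : R) (m : nat) (s1 s2 k1 k2 : R).
Hypotheses (m0 : (0 < m)%N) (s1_gt0 : 0 < s1) (k1_gt0 : 0 < k1) (s12 : s1 <= s2) (k12 : k1 <= k2).
Implicit Types th : R * R.

Definition in_box th := [/\ s1 <= th.1, th.1 <= s2, k1 <= th.2 & th.2 <= k2].

(** The constant [8 r^2] of [ar1_energy_le] with [r = k2 / k1], squared because there are two axes,
    times the largest ratio of variances. *)
Definition prec_bound : R := s2 / s1 * (8 * (k2 / k1) ^+ 2) ^+ 2.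

Lemma rho_comparable th th' : in_box th -> in_box th' ->
  1 - rho delta m th <= k2 / k1 * (1 - rho delta m th').
Proof.
move=> [_ _ h1 h2] [_ _ h3 h4].
have d0 := mesh_gt0 delta m0.
apply: onem_expRN_le.
- by rewrite mulr_gt0// (lt_le_trans k1_gt0).
- by rewrite mulr_gt0// (lt_le_trans k1_gt0).
- by rewrite ler_pdivlMr// mul1r.
- rewrite mulrA ler_pM2r//; apply: le_trans h2 _.
  by rewrite mulrAC ler_pdivlMr// ler_pM2l// (lt_le_trans k1_gt0).
Qed.

Lemma whitener_le th th' (y : 'cV[R]_(m ^ 2)) : in_box th -> in_box th' ->
  dot (whitener delta m th *m y) (whitener delta m th *m y) <=
  prec_bound * dot (whitener delta m th' *m y) (whitener delta m th' *m y).
Proof.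
move=> b b'; have [h1 h2 h3 h4] := b; have [h1' h2' h3' h4'] := b'.
have p (x y' : R) : 0 < x -> x <= y' -> 0 < y' by exact: lt_le_trans.
have W t : s1 <= t.1 -> dot (whitener delta m t *m y) (whitener delta m t *m y) =
    t.1^-1 * dot ((arW m (rho delta m t) *t arW m (rho delta m t)) *m (y : 'cV_(m * m)))
     ((arW m (rho delta m t) *t arW m (rho delta m t)) *m (y : 'cV_(m * m))).
  move=> h; rewrite /whitener -scalemxAl dotZl dotZr mulrA -invfM -expr2 sqr_sqrtr//.
  by rewrite ltW// (p s1).
rewrite (W th h1) (W th' h1') /prec_bound.
set c := 8 * (k2 / k1) ^+ 2.
have c0 : 0 <= c by exact: (mulr_ge0 (ler0n _ 8) (sqr_ge0 _)).
have e v : dot (arW m (rho delta m th) *m v) (arW m (rho delta m th) *m v) <=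
    c * dot (arW m (rho delta m th') *m v) (arW m (rho delta m th') *m v).
  have r01 := rho_in01 delta m0 (p _ _ k1_gt0 h3).
  have r01' := rho_in01 delta m0 (p _ _ k1_gt0 h3').
  have [f fE] := arW_energy v r01 m0; rewrite !fE//.
  apply: ar1_energy_le => //; try exact: rho_comparable.
  by rewrite ler_pdivlMr// mul1r.
have := @dot_tens_le _ _ _ _ _ c0 e y.
set a := dot _ _; set a' := dot _ _ => aa'.
have a'0 : 0 <= a' by exact: dot_ge0.
have a0 : 0 <= a by exact: dot_ge0.
clear W e; clearbody a a' c.
have t0 : 0 < th.1 by exact: p h1.
have t'0 : 0 < th'.1 by exact: p h1'.
clear p b b' h2 h3 h4 h3' h4'; move: th.1 th'.1 h1 h1' h2' t0 t'0 => t t' h1 h1' h2' t0 t'0.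
have ca : 0 <= c ^+ 2 * a' by rewrite mulr_ge0 ?sqr_ge0.
apply: (@le_trans _ _ (s1^-1 * (c ^+ 2 * a'))).
  by rewrite ler_pM ?lef_pV2 ?posrE ?invr_ge0 ?(ltW t0).
have -> : s2 / s1 * c ^+ 2 * (t'^-1 * a') = s1^-1 * (c ^+ 2 * a') * (s2 / t') by ring.
rewrite ler_peMr ?mulr_ge0 ?invr_ge0 ?(ltW s1_gt0)//.
by rewrite ler_pdivlMr ?mul1r.
Qed.

Lemma rel_prec_le th0 th x : in_box th0 -> in_box th ->
  quad (rel_prec delta m th0 th) x <= prec_bound * dot x x.
Proof.
move=> b0 b; have [h1 _ h3 _] := b0.
have s0 := lt_le_trans s1_gt0 h1; have k0 := lt_le_trans k1_gt0 h3.
by rewrite [X in _ <= _ * X](dot_whiten0 delta m0 s0 k0) quad_rel_prec; exact: whitener_le.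
Qed.

Lemma rel_prec_ge th0 th x : in_box th0 -> in_box th ->
  dot x x <= prec_bound * quad (rel_prec delta m th0 th) x.
Proof.
move=> b0 b; have [h1 _ h3 _] := b0.
have s0 := lt_le_trans s1_gt0 h1; have k0 := lt_le_trans k1_gt0 h3.
by rewrite quad_rel_prec [leLHS](dot_whiten0 delta m0 s0 k0); exact: whitener_le.
Qed.
End uniform_bounds.

(** * Order of magnitude of the entropy *)

Lemma ln_le_sub1 (R : realType) (x : R) : 0 < x -> ln x <= x - 1.
Proof. by move=> x0; have := @le_ln1Dx R (x - 1); rewrite (addrC 1) subrK; apply; lra. Qed.

Lemma onem_expRN_ge (R : realType) (x : R) : 0 <= x -> x / (1 + x) <= 1 - expR (- x).
Proof.
move=> x0; have x1 : 0 < 1 + x by lra.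
rewrite ler_pdivrMr// expRN mulrBl mul1r.
have : (expR x)^-1 * (1 + x) <= 1.
  by rewrite mulrC ler_pdivrMr ?expR_gt0// mul1r expR_ge1Dx.
lra.
Qed.

Lemma onem_expRN_ub (R : realType) (x : R) : 1 - expR (- x) <= x.
Proof. by have := expR_ge1Dx (- x); lra. Qed.

(** * One axis of the grid: expansions in the mesh *)

Section one_dimensional.
Variables (R : realType) (k1 k2 : R).
Hypotheses (k1_gt0 : 0 < k1) (k12 : k1 <= k2).
Implicit Types h k : R.

Let in_k k := k1 <= k <= k2.
Definition crho h k : R := expR (- (k * h)).
(** [var_ratio] and [bias_ratio] add up to [ar_ratio], because [1 - 2 r r0 + r^2 = (1 - r0^2) + (r -
    r0)^2]. The first tends to [k0 / k] as [h] tends to 0; the second, the effect of a wrong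
    coefficient, is [O (h)] and at least a constant times [h (k - k0)^2]. *)
Definition var_ratio h k0 k : R := (1 - crho h k0 ^+ 2) / (1 - crho h k ^+ 2).
Definition bias_ratio h k0 k : R := (crho h k - crho h k0) ^+ 2 / (1 - crho h k ^+ 2).

Let k2_gt0 : 0 < k2. Proof. exact: lt_le_trans k12. Qed.
Let k_gt0 k : in_k k -> 0 < k. Proof. by move=> /andP[h _]; exact: lt_le_trans h. Qed.

Lemma crho_sq h k : crho h k ^+ 2 = expR (- (2 * k * h)).
Proof. by rewrite /crho -expRM_natl; congr expR; ring. Qed.

Lemma crho_var_bounds h k : 0 < h <= 1 -> in_k k ->
  2 * k1 / (1 + 2 * k2) * h <= 1 - crho h k ^+ 2 <= 2 * k2 * h.
Proof.
move=> /andP[h0 h1] kk; have k0 := k_gt0 kk; case/andP: (kk) => ka kb.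
rewrite crho_sq; apply/andP; split.
  have x0 : 0 <= 2 * k * h by rewrite mulr_ge0 ?mulr_ge0 ?ltW.
  apply: le_trans (onem_expRN_ge x0).
  have p1 : 0 < 1 + 2 * k2 by lra.
  have p2 : 0 < 1 + 2 * k * h by lra.
  rewrite ler_pdivlMr// mulrAC -!mulrA ler_pM2l// [_^-1 * _]mulrC !mulrA ler_pdivrMr//.
  have bk : k * h <= k2 by apply: le_trans kb; rewrite ler_piMr// ltW.
  have ab : k1 * h <= k * h by rewrite ler_pM2r.
  have a0 : 0 < k1 * h by rewrite mulr_gt0.
  have -> : 1 + 2 * k * h = 1 + 2 * (k * h) by ring.
  rewrite mulrAC; apply: ler_pM => //; lra.
apply: le_trans (onem_expRN_ub _) _.
by rewrite ler_pM2r// ler_pM2l.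
Qed.

Lemma crho_var_gt0 h k : 0 < h <= 1 -> in_k k -> 0 < 1 - crho h k ^+ 2.
Proof.
move=> hh kk; have /andP[+ _] := crho_var_bounds hh kk; apply: lt_le_trans.
by case/andP: hh => h0 _; rewrite mulr_gt0// divr_gt0 ?mulr_gt0// addr_gt0// mulr_gt0.
Qed.

Lemma var_ratio_bounds : exists2 a : R, 0 < a & forall h k0 k,
  0 < h <= 1 -> in_k k0 -> in_k k -> a <= var_ratio h k0 k <= a^-1.
Proof.
pose c := 2 * k1 / (1 + 2 * k2); pose C := 2 * k2.
have c0 : 0 < c by rewrite divr_gt0 ?mulr_gt0// addr_gt0// mulr_gt0.
have C0 : 0 < C by rewrite mulr_gt0.
exists (c / C) => [|h k0 k hh kk0 kk]; first by rewrite divr_gt0.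
have /andP[h0 h1] := hh.
have /andP[a1 a2] := crho_var_bounds hh kk0.
have /andP[b1 b2] := crho_var_bounds hh kk.
have p := crho_var_gt0 hh kk.
rewrite -/c -/C in a1 a2 b1 b2; rewrite /var_ratio; apply/andP; split.
  rewrite ler_pdivlMr// (le_trans _ a1)// mulrAC ler_pdivrMr//.
  by have := ler_wpM2l (ltW c0) b2; lra.
rewrite ler_pdivrMr// (le_trans a2)// invf_div [leRHS]mulrAC ler_pdivlMr//.
by have := ler_wpM2l (ltW C0) b1; lra.
Qed.

Lemma var_ratio_limit : exists2 C : R, 0 < C & forall h k0 k,
  0 < h <= 1 -> in_k k0 -> in_k k -> `|var_ratio h k0 k - k0 / k| <= C * h.
Proof.
pose c := 2 * k1 / (1 + 2 * k2).
have c0 : 0 < c by rewrite divr_gt0 ?mulr_gt0// addr_gt0// mulr_gt0.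
exists (4 * k2 ^+ 3 / (c * k1)) => [|h k0 k hh kk0 kk].
  by apply: divr_gt0; [apply: mulr_gt0 => //; exact: exprn_gt0|exact: mulr_gt0].
have /andP[h0 h1] := hh.
have p := crho_var_gt0 hh kk; have /andP[b1 _] := crho_var_bounds hh kk.
rewrite -/c in b1.
have kp := k_gt0 kk; have k0p := k_gt0 kk0.
have -> : var_ratio h k0 k - k0 / k =
    (k * (1 - crho h k0 ^+ 2) - k0 * (1 - crho h k ^+ 2)) / (k * (1 - crho h k ^+ 2)).
  by rewrite /var_ratio; field; rewrite !gt_eqF.
rewrite normrM normfV (ger0_norm (ltW (mulr_gt0 kp p))) ler_pdivrMr ?mulr_gt0//.
have quad_lb (x : R) : 0 <= x -> x - x ^+ 2 <= 1 - expR (- x).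
  move=> x0; apply: le_trans (onem_expRN_ge x0).
  by rewrite ler_pdivlMr; [have : 0 <= x ^+ 3 by rewrite exprn_ge0|]; lra.
(* The first-order terms [2 k k0 h] cancel, which leaves a remainder of order [h^2]. *)
have num : `|k * (1 - crho h k0 ^+ 2) - k0 * (1 - crho h k ^+ 2)| <= 4 * k2 ^+ 3 * h ^+ 2.
  rewrite !crho_sq; set x := 2 * k * h; set x0 := 2 * k0 * h.
  have xp : 0 <= x by rewrite !mulr_ge0// ltW.
  have x0p : 0 <= x0 by rewrite !mulr_ge0// ltW.
  have u1 := onem_expRN_ub x; have u2 := onem_expRN_ub x0.
  have l1 := quad_lb _ xp; have l2 := quad_lb _ x0p.
  have kx : k * x0 = k0 * x by rewrite /x /x0; ring.
  have cub (a b : R) : 0 <= a <= k2 -> 0 <= b <= k2 -> a * (2 * b * h) ^+ 2 <= 4 * k2 ^+ 3 * h ^+ 2.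
    move=> /andP[a0 a2] /andP[bp b2].
    have -> : a * (2 * b * h) ^+ 2 = 4 * (a * b ^+ 2) * h ^+ 2 by ring.
    rewrite ler_wpM2r ?sqr_ge0// ler_pM2l// (exprS k2 2) ler_pM ?sqr_ge0//.
    by rewrite lerXn2r// nnegrE ltW.
  have [/andP[_ ka] /andP[_ ka0]] := (kk, kk0).
  have b0 : 0 <= k0 <= k2 by rewrite (ltW k0p).
  have bk : 0 <= k <= k2 by rewrite (ltW kp).
  have c1 : k0 * x ^+ 2 <= 4 * k2 ^+ 3 * h ^+ 2 by exact: (cub _ _ b0 bk).
  have c2 : k * x0 ^+ 2 <= 4 * k2 ^+ 3 * h ^+ 2 by exact: (cub _ _ bk b0).
  have m1 := ler_wpM2l (ltW kp) u2; have m2 := ler_wpM2l (ltW kp) l2.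
  have m3 := ler_wpM2l (ltW k0p) u1; have m4 := ler_wpM2l (ltW k0p) l1.
  rewrite !mulrBr in m2 m4; rewrite ler_norml; apply/andP; split; lra.
apply: le_trans num _.
have -> : 4 * k2 ^+ 3 / (c * k1) * h * (k * (1 - crho h k ^+ 2)) =
   4 * k2 ^+ 3 * h * ((1 - crho h k ^+ 2) / c * (k / k1)) by field; rewrite !gt_eqF.
have pos : 0 < 4 * k2 ^+ 3 * h by rewrite mulr_gt0 ?mulr_gt0 ?exprn_gt0.
rewrite expr2 mulrA ler_pM2l//.
have : h <= (1 - crho h k ^+ 2) / c by rewrite ler_pdivlMr// mulrC.
have : 1 <= k / k1 by rewrite ler_pdivlMr// mul1r; case/andP: kk.
move=> g1 g2; rewrite -[leLHS]mulr1; apply: ler_pM => //; exact: ltW.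
Qed.

Lemma bias_ratio_ub : exists2 C : R, 0 < C & forall h k0 k,
  0 < h <= 1 -> in_k k0 -> in_k k -> bias_ratio h k0 k <= C * h.
Proof.
pose c := 2 * k1 / (1 + 2 * k2).
have c0 : 0 < c by rewrite divr_gt0 ?mulr_gt0// addr_gt0// mulr_gt0.
exists (k2 ^+ 2 / c) => [|h k0 k hh kk0 kk]; first by rewrite divr_gt0 ?exprn_gt0.
have /andP[h0 h1] := hh; have p := crho_var_gt0 hh kk.
have /andP[b1 _] := crho_var_bounds hh kk; rewrite -/c in b1.
rewrite /bias_ratio ler_pdivrMr//.
have ub k' : in_k k' -> 1 - k2 * h <= crho h k' <= 1.
  move=> kk'; apply/andP; split; last first.
    by rewrite /crho expR_le1 oppr_le0 mulr_ge0// ltW// k_gt0.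
  have := onem_expRN_ub (k' * h); rewrite -/(crho _ _).
  have : k' * h <= k2 * h by rewrite ler_pM2r//; case/andP: kk'.
  lra.
have /andP[u1 u2] := ub _ kk; have /andP[v1 v2] := ub _ kk0.
have : `|crho h k - crho h k0| <= k2 * h by rewrite ler_norml; apply/andP; split; lra.
move=> d; have : (crho h k - crho h k0) ^+ 2 <= (k2 * h) ^+ 2.
  rewrite -real_normK ?num_real//; rewrite lerXn2r// nnegrE.
  by rewrite mulr_ge0// ltW.
move=> /le_trans; apply.
have -> : k2 ^+ 2 / c * h * (1 - crho h k ^+ 2) = k2 ^+ 2 * h * ((1 - crho h k ^+ 2) / c) by ring.
have -> : (k2 * h) ^+ 2 = k2 ^+ 2 * h * h by ring.
by rewrite ler_pM2l ?mulr_gt0 ?exprn_gt0// ler_pdivlMr// mulrC.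
Qed.

Lemma bias_ratio_lb : exists2 c : R, 0 < c & forall h k0 k,
  0 < h <= 1 -> in_k k0 -> in_k k -> c * h * (k - k0) ^+ 2 <= bias_ratio h k0 k.
Proof.
exists (expR (- k2) ^+ 2 / (2 * k2)) => [|h k0 k hh kk0 kk].
  by rewrite divr_gt0 ?mulr_gt0 ?exprn_gt0 ?expR_gt0.
have /andP[h0 h1] := hh; have p := crho_var_gt0 hh kk.
have /andP[_ b2] := crho_var_bounds hh kk.
rewrite /bias_ratio ler_pdivlMr//.
have gap a b : in_k a -> in_k b -> a <= b -> expR (- k2) * (h * (b - a)) <= crho h a - crho h b.
  move=> ka kb ab.
  have -> : crho h a - crho h b = crho h b * (expR (h * (b - a)) - 1).
    have -> : crho h a = crho h b * expR (h * (b - a)).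
      by rewrite /crho -expRD; congr expR; ring.
    by rewrite [RHS]mulrBr mulr1.
  apply: ler_pM; rewrite ?expR_ge0//.
  - by rewrite mulr_ge0 ?(ltW h0)// subr_ge0.
  - rewrite ler_expR lerN2; case/andP: kb => b1 b3; apply: le_trans b3.
    by rewrite ler_piMr// ltW// (lt_le_trans k1_gt0).
  - by have := expR_ge1Dx (h * (b - a)); lra.
have sq : (expR (- k2) * (h * (k - k0))) ^+ 2 <= (crho h k - crho h k0) ^+ 2.
  have g0 a b : a <= b -> 0 <= expR (- k2) * (h * (b - a)).
    by move=> ab; rewrite mulr_ge0 ?expR_ge0// mulr_ge0 ?(ltW h0)// subr_ge0.
  have [kk0'|/ltW kk0'] := leP k k0.
    have g := gap _ _ kk kk0 kk0'; have z := g0 _ _ kk0'.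
    rewrite -[leLHS]sqrrN (_ : - (expR (- k2) * (h * (k - k0))) = expR (- k2) * (h * (k0 - k))); last by ring.
    by rewrite ler_pXn2r// nnegrE (le_trans z g).
  have g := gap _ _ kk0 kk kk0'; have z := g0 _ _ kk0'.
  by rewrite -[leRHS]sqrrN opprB ler_pXn2r// nnegrE (le_trans z g).
apply: le_trans sq.
have -> : (expR (- k2) * (h * (k - k0))) ^+ 2 = expR (- k2) ^+ 2 / (2 * k2) * h * (k - k0) ^+ 2 * (2 * k2 * h).
  by field; rewrite gt_eqF.
rewrite ler_wpM2l// mulr_ge0 ?sqr_ge0// mulr_ge0 ?(ltW h0)// divr_ge0 ?mulr_ge0 ?(ltW k2_gt0)//.
Qed.

Lemma bias_ratio_ge0 h k0 k : 0 < h <= 1 -> in_k k -> 0 <= bias_ratio h k0 k.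
Proof. by move=> hh kk; rewrite divr_ge0 ?sqr_ge0// ltW// crho_var_gt0. Qed.
End one_dimensional.

Section scalar_entropy.
Variables (R : realType) (N u q s : R).
Hypotheses (N0 : 0 <= N) (u0 : 0 < u) (s0 : 0 < s) (sq : s <= q).
Let M := N + 1.
Let z := (1 + N * q) / M.
Let v := u * z ^+ 2.
(** The formula of [entropy_rel_prec] with [M = m], [N = m - 1], [u] the ratio of variances, [q] the
    [ar_ratio] and [s] the [var_ratio]. Then [z] is the mean diagonal entry of the whitened
    covariance along one axis, and [v] is the trace of [rel_prec] divided by [m ^ 2]. *)
Definition scalar_entropy : R :=
  u * (1 + N * q) ^+ 2 - M ^+ 2 - M ^+ 2 * ln u - 2 * (M * N) * ln s.

Let M0 : 0 < M. Proof. exact: ltr_wpDl. Qed.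
Let q0 : 0 < q. Proof. exact: lt_le_trans sq. Qed.
Let z0 : 0 < z. Proof. by rewrite divr_gt0// ltr_pwDl// mulr_ge0// ltW. Qed.
Let v0 : 0 < v. Proof. by rewrite mulr_gt0// exprn_gt0. Qed.

(** This separates a wrong overall scale [v] from a wrong correlation. Both parts turn out to be
    nonnegative, so each alone bounds the entropy from below. *)
Let entE : scalar_entropy = M ^+ 2 * (v - 1 - ln v) + 2 * M * (M * ln z - N * ln s).
Proof.
have zM : 1 + N * q = M * z by rewrite /z [RHS]mulrC divfK// gt_eqF.
have lnv : ln v = ln u + 2 * ln z.
  by rewrite /v lnM ?posrE ?exprn_gt0// lnXn// mulr_natl.
rewrite /scalar_entropy zM lnv /v; ring.
Qed.

Let phi_ge0 : 0 <= v - 1 - ln v.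
Proof. by rewrite subr_ge0 ln_le_sub1. Qed.

(* the concavity bound [N ln q <= (N + 1) ln ((1 + N q) / (N + 1))] *)
Let jensen : N * ln q <= M * ln z.
Proof.
have h1 : ln (q / z) <= q / z - 1 by apply: ln_le_sub1; rewrite divr_gt0.
have h2 : ln z^-1 <= z^-1 - 1 by apply: ln_le_sub1; rewrite invr_gt0.
rewrite ln_div ?posrE// in h1; rewrite lnV ?posrE// in h2.
have e : N * (q / z) + z^-1 = M.
  have -> : N * (q / z) + z^-1 = (1 + N * q) / z by ring.
  have -> : 1 + N * q = M * z by rewrite /z [RHS]mulrC divfK// gt_eqF.
  by rewrite mulfK// gt_eqF.
have := ler_wpM2l N0 h1; rewrite !mulrBr mulr1 => h3.
have -> : M * ln z = N * ln z + ln z by rewrite /M; ring.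
have : M = N + 1 by []. lra.
Qed.

Let bias_lb : N * (1 - s / q) <= N * ln q - N * ln s.
Proof.
rewrite -mulrBr ler_wpM2l//.
have : ln (s / q) <= s / q - 1 by apply: ln_le_sub1; rewrite divr_gt0.
rewrite ln_div ?posrE//; lra.
Qed.

Lemma scalar_entropy_ge_var : M ^+ 2 * (v - 1 - ln v) <= scalar_entropy.
Proof.
rewrite entE lerDl mulr_ge0 ?mulr_ge0 ?(ltW M0)//.
have : 0 <= N * (1 - s / q).
  by rewrite mulr_ge0// subr_ge0 ler_pdivrMr// mul1r.
have := jensen; have := bias_lb; lra.
Qed.

Lemma scalar_entropy_ge_bias : 2 * M * (N * (1 - s / q)) <= scalar_entropy.
Proof.
rewrite entE; apply: ler_wpDl; first by rewrite mulr_ge0 ?sqr_ge0.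
rewrite ler_pM2l ?mulr_gt0//; have := jensen; have := bias_lb; lra.
Qed.

(** The inequality [ln y <= y - 1] at suitable quotients and reciprocals bounds each part from
    above. The term [q + q^-1] is the price of the first diagonal entry, which is 1 instead of
    [q]. *)
Lemma scalar_entropy_le :
  scalar_entropy <= M ^+ 2 * ((v - 1) ^+ 2 / v) + 2 * M * (N * ((q - s) / s) + q + q^-1).
Proof.
rewrite entE; apply: lerD.
  rewrite ler_pM2l ?exprn_gt0//.
  have h : ln v^-1 <= v^-1 - 1 by apply: ln_le_sub1; rewrite invr_gt0.
  rewrite lnV ?posrE// in h.
  have -> : (v - 1) ^+ 2 / v = v - 2 + v^-1 by field; rewrite gt_eqF.
  lra.
rewrite ler_pM2l ?mulr_gt0//.
have h1 : ln (q / s) <= q / s - 1 by apply: ln_le_sub1; rewrite divr_gt0.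
have h2 : ln (z / q) <= z / q - 1 by apply: ln_le_sub1; rewrite divr_gt0.
have h3 := ln_le_sub1 q0.
rewrite ln_div ?posrE// in h1; rewrite ln_div ?posrE// in h2.
have e : M * (z / q - 1) = q^-1 - 1.
  by rewrite /z /M; field; rewrite !gt_eqF.
have e2 : (q - s) / s = q / s - 1 by field; rewrite gt_eqF.
have m2 := ler_wpM2l (ltW M0) h2; have m1 := ler_wpM2l N0 h1.
have Mq : M * ln q = N * ln q + ln q by rewrite /M; ring.
rewrite e2; move: m1 m2; rewrite e !mulrBr; lra.
Qed.

Lemma weighted_mean_bounds a Q : 0 < a <= 1 -> a <= q <= Q -> a <= z <= 1 + Q.
Proof.
move=> /andP[a0 a1] /andP[aq qQ]; rewrite /z ler_pdivlMr// ler_pdivrMr//.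
have := ler_wpM2l N0 aq; have := ler_wpM2l N0 qQ.
have Q0 : 0 < Q by apply: lt_le_trans qQ.
rewrite /M; move: N0 Q0 => + +; move: (N) => n n0 Q0 h1 h2.
have h3 : 0 <= n * Q by rewrite mulr_ge0// ltW.
apply/andP; split; lra.
Qed.

Lemma weighted_mean_dist : z - q = (1 - q) / M.
Proof. by rewrite /z /M; field; rewrite gt_eqF. Qed.
End scalar_entropy.

Ltac pos := repeat match goal with
  | |- is_true (0 < _ + _) => apply: addr_gt0
  | |- is_true (0 < _ ^+ _) => apply: exprn_gt0
  | |- is_true (0 < _^-1) => rewrite invr_gt0
  | |- is_true (0 < _ * _) => apply: mulr_gt0
  end; try assumption; try by [].

Section mesh.
Variables (R : realType) (delta : R).
Hypothesis delta01 : 0 <= delta < 1.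

Lemma mesh_in01 (m : nat) : (0 < m)%N -> 0 < mesh delta m <= 1.
Proof.
move=> m0; rewrite mesh_gt0//= /mesh powRN invf_le1 ?powR_gt0 ?ltr0n//.
rewrite -[leLHS](powRr0 m%:R); apply: ler_powR; first by rewrite ler1n.
by case/andP: delta01 => _ h; rewrite subr_ge0 ltW.
Qed.

(** The product is [m ^ delta]. Boundary effects of relative order [1 / m] are thereby absorbed into
    terms of the order of the mesh. *)
Lemma mesh_mul_ge1 (m : nat) : (0 < m)%N -> 1 <= m%:R * mesh delta m.
Proof.
move=> m0; rewrite /mesh powRN ler_pdivlMr ?powR_gt0 ?ltr0n// mul1r.
by apply: ler1_powR; [rewrite ler1n|case/andP: delta01 => h _; rewrite lerBlDr lerDl].
Qed.

Lemma mesh_cvg0 (e : R) : 0 < e -> \forall m \near \oo, mesh delta m <= e.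
Proof.
move=> e0; have d0 : 0 < 1 - delta by case/andP: delta01 => _; rewrite subr_gt0.
exists (Num.truncn (e^-1 `^ (1 - delta)^-1)).+1 => // m /= hm.
have m0 : (0 < m)%N by apply: leq_trans hm.
rewrite /mesh powRN -[leRHS]invrK lef_pV2 ?posrE ?invr_gt0 ?powR_gt0 ?ltr0n//.
have -> : e^-1 = (e^-1 `^ (1 - delta)^-1) `^ (1 - delta).
  by rewrite -powRrM mulVf ?gt_eqF// powRr1// invr_ge0 ltW.
apply: ge0_ler_powR; rewrite ?nnegrE ?powR_ge0 ?ler0n ?(ltW d0)//.
apply: le_trans (ltW (truncnS_gt _)) _.
by rewrite ler_nat.
Qed.
End mesh.

Lemma half_gap (R : realType) (x y z w t : R) :
  x <= y + z + w -> x = 4 * t -> y <= t -> z <= t -> 2 * t <= w.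
Proof. lra. Qed.

Lemma half_le_gap (R : realFieldType) (x y z : R) : x <= y + z -> z <= x / 2 -> x / 2 <= y.
Proof. lra. Qed.

Lemma norm_sub1_le (R : realDomainType) (x y : R) : 0 <= x -> x <= y -> `|x - 1| <= y + 1.
Proof. by move=> x0 xy; rewrite ler_norml; apply/andP; split; lra. Qed.

Section entropy_compare.
Variables (R : realType) (delta s1 s2 k1 k2 : R).
Hypotheses (delta01 : 0 <= delta < 1).
Hypotheses (s1_gt0 : 0 < s1) (k1_gt0 : 0 < k1) (s12 : s1 <= s2) (k12 : k1 <= k2).
Implicit Types th : R * R.
Local Notation box := (in_box s1 s2 k1 k2).
Local Notation ratio th0 th := (th0.1 / th.1 * (th0.2 / th.2) ^+ 2).

Let v_of (m : nat) th0 th : R :=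
  th0.1 / th.1 * ((1 + m.-1%:R * ar_ratio delta m th0 th) / m%:R) ^+ 2.

(** Here [v] is within [K h] of [ratio], the true value of [sigma^2 kappa^2] divided by that of the
    model. A wrong product costs order [m^2]; a wrong [kappa] always costs at least order
    [m^2 h]. *)
Lemma entropy_two_sided : exists2 K : R, 0 < K & forall m th0 th, (1 < m)%N ->
  box th0 -> box th ->
  let v := v_of m th0 th in let h := mesh delta m in
  let E := entropy (rel_prec delta m th0 th) in
  [/\ 0 < v <= K, `|v - ratio th0 th| <= K * h,
      m%:R ^+ 2 * (v - 1 - ln v) <= E,
      K^-1 * (m%:R ^+ 2 * h * (th.2 - th0.2) ^+ 2) <= E &
      E <= K * m%:R ^+ 2 * ((v - 1) ^+ 2 + h)].
Proof.
have [a a0 sbd] := var_ratio_bounds k1_gt0 k12.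
have [Cs Cs0 slim] := var_ratio_limit k1_gt0 k12.
have [Ce Ce0 eub] := bias_ratio_ub k1_gt0 k12.
have [ce ce0 elb] := bias_ratio_lb k1_gt0 k12.
pose Q := a^-1 + Ce.
have Q0 : 0 < Q by rewrite /Q; pos.
pose Cz := Cs + Ce + 1 + Q.
have s2_gt0 : 0 < s2 by exact: lt_le_trans s12.
have k2_gt0 : 0 < k2 by exact: lt_le_trans k12.
pose V := s2 / s1 * (1 + Q) ^+ 2.
pose v0 := s1 / s2 * a ^+ 2.
have v00 : 0 < v0 by rewrite /v0; pos.
have V0 : 0 < V by rewrite /V; pos.
pose Cv := s2 / s1 * (Cz * (1 + Q + k2 / k1)).
have Cz0 : 0 < Cz by rewrite /Cz; pos.
have Cv0 : 0 < Cv by rewrite /Cv; pos.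
pose Ku1 := v0^-1; pose Ku2 := 2 * (Ce / a + Q + a^-1).
have Ku10 : 0 < Ku1 by rewrite /Ku1; pos.
have Ku20 : 0 < Ku2 by rewrite /Ku2; pos.
have ceQ : 0 < ce / Q by pos.
pose Ki := (ce / Q)^-1.
have Ki0 : 0 < Ki by rewrite /Ki; pos.
(* Each item has a constant of its own, and the sum serves for all of them. *)
exists (V + Cv + Ki + Ku1 + Ku2); first by pos.
move=> m th0 th m1 b0 b v h E.
have m0 : (0 < m)%N by exact: leq_trans m1.
have [b01 b02 b03 b04] := b0; have [b1 b2 b3 b4] := b.
have hh := mesh_in01 delta01 m0; rewrite -/h in hh.
have /andP[h0 h1] := hh.
have kk0 : k1 <= th0.2 <= k2 by rewrite b03.
have kk : k1 <= th.2 <= k2 by rewrite b3.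
have := sbd _ _ _ hh kk0 kk; have := slim _ _ _ hh kk0 kk.
have := eub _ _ _ hh kk0 kk; have := elb _ _ _ hh kk0 kk.
have := bias_ratio_ge0 k1_gt0 k12 th0.2 hh kk.
set s := var_ratio _ _ _; set e := bias_ratio _ _ _ => e_ge0 e_lb e_ub s_lim /andP[s_lb s_ub].
have a1 : a <= 1.
  have := sbd _ _ _ hh kk kk; rewrite /var_ratio divff => [/andP[]//|].
  by rewrite gt_eqF// (crho_var_gt0 k1_gt0 k12 hh kk).
have qE : ar_ratio delta m th0 th = s + e.
  rewrite /ar_ratio /s /e /var_ratio /bias_ratio -mulrDl; congr (_ / _).
  by rewrite /crho /rho -/h; ring.
set q := s + e in qE.
have M1 : m.-1%:R + 1 = m%:R :> R by rewrite natr1 prednK.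
set N : R := m.-1%:R in M1; set M : R := m%:R in M1.
have N_ge1 : 1 <= N by rewrite ler1n -ltnS prednK.
have N0 : 0 <= N by rewrite ler0n.
have Mp : 0 < M by rewrite ltr0n.
have s_gt0 : 0 < s by exact: lt_le_trans s_lb.
have sq : s <= q by rewrite lerDl.
have qQ : q <= Q.
  by rewrite lerD// (le_trans e_ub)// ler_piMr// ltW.
have aq : a <= q by exact: le_trans sq.
have q0 : 0 < q by exact: lt_le_trans aq.
set u := th0.1 / th.1.
have t0 : 0 < th.1 by exact: lt_le_trans b1.
have t00 : 0 < th0.1 by exact: lt_le_trans b01.
have kp : 0 < th.2 by exact: lt_le_trans b3.
have k0p : 0 < th0.2 by exact: lt_le_trans b03.
have u0 : 0 < u by rewrite divr_gt0.
have uub : u <= s2 / s1.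
  by rewrite ler_pM ?invr_ge0 ?(ltW t00) ?(ltW t0)// lef_pV2 ?posrE.
have ulb : s1 / s2 <= u.
  by rewrite ler_pM ?invr_ge0 ?(ltW s1_gt0) ?(ltW s2_gt0)// lef_pV2 ?posrE.
have EE : E = scalar_entropy N u q s.
  rewrite /E entropy_rel_prec// /scalar_entropy -/u qE -/N M1 -/M.
  by rewrite !natrM -/M -/N -expr2.
pose z := (1 + N * q) / M.
have vE : v = u * z ^+ 2 by rewrite /v /v_of qE.
have /andP[az zQ] : a <= z <= 1 + Q.
  by rewrite /z -M1; apply: (weighted_mean_bounds N0 s_gt0 sq); rewrite ?a0 ?aq.
have z0 : 0 < z by exact: lt_le_trans az.
have vp : 0 < v by rewrite vE mulr_gt0// exprn_gt0.
have vV : v <= V.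
  rewrite vE ler_pM ?(ltW u0) ?sqr_ge0//. rewrite ler_pXn2r// nnegrE ltW//.
  by rewrite addr_gt0.
have v0v : v0 <= v.
  rewrite vE ler_pM ?sqr_ge0 ?divr_ge0 ?(ltW s1_gt0) ?(ltW s2_gt0)//.
  by rewrite ler_pXn2r// nnegrE ltW.
have Mh : 1 <= M * h by exact: mesh_mul_ge1.
have zdist : `|z - th0.2 / th.2| <= Cz * h.
  have zq : z - q = (1 - q) / M by rewrite /z -M1; exact: weighted_mean_dist.
  have -> : z - th0.2 / th.2 = (s - th0.2 / th.2) + (e + (1 - q) / M).
    by rewrite -zq /q; ring.
  have d1 : `|(1 - q) / M| <= (1 + Q) * h.
    rewrite normrM normfV (ger0_norm (ltW Mp)) ler_pdivrMr// -mulrA (mulrC h).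
    apply: (@le_trans _ _ ((1 + Q) * 1)); last by rewrite ler_pM2l// addr_gt0.
    by rewrite mulr1 distrC [leRHS]addrC norm_sub1_le// ltW.
  have d2 : `|e| <= Ce * h by rewrite ger0_norm.
  have -> : Cz * h = Cs * h + (Ce * h + (1 + Q) * h) by rewrite /Cz; ring.
  apply: le_trans (ler_normD _ _) (lerD s_lim _).
  exact: le_trans (ler_normD _ _) (lerD d2 d1).
have vdist : `|v - ratio th0 th| <= Cv * h.
  rewrite -/u vE -mulrBr subr_sqr normrM (ger0_norm (ltW u0)) normrM.
  have zk : `|z + th0.2 / th.2| <= 1 + Q + k2 / k1.
    rewrite (ger0_norm (addr_ge0 (ltW z0) (divr_ge0 (ltW k0p) (ltW kp)))).
    by rewrite lerD// ler_pM ?(ltW k0p) ?invr_ge0 ?(ltW kp)// lef_pV2 ?posrE.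
  have w := ler_pM (normr_ge0 _) (normr_ge0 _) zdist zk.
  apply: le_trans (ler_pM (ltW u0) _ uub w) _; first by rewrite mulr_ge0.
  by rewrite /Cv le_eqVlt; apply/orP; left; apply/eqP; ring.
rewrite EE; split.
- by rewrite vp (le_trans vV)//; clear -V0 Cv0 Ki0 Ku10 Ku20; lra.
- apply: le_trans vdist _; rewrite ler_pM2r//.
  by clear -V0 Cv0 Ki0 Ku10 Ku20; lra.
- by rewrite vE /z -/M -M1; exact: (scalar_entropy_ge_var N0 u0 s_gt0 sq).
- apply: le_trans (scalar_entropy_ge_bias N0 u0 s_gt0 sq).
  rewrite -/M M1.
  apply: (@le_trans _ _ ((ce / Q) * (M ^+ 2 * h * (th.2 - th0.2) ^+ 2))).
    apply: ler_wpM2r; first by rewrite mulr_ge0 ?sqr_ge0// mulr_ge0 ?sqr_ge0 ?(ltW h0).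
    rewrite [leRHS](_ : _ = Ki^-1); last by rewrite /Ki invrK.
    rewrite lef_pV2 ?posrE//; last by pos.
    by clear -V0 Cv0 Ki0 Ku10 Ku20; lra.
  have -> : 1 - s / q = e / q by rewrite /q; field; rewrite gt_eqF.
  have eQ : e / Q <= e / q by rewrite ler_wpM2l// lef_pV2 ?posrE.
  apply: (@le_trans _ _ (2 * M * (N * (ce * h * (th.2 - th0.2) ^+ 2 / Q)))); last first.
    rewrite ler_pM2l ?mulr_gt0// ler_wpM2l// (le_trans _ eQ)//.
    by rewrite ler_pM2r ?invr_gt0.
  have -> : 2 * M * (N * (ce * h * (th.2 - th0.2) ^+ 2 / Q)) =
    (2 * N) * (M * (ce / Q * h * (th.2 - th0.2) ^+ 2)) by field; rewrite gt_eqF.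
  have -> : ce / Q * (M ^+ 2 * h * (th.2 - th0.2) ^+ 2) =
    M * (M * (ce / Q * h * (th.2 - th0.2) ^+ 2)) by ring.
  have M2N : M <= 2 * N by rewrite -M1 mulr_natl mulr2n lerD2l.
  apply: ler_wpM2r => //.
  by rewrite mulr_ge0 ?(ltW Mp)// mulr_ge0 ?sqr_ge0// mulr_ge0 ?(ltW ceQ) ?(ltW h0).
- apply: le_trans (scalar_entropy_le N0 u0 s_gt0 sq) _.
  rewrite -/M M1 -/z -vE (_ : q - s = e); last by rewrite /q; ring.
  have t1 : (v - 1) ^+ 2 / v <= v0^-1 * (v - 1) ^+ 2.
    by rewrite mulrC ler_wpM2r ?sqr_ge0// lef_pV2 ?posrE.
  have t2 : N * (e / s) <= M * h * (Ce / a).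
    have NM : N <= M by rewrite -M1 lerDl.
    have es : e / s <= h * (Ce / a).
      rewrite [leRHS](_ : _ = Ce * h * a^-1); last by ring.
      by rewrite ler_pM ?invr_ge0 ?(ltW s_gt0)// lef_pV2 ?posrE.
    rewrite -(mulrA M); apply: ler_pM => //; exact: divr_ge0 e_ge0 (ltW s_gt0).
  have t3 : q + q^-1 <= M * h * (Q + a^-1).
    apply: (@le_trans _ _ (1 * (Q + a^-1))).
      by rewrite mul1r lerD// lef_pV2 ?posrE.
    by rewrite ler_pM2r// addr_gt0 ?invr_gt0.
  set K := V + Cv + Ki + Ku1 + Ku2.
  have K1 : Ku1 <= K by rewrite /K; clear -V0 Cv0 Ki0 Ku10 Ku20; lra.
  have K2 : Ku2 <= K by rewrite /K; clear -V0 Cv0 Ki0 Ku10 Ku20; lra.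
  have p1 := ler_wpM2l (sqr_ge0 M) t1.
  have p2 : 2 * M * (N * (e / s) + q + q^-1) <= M ^+ 2 * h * (2 * (Ce / a + Q + a^-1)).
    have -> : M ^+ 2 * h * (2 * (Ce / a + Q + a^-1)) =
      2 * M * (M * h * (Ce / a) + M * h * (Q + a^-1)) by ring.
    by rewrite ler_pM2l ?mulr_gt0// -addrA lerD.
  have p3 : M ^+ 2 * (v - 1) ^+ 2 * v0^-1 <= M ^+ 2 * (v - 1) ^+ 2 * K.
    by rewrite ler_wpM2l// mulr_ge0 ?sqr_ge0.
  have p4 : M ^+ 2 * h * (2 * (Ce / a + Q + a^-1)) <= M ^+ 2 * h * K.
    by rewrite ler_wpM2l// mulr_ge0 ?sqr_ge0 ?(ltW h0).
  apply: le_trans (lerD p1 p2) _.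
  have -> : K * M ^+ 2 * ((v - 1) ^+ 2 + h) = M ^+ 2 * (v - 1) ^+ 2 * K + M ^+ 2 * h * K by ring.
  rewrite lerD// (le_trans _ p3)// le_eqVlt; apply/orP; left; apply/eqP; ring.
Qed.

Lemma ratio_lipschitz : exists2 L : R, 0 < L & forall th0 th th' (e : R),
  box th0 -> box th -> box th' ->
  `|th.1 - th'.1| <= e -> `|th.2 - th'.2| <= e ->
  `|ratio th0 th - ratio th0 th'| <= L * e.
Proof.
have s2_gt0 : 0 < s2 by exact: lt_le_trans s12.
have k2_gt0 : 0 < k2 by exact: lt_le_trans k12.
exists (s2 * k2 ^+ 2 * (k2 ^+ 2 + s2 * (k2 + k2)) / (s1 * k1 ^+ 2) ^+ 2); first by pos.
move=> [a0 b0] [a b] [a' b'] e [/= a01 a02 b01 b02] [/= a1 a2 b1 b2] [/= a1' a2' b1' b2'] da db.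
have p0 : 0 < a0 by exact: lt_le_trans a01.
have p1 : 0 < a by exact: lt_le_trans a1.
have p2 : 0 < a' by exact: lt_le_trans a1'.
have q0 : 0 < b0 by exact: lt_le_trans b01.
have q1 : 0 < b by exact: lt_le_trans b1.
have q2 : 0 < b' by exact: lt_le_trans b1'.
have -> : a0 / a * (b0 / b) ^+ 2 - a0 / a' * (b0 / b') ^+ 2 =
  - (a0 * b0 ^+ 2 * ((a - a') * b' ^+ 2 + a * ((b - b') * (b + b')))) * ((a * b ^+ 2) * (a' * b' ^+ 2))^-1.
  by field; rewrite !gt_eqF.
have sqle (x y : R) : 0 < x -> x <= y -> x ^+ 2 <= y ^+ 2.
  by move=> x0 xy; rewrite ler_pXn2r// nnegrE ltW// (lt_le_trans x0).
have num : `|a0 * b0 ^+ 2 * ((a - a') * b' ^+ 2 + a * ((b - b') * (b + b')))| <=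
    s2 * k2 ^+ 2 * (k2 ^+ 2 + s2 * (k2 + k2)) * e.
  rewrite normrM -mulrA; apply: ler_pM => //.
    rewrite ger0_norm; last by rewrite mulr_ge0 ?sqr_ge0// ltW.
    by rewrite ler_pM ?sqr_ge0 ?(ltW p0)// sqle.
  apply: le_trans (ler_normD _ _) _; rewrite [leRHS]mulrDl; apply: lerD.
    rewrite normrM mulrC [`|b' ^+ 2|]ger0_norm ?sqr_ge0//.
    by rewrite ler_pM ?sqr_ge0// sqle.
  rewrite normrM (ger0_norm (ltW p1)) normrM [`|b + b'|]ger0_norm; last first.
    by rewrite addr_ge0// ltW.
  rewrite -mulrA; apply: ler_pM; rewrite ?(ltW p1)//.
    by rewrite mulr_ge0// addr_ge0// ltW.
  rewrite mulrC; apply: ler_pM => //; first by rewrite addr_ge0// ltW.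
  exact: lerD.
rewrite normrM normrN [leRHS]mulrAC; apply: ler_pM => //.
have dp : 0 < a * b ^+ 2 * (a' * b' ^+ 2) by pos.
rewrite normfV (ger0_norm (ltW dp)) lef_pV2 ?posrE//; last by pos.
have lb (x y : R) : s1 <= x -> k1 <= y -> s1 * k1 ^+ 2 <= x * y ^+ 2.
  by move=> sx ky; rewrite ler_pM ?sqr_ge0 ?(ltW s1_gt0)// sqle.
have sk0 : 0 <= s1 * k1 ^+ 2 by rewrite mulr_ge0 ?sqr_ge0// ltW.
by rewrite [leLHS]expr2; apply: ler_pM => //; exact: lb.
Qed.

(** Three regimes. If [ratio] at [tha] differs from 1, it still does nearby, and the entropy there
    is at least of order [m^2], the largest possible. If it equals 1 and [kappa] is wrong, the
    entropy at [tha] is [O (m^2 h)], and nearby [kappa] is still wrong, which costs as much.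
    Otherwise [tha] is the truth and its entropy is 0. In the last two regimes the entropy nearby
    may be of larger order, so only one inequality is claimed. *)
Lemma entropy_compare th0 tha : box th0 -> box tha ->
  exists e K : R, [/\ 0 < e, 0 < K & \forall m \near \oo, forall th, box th ->
    `|th.1 - tha.1| <= e -> `|th.2 - tha.2| <= e ->
    entropy (rel_prec delta m th0 tha) <= K * entropy (rel_prec delta m th0 th)].
Proof.
move=> b0 ba; have [K K0 two] := entropy_two_sided.
have [L L0 lip] := ratio_lipschitz.
have [g1|g1] := eqVneq (ratio th0 tha) 1; last first.
  (* One [eta] is lost by moving from [tha] to [th] and one by replacing [ratio] with [v], so that
     [|v - 1|] keeps [2 eta] of the original [4 eta]. *)
  pose eta := `|ratio th0 tha - 1| / 4.
  have eta0 : 0 < eta by rewrite divr_gt0// normr_gt0 subr_eq0.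
  exists (eta / L), (K * ((K + 1) ^+ 2 + 1) / (2 * eta ^+ 2 / (1 + K))).
  split; [by pos|by pos|].
  near=> m => th b d1 d2.
  have m1 : (1 < m)%N by near: m; exact: nbhs_infty_gt.
  have m0 : (0 < m)%N by exact: ltnW.
  have /andP[h0 h1] := mesh_in01 delta01 m0.
  have hK : mesh delta m <= eta / K by near: m; apply: mesh_cvg0 => //; pos.
  have [/andP[vp vK] vd E1 _ _] := two _ _ _ m1 b0 b.
  have [/andP[vap vaK] _ _ _ Ea] := two _ _ _ m1 b0 ba.
  set va := v_of m th0 tha in vap vaK Ea; set v := v_of m th0 th in vp vK vd E1.
  have dr := lip _ _ _ _ b0 b ba d1 d2.
  have Le : L * (eta / L) = eta by field; rewrite gt_eqF.
  rewrite Le in dr.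
  have Kh : K * mesh delta m <= eta by rewrite mulrC -ler_pdivlMr.
  have v1 : 2 * eta <= `|v - 1|.
    have tri : `|ratio th0 tha - 1| <= `|v - ratio th0 th| + `|ratio th0 th - ratio th0 tha| + `|v - 1|.
      have -> : ratio th0 tha - 1 = - (v - ratio th0 th) - (ratio th0 th - ratio th0 tha) + (v - 1) by ring.
      apply: le_trans (ler_normD _ _) _; rewrite lerD2r.
      by apply: le_trans (ler_normB _ _) _; rewrite normrN.
    apply: half_gap tri _ (le_trans vd Kh) dr.
    by rewrite /eta; field.
  have v2 : (2 * eta) ^+ 2 <= (v - 1) ^+ 2.
    rewrite -[leRHS]real_normK ?num_real// ler_pXn2r ?nnegrE ?normr_ge0//.
    by rewrite mulr_ge0// ltW.
  have phi := le_trans v2 (sub1_ln_ge vp vK).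
  have phi2 : 2 * eta ^+ 2 / (1 + K) <= v - 1 - ln v.
    rewrite ler_pdivrMr; last by pos.
    have -> : 2 * eta ^+ 2 = (2 * eta) ^+ 2 / 2 by field.
    by rewrite ler_pdivrMr//; apply: le_trans phi _; apply: eq_lew; ring.
  set M : R := m%:R in E1 Ea; have M0 : 0 < M by rewrite ltr0n.
  set c := 2 * eta ^+ 2 / (1 + K) in phi2 *; have c0 : 0 < c by rewrite /c; pos.
  have va2 : (va - 1) ^+ 2 + mesh delta m <= (K + 1) ^+ 2 + 1.
    apply: lerD => //; rewrite -real_normK ?num_real// ler_pXn2r ?nnegrE ?normr_ge0//; last by rewrite ltW//; pos.
    exact: norm_sub1_le (ltW vap) vaK.
  apply: le_trans Ea _; rewrite [leRHS]mulrAC ler_pdivlMr//.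
  have h : M ^+ 2 * c <= entropy (rel_prec delta m th0 th).
    by apply: le_trans E1; rewrite ler_pM2l ?exprn_gt0.
  apply: (@le_trans _ _ (K * ((K + 1) ^+ 2 + 1) * (M ^+ 2 * c))).
    rewrite [leRHS](_ : _ = (K * M ^+ 2 * ((K + 1) ^+ 2 + 1)) * c); last by ring.
    by rewrite ler_pM2r// ler_pM2l//; pos.
  by rewrite ler_pM2l//; pos.
have [k01|k01] := eqVneq tha.2 th0.2.
  have tha0 : tha = th0.
    move: ba b0 g1 k01; case: (tha) (th0) => [a b] [a0' b0'] /= [/= h1 _ h3 _] [/= h1' _ _ _] + bb.
    have a0 : 0 < a by exact: lt_le_trans h1.
    have bp : 0 < b by exact: lt_le_trans h3.
    rewrite bb divff ?expr1n ?mulr1; last by rewrite -bb gt_eqF.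
    by move=> /(divr1_eq) ->.
  exists 1, 1; split => //; near=> m => th b _ _.
  have m1 : (1 < m)%N by near: m; exact: nbhs_infty_gt.
  have [/andP[vp _] _ E1 _ _] := two _ _ _ m1 b0 b.
  have [h1 _ h3 _] := b0.
  rewrite tha0 rel_prec0 ?(ltnW m1)//; [|exact: lt_le_trans h1|exact: lt_le_trans h3].
  rewrite /entropy mxtrace1 det1 ln1 subrr subr0 mul1r (le_trans _ E1)//.
  by rewrite mulr_ge0 ?sqr_ge0// subr_ge0 ln_le_sub1.
pose D := `|tha.2 - th0.2|.
have D0 : 0 < D by rewrite normr_gt0 subr_eq0.
exists (D / 2), (K * (K ^+ 2 + 1) / (K^-1 * (D / 2) ^+ 2)); split; [by pos|by pos|].
near=> m => th b _ d2.
have m1 : (1 < m)%N by near: m; exact: nbhs_infty_gt.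
have m0 : (0 < m)%N by exact: ltnW.
have /andP[h0 h1] := mesh_in01 delta01 m0.
have [_ _ _ E1 _] := two _ _ _ m1 b0 b.
have [_ vd _ _ Ea] := two _ _ _ m1 b0 ba.
set va := v_of m th0 tha in vd Ea; rewrite g1 in vd.
set h := mesh delta m in h0 h1 vd E1 Ea.
set M : R := m%:R in E1 Ea; have M0 : 0 < M by rewrite ltr0n.
have dk : (D / 2) ^+ 2 <= (th.2 - th0.2) ^+ 2.
  rewrite -[leRHS]real_normK ?num_real// ler_pXn2r ?nnegrE ?normr_ge0//; last by rewrite ltW//; pos.
  apply: half_le_gap d2.
  rewrite /D (_ : tha.2 - th0.2 = (th.2 - th0.2) - (th.2 - tha.2)); last by ring.
  exact: ler_normB.
(* As [ratio] is 1 at [tha], [(va - 1)^2] is only [O (h^2)] and the mesh term dominates. *)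
have va2 : (va - 1) ^+ 2 + h <= (K ^+ 2 + 1) * h.
  rewrite mulrDl mul1r lerD2r -real_normK ?num_real//.
  apply: (@le_trans _ _ ((K * h) ^+ 2)).
    by rewrite ler_pXn2r ?nnegrE ?normr_ge0// ltW//; pos.
  by rewrite exprMn ler_pM2l ?exprn_gt0// expr2 ler_piMr// ltW.
apply: le_trans Ea _; rewrite [leRHS]mulrAC ler_pdivlMr; last by pos.
apply: (@le_trans _ _ (K * (K ^+ 2 + 1) * (K^-1 * (M ^+ 2 * h * (D / 2) ^+ 2)))).
  rewrite [leRHS](_ : _ = (K * M ^+ 2 * ((K ^+ 2 + 1) * h)) * (K^-1 * (D / 2) ^+ 2)); last by ring.
  by rewrite ler_pM2r; [rewrite ler_pM2l//; pos|pos].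
rewrite ler_pM2l; last by pos.
apply: le_trans E1; rewrite ler_pM2l ?invr_gt0// ler_pM2l//; pos.
Unshelve. all: by end_near. Qed.
End entropy_compare.

(** * Regression on the grid *)

Section regression_bounds.
Variables (R : realType) (n q : nat) (H : 'M[R]_n) (A : 'M[R]_(n, q)) (C : R).
Hypothesis Hs : H^T = H.
Hypothesis GA : A^T *m H *m A \in unitmx.
Hypothesis C0 : 0 < C.
Hypothesis Hpos : forall x, x != 0 -> 0 < quad H x.
Hypothesis Hle : forall x, quad H x <= C * dot x x.

Lemma quad_ge0 x : 0 <= quad H x.
Proof.
by have [->|/Hpos/ltW//] := eqVneq x 0; rewrite /quad /dot mulmx0 mulmx0 mxE.
Qed.

(** The projection gives the nearest point of the column space in the norm of [H]. The fit under
    another parameter is a competitor, and so biases at two parameters can be compared. *)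
Lemma gls_min (nu : 'cV[R]_n) (b : 'cV[R]_q) :
  quad H (nu - gls_proj H A *m nu) <= quad H (nu - A *m b).
Proof.
set a := nu - _.
pose b' := invmx (A^T *m H *m A) *m A^T *m H *m nu - b.
have -> : nu - A *m b = A *m b' + a.
  by rewrite /b' mulmxBr -gls_projE /a [RHS]addrC addrA subrK.
by rewrite (quadD _ a Hs) (gls_orth GA) mulr0 addr0 lerDr quad_ge0.
Qed.

Lemma gls_proj_fix (b : 'cV[R]_q) : A *m b - gls_proj H A *m (A *m b) = 0.
Proof. by rewrite mulmxA gls_projA// subrr. Qed.

Variables (nu eps : 'cV[R]_n) (W : R).
Let a := nu - gls_proj H A *m nu.
Let e := gls_proj H A *m eps.

(** [quad H e] equals [dot (H *m e) eps], so its square is at most [W |H e|^2 <= W * C * quad H e],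
    and one factor cancels. *)
Lemma quad_fit_le : 0 <= W ->
  dot (H *m e) eps ^+ 2 <= W * dot (H *m e) (H *m e) -> quad H e <= C * W.
Proof.
move=> W0; rewrite -(quad_gls_fit Hs GA eps) -/e => h.
have := le_trans h (ler_wpM2l W0 (dot_mul_le e Hs quad_ge0 (ltW C0) Hle)).
have := quad_ge0 e; rewrite le_eqVlt => /orP[/eqP <- _|q0]; first by rewrite mulr_ge0// ltW.
by rewrite expr2 mulrA ler_pM2r// mulrC.
Qed.

Lemma cross_term_le : 0 <= W ->
  dot (H *m a) eps ^+ 2 <= W * dot (H *m a) (H *m a) ->
  dot (H *m a) eps ^+ 2 <= W * (C * quad H a).
Proof.
by move=> W0 /le_trans; apply; rewrite ler_wpM2l// (dot_mul_le _ Hs quad_ge0 (ltW C0) Hle).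
Qed.

Lemma quad_fit_eq0 : H = 1%:M -> quad H e = 0 -> A^T *m eps = 0.
Proof.
move=> H1; have e0 : quad H e = 0 -> e = 0.
  by apply: contra_eq => /Hpos; rewrite lt_neqAle eq_sym => /andP[].
move=> /e0 ez; have : A^T *m (H *m e) = A^T *m (H *m eps).
  rewrite /e /gls_proj !mulmxA mulmxV// mul1mx//.
by rewrite ez !mulmx0 H1 mul1mx => <-.
Qed.
End regression_bounds.

(* The three error terms of [loglik_kl_loss] are controlled through
   [z^2 <= x y -> 2 |z| <= eta x + y / eta]. *)
Lemma criterion_gap (R : realType) (C W Phi qa qe ch2 ch1 eta : R) :
  0 < C -> 0 <= W -> 0 <= Phi -> 0 <= qa -> 0 <= qe -> 0 < eta ->
  ch2 ^+ 2 <= W * (5 * (1 + C) * Phi) -> ch1 ^+ 2 <= W * (C * qa) -> qe <= C * W ->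
  `|ch2 + 2 * ch1 - 2 * qe| <= eta * (Phi / 2 + (qa + qe) / 2) + (10 * (1 + C) / eta + 2 * C) * W.
Proof.
move=> C0 W0 P0 qa0 qe0 eta0 h2 h1 h3.
have sq_le (z x y : R) : 0 <= x -> 0 <= y -> z ^+ 2 <= x * y -> 2 * `|z| <= x + y.
  by move=> x0 y0 hz; apply: mul2_le_add => //; rewrite real_normK ?num_real.
have i0 : 0 <= W / eta by rewrite divr_ge0// ltW.
have WE : W = eta * (W / eta) by rewrite mulrC divfK// gt_eqF.
have x2 : 0 <= eta * Phi by rewrite mulr_ge0// ltW.
have y2 : 0 <= 5 * (1 + C) * (W / eta) by rewrite mulr_ge0// mulr_ge0// addr_ge0// ltW.
have x1 : 0 <= eta * qa / 2 by rewrite mulr_ge0// mulr_ge0// ltW.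
have y1 : 0 <= 2 * C * (W / eta) by rewrite mulr_ge0// mulr_ge0// ltW.
have b2 : 2 * `|ch2| <= eta * Phi + 5 * (1 + C) * (W / eta).
  apply: (sq_le _ _ _ x2 y2); apply: le_trans h2 _.
  by rewrite [in leLHS]WE le_eqVlt; apply/orP; left; apply/eqP; ring.
have b1 : 2 * `|ch1| <= eta * qa / 2 + 2 * C * (W / eta).
  apply: (sq_le _ _ _ x1 y1); apply: le_trans h1 _.
  by rewrite [in leLHS]WE le_eqVlt; apply/orP; left; apply/eqP; field; rewrite gt_eqF.
have tri : `|ch2 + 2 * ch1 - 2 * qe| <= `|ch2| + 2 * `|ch1| + 2 * qe.
  apply: le_trans (ler_normB _ _) _; rewrite [`|2 * qe|]ger0_norm ?mulr_ge0// lerD2r.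
  by apply: le_trans (ler_normD _ _) _; rewrite normrM [`|2|]ger0_norm.
apply: le_trans tri _.
have -> : (10 * (1 + C) / eta + 2 * C) * W = 10 * ((1 + C) * (W / eta)) + 2 * (C * W) by ring.
have p : 0 <= eta * qe by rewrite mulr_ge0// ltW.
have p2 : 0 <= C * (W / eta) by rewrite mulr_ge0// ltW.
rewrite !mulrDl !mul1r in b2 *; rewrite !mulrDr !mulrDl in b2 b1 *.
have -> : eta * (Phi / 2) = eta * Phi / 2 by ring.
clear -b1 b2 h3 p p2 i0; lra.
Qed.

Lemma unitmx_inj (R : realType) n (M : 'M[R]_n) :
  (forall y : 'cV_n, M *m y = 0 -> y = 0) -> M \in unitmx.
Proof.
move=> h; rewrite -unitmx_tr -row_free_unit -kermx_eq0; apply/eqP/row_matrixP => i.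
rewrite row0; apply: trmx_inj; rewrite trmx0; apply: h.
by rewrite -{1}[M]trmxK -trmx_mul -row_mul mulmx_ker row0 trmx0.
Qed.

Section designs.
Variables (R : realType) (p : nat) (a : {set 'I_p}).

(** Keeps the intercept and the columns in [a]: each design is the full design times an injective
    matrix and inherits its full rank. *)
Definition selector : 'M[R]_(1 + p, 1 + #|a|) :=
  block_mx 1%:M 0 0 (colsub (fun j : 'I_#|a| => enum_val j) 1%:M).

Lemma selector_inj (y : 'cV_(1 + #|a|)) : selector *m y = 0 -> y = 0.
Proof.
rewrite -[y]vsubmxK /selector mul_block_col mul1mx !mul0mx addr0 add0r => /eqP.
rewrite col_mx_eq0 => /andP[/eqP -> /eqP h]; suff -> : dsubmx y = 0 by rewrite col_mx0.
apply/colP => j; have := congr1 (fun M : 'cV__ => M (enum_val j) 0) h; rewrite !mxE => <-.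
rewrite (bigD1 j)//= !mxE eqxx mul1r big1 ?addr0// => j' jj'.
rewrite !mxE (inj_eq enum_val_inj) eq_sym (negbTE jj') mul0r//.
Qed.

Lemma design_selector delta x m :
  design delta x m a = full_design delta x m *m selector.
Proof.
rewrite /design /full_design /selector mul_row_block mulmx1 !mulmx0 addr0 add0r.
congr row_mx; apply/matrixP => k j; rewrite !mxE (bigD1 (enum_val j))//= !mxE eqxx mulr1.
rewrite big1 ?addr0// => j' jj'; rewrite !mxE (negbTE jj') mulr0//.
Qed.

Lemma design_unit n (S : 'M[R]_n) (F : 'M[R]_(n, 1 + p)) :
  (forall x, x != 0 -> 0 < quad (invmx S) x) -> F^T *m invmx S *m F \in unitmx ->
  (F *m selector)^T *m invmx S *m (F *m selector) \in unitmx.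
Proof.
move=> pos U; apply: unitmx_inj => y hy; apply: selector_inj.
have z : quad (invmx S) (F *m selector *m y) = 0.
  by rewrite /quad /dot trmx_mul -!mulmxA; move: hy; rewrite -!mulmxA => ->; rewrite mulmx0 mxE.
have {}z : F *m selector *m y = 0.
  by apply: contra_eq z => /pos; rewrite lt_neqAle eq_sym => /andP[].
by rewrite -[_ *m y](mulKmx U) -!mulmxA (mulmxA F) z !mulmx0.
Qed.
End designs.

(** * Moments of the whitened Gaussian noise *)

Section gaussian_vector.
Context {d : measure_display} {T : measurableType d} {R : realType}.
Variable P : probability T R.
Local Notation hasE := (hasE P).

Lemma hasE_expectation (X : T -> R) r : hasE X r -> 'E_P[X]%E = r%:E.
Proof. by move=> [_ h]; rewrite unlock. Qed.

Lemma hasE_measurable (X : T -> R) r : hasE X r -> measurable_fun [set: T] X.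
Proof. by move=> [/measurable_int h _]; exact/measurable_EFinP. Qed.

Lemma hasE_of_square (X : T -> R) v : measurable_fun [set: T] X ->
  hasE (fun w => X w ^+ 2) v -> 'E_P[X]%E = 0%E -> hasE X 0.
Proof.
move=> mX [i2 _] EX; split; last by move: EX; rewrite unlock.
have i1 : P.-integrable [set: T] (EFin \o (fun w => 1 + X w ^+ 2)).
  have := integrableD measurableT (finite_measure_integrable_cst P 1 measurableT) i2.
  by apply: eq_integrable => // w _ /=; rewrite EFinD.
apply: le_integrable i1 => //; first exact/measurable_EFinP.
move=> w _ /=; rewrite lee_fin [leRHS]ger0_norm ?addr_ge0 ?sqr_ge0//.
rewrite ler_norml; have := sqr_ge0 (X w - 1); have := sqr_ge0 (X w + 1).
by rewrite !expr2 => h1 h2; apply/andP; split; lra.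
Qed.

Variables (n : nat) (Y : 'I_n -> {RV P >-> R}).
Hypothesis YG : forall c : 'I_n -> R, gaussian_rv P (fun w => \sum_i c i * Y i w).
Hypothesis YC : forall i, 'E_P[Y i]%E = 0%E.

Lemma gaussian_coordinate i : gaussian_rv P (Y i).
Proof.
have := YG (fun j => (j == i)%:R); congr (gaussian_rv P _); apply/funext => w.
rewrite (bigD1 i)//= eqxx mul1r big1 ?addr0// => j /negbTE ->.
by rewrite mul0r.
Qed.

Lemma gaussian_mean i : hasE (Y i) 0.
Proof.
have [v [_ h2 _ _]] := gaussian_moments (measurable_funPT (Y i)) (gaussian_coordinate i) (YC i).
exact: hasE_of_square h2 (YC i).
Qed.

Lemma gaussian_combination (c : 'I_n -> R) :
  exists v : R, [/\ hasE (fun w => (\sum_i c i * Y i w) ^+ 2) v,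
    hasE (fun w => (\sum_i c i * Y i w) ^+ 4) (3 * v ^+ 2) &
    (v != 0 -> P ((fun w => \sum_i c i * Y i w) @^-1` [set 0]) = 0%E)].
Proof.
have h0 : hasE (fun w => \sum_i c i * Y i w) 0.
  have := hasE_sum (index_enum 'I_n) (Q := xpredT) (fun i _ => hasE_Z (c i) (gaussian_mean i)).
  by under [X in hasE _ X]eq_bigr => i _ do rewrite mulr0; rewrite big1.
have [v [_ h2 h4 h]] := gaussian_moments (hasE_measurable h0) (YG c) (hasE_expectation h0).
by exists v.
Qed.

(** Moments are available for linear combinations, so the product is recovered by polarization from
    the squares of [Y i + Y j] and [Y i - Y j]. *)
Lemma gaussian_product (mu : 'I_n -> R) i j :
  hasE (fun w => Y i w * Y j w)
   (fine (covariance P (fun w => mu i + Y i w) (fun w => mu j + Y j w))).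
Proof.
have mE k : 'E_P[(fun w => (mu k + Y k w)%R)]%E = (mu k)%:E.
  by apply: hasE_expectation; have := hasE_D (hasE_cst P (mu k)) (gaussian_mean k); rewrite addr0.
have [s hs] : exists s, hasE (fun w => Y i w * Y j w) s.
  have sq e : exists v, hasE (fun w => (Y i w + e * Y j w) ^+ 2) v.
    have [v [h _ _]] := gaussian_combination (fun k => (k == i)%:R + e * (k == j)%:R).
    exists v; apply: hasE_ext h => w; congr (_ ^+ 2).
    under eq_bigr => k _ do rewrite mulrDl -mulrA.
    by rewrite big_split/= -mulr_sumr !sum_delta.
  have [v1 h1] := sq 1; have [v2 h2] := sq (-1).
  exists (4^-1 * (v1 + -1 * v2)).
  apply: hasE_ext (hasE_Z 4^-1 (hasE_D h1 (hasE_Z (-1) h2))) => w /=.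
  by field.
rewrite unlock !mE /= (_ : _ * _ = (fun w => Y i w * Y j w)); last first.
  by apply/funext => w /=; rewrite !fctE/= !(addrC (mu _)) !addrK.
by rewrite (hasE_expectation hs).
Qed.
End gaussian_vector.

Section whitened_noise.
Context {d : measure_display} {T : measurableType d} {R : realType}.
Variable P : probability T R.
Local Notation hasE := (hasE P).
Variables (n : nat) (Y : 'I_n -> {RV P >-> R}) (mu : 'I_n -> R) (W0 : 'M[R]_n).
Hypothesis YG : forall c : 'I_n -> R, gaussian_rv P (fun w => \sum_i c i * Y i w).
Hypothesis YC : forall i, 'E_P[Y i]%E = 0%E.
Hypothesis S0W : W0 *m (\matrix_(i, j) fine (covariance P
  (fun w => mu i + Y i w) (fun w => mu j + Y j w))) *m W0^T = 1%:M.

Definition white (i : 'I_n) (w : T) : R := \sum_k W0 i k * Y k w.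

Lemma white2 i j : hasE (fun w => white i w * white j w) (i == j)%:R.
Proof.
pose S := \matrix_(i, j) fine (covariance P (fun w => mu i + Y i w) (fun w => mu j + Y j w)).
have hS : W0 *m S *m W0^T = 1%:M by exact: S0W.
have -> : (i == j)%:R = \sum_k \sum_l W0 i k * W0 j l * S k l.
  have := congr1 (fun M : 'M[R]_n => M i j) hS; rewrite [in RHS]mxE => <-.
  rewrite mxE exchange_big/=; apply: eq_bigr => l _.
  by rewrite [in LHS]mxE big_distrl/=; apply: eq_bigr => k _; rewrite [W0^T _ _]mxE; ring.
apply: hasE_ext; last first.
  apply: hasE_sum => k _; apply: hasE_sum => l _; apply: hasE_Z.
  by rewrite /S mxE; exact: gaussian_product.
move=> w; rewrite /white big_distrlr/=; apply: eq_bigr => k _; apply: eq_bigr => l _.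
by rewrite mulrACA.
Qed.

Lemma white_combination (c : 'I_n -> R) w :
  \sum_i c i * white i w = \sum_k (\sum_i c i * W0 i k) * Y k w.
Proof.
under [RHS]eq_bigr => k _ do rewrite big_distrl/=.
rewrite exchange_big/=; apply: eq_bigr => i _; rewrite mulr_sumr.
by apply: eq_bigr => k _; rewrite mulrA.
Qed.

Lemma whiteG (c : 'I_n -> R) : exists v,
  hasE (fun w => (\sum_i c i * white i w) ^+ 2) v /\
  hasE (fun w => (\sum_i c i * white i w) ^+ 4) (3 * v ^+ 2).
Proof.
have [v [h2 h4 _]] := gaussian_combination YG YC (fun k => \sum_i c i * W0 i k).
exists v; split.
  by apply: hasE_ext h2 => w; rewrite white_combination.
by apply: hasE_ext h4 => w; rewrite white_combination.
Qed.

(** The noise is white, so the sum of squares is the variance of the combination, and a Gaussian law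
    of positive variance has no atom at 0. *)
Lemma white_atomless (c : 'I_n -> R) : \sum_i c i ^+ 2 != 0 ->
  P [set w | \sum_i c i * white i w = 0] = 0%E.
Proof.
move=> c0; have [v [h2 _ h]] := gaussian_combination YG YC (fun k => \sum_i c i * W0 i k).
have v0 : v = \sum_i c i ^+ 2.
  apply: hasE_uniq h2 _.
  have := chaos1_sq white2 (\col_i c i); under [X in hasE _ X]eq_bigr => i _ do rewrite mxE.
  apply: hasE_ext => w; rewrite -white_combination /chaos1; congr (_ ^+ 2).
  by apply: eq_bigr => i _; rewrite mxE.
rewrite -(h _) ?v0//; congr (P _); apply/seteqP; split => w /=;
  by rewrite white_combination.
Qed.

Definition white_vec (w : T) : 'cV[R]_n := \col_i white i w.

Lemma white_vecE w : white_vec w = W0 *m \col_k (Y k w).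
Proof. by apply/colP => i; rewrite !mxE; apply: eq_bigr => k _; rewrite mxE. Qed.

Lemma dot_white (g : 'cV[R]_n) w : dot g (white_vec w) = chaos1 white g w.
Proof. by rewrite /dot mxE; apply: eq_bigr => i _; rewrite !mxE. Qed.

Lemma quad_white (C : 'M[R]_n) w : quad C (white_vec w) - \tr C = chaos2 white C w.
Proof.
rewrite /quad /dot mxE /chaos2 /mxtrace -sumrB; apply: eq_bigr => i _.
rewrite !mxE mulr_sumr -[C i i](sum_delta i (fun j => C i j)) -sumrB.
apply: eq_bigr => j _; rewrite mxE (eq_sym i j); ring.
Qed.

Lemma mxdot_trmx_le (C : 'M[R]_n) : mxdot C C^T <= mxdot C C.
Proof.
have := mxdot_ge0 (C - C^T); rewrite mxdotDl !mxdotDr -scaleN1r !mxdotZl !mxdotZr.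
rewrite mxdot_trmx (mxdotC C^T C); lra.
Qed.

(** [mxspan_sup] for both chaoses. The linear chaos is isometric; the quadratic one has second
    moment [|C|^2 + mxdot C C^T <= 2 |C|^2], whence the factor 2. *)
Lemma white_sup (s1 : seq 'M[R]_n) (s2 : seq 'cV[R]_n) :
  exists W : T -> R, [/\ forall w, 0 <= W w,
    exists2 r, hasE W r & r <= 2 * (size s1)%:R + (size s2)%:R,
    forall w C, mxspan s1 C -> (quad C (white_vec w) - \tr C) ^+ 2 <= W w * mxdot C C &
    forall w g, mxspan s2 g -> dot g (white_vec w) ^+ 2 <= W w * dot g g].
Proof.
have D2 (A B : 'M[R]_n) w : chaos2 white (A + B) w = chaos2 white A w + chaos2 white B w.
  rewrite /chaos2 -big_split/=; apply: eq_bigr => i _; rewrite -big_split/=.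
  by apply: eq_bigr => j _; rewrite mxE mulrDl.
have Z2 k (A : 'M[R]_n) w : chaos2 white (k *: A) w = k * chaos2 white A w.
  rewrite /chaos2 mulr_sumr; apply: eq_bigr => i _; rewrite mulr_sumr.
  by apply: eq_bigr => j _; rewrite mxE mulrA.
have E2 (A : 'M[R]_n) : exists2 r, hasE (fun w => chaos2 white A w ^+ 2) r & r <= 2 * mxdot A A.
  exists (\sum_i \sum_j A i j ^+ 2 + \sum_i \sum_j A i j * A j i).
    by apply: chaos2_sq => [i j|c]; [exact: white2|exact: whiteG].
  have -> : \sum_i \sum_j A i j ^+ 2 = mxdot A A by [].
  have -> : \sum_i \sum_j A i j * A j i = mxdot A A^T.
    by apply: eq_bigr => i _; apply: eq_bigr => j _; rewrite mxE.
  have := mxdot_trmx_le A; lra.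
have D1 (A B : 'cV[R]_n) w : chaos1 white (A + B) w = chaos1 white A w + chaos1 white B w.
  by rewrite /chaos1 -big_split/=; apply: eq_bigr => i _; rewrite mxE mulrDl.
have Z1 k (A : 'cV[R]_n) w : chaos1 white (k *: A) w = k * chaos1 white A w.
  by rewrite /chaos1 mulr_sumr; apply: eq_bigr => i _; rewrite mxE mulrA.
have E1 (A : 'cV[R]_n) : exists2 r, hasE (fun w => chaos1 white A w ^+ 2) r & r <= 1 * mxdot A A.
  exists (\sum_i A i 0 ^+ 2); first by apply: chaos1_sq => i j; exact: white2.
  by rewrite mul1r; apply: ler_sum => i _; rewrite big_ord1.
have [_ [W2 [W20 [r2 hr2 r2K] hW2]]] := mxspan_sup (ler0n _ 2) D2 Z2 E2 s1.
have [_ [W1 [W10 [r1 hr1 r1K] hW1]]] := mxspan_sup ler01 D1 Z1 E1 s2.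
exists (fun w => W2 w + W1 w); split.
- by move=> w; rewrite addr_ge0.
- exists (r2 + r1); first exact: hasE_D.
  by rewrite lerD// (le_trans r1K)// mul1r.
- move=> w C sC; rewrite quad_white; apply: le_trans (hW2 w C sC) _.
  by rewrite ler_wpM2r ?mxdot_ge0// lerDl.
- move=> w g sg; rewrite dot_white dotE; apply: le_trans (hW1 w g sg) _.
  by rewrite ler_wpM2r ?mxdot_ge0// lerDr.
Qed.
End whitened_noise.

(** * Bounds for one model at one parameter, for a given outcome *)

Section model_bounds.
Variables (R : realType) (delta : R) (m p : nat) (s1 s2 k1 k2 : R) (th0 : R * R).
Hypotheses (m0 : (0 < m)%N) (s1_gt0 : 0 < s1) (k1_gt0 : 0 < k1) (s12 : s1 <= s2) (k12 : k1 <= k2).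
Hypothesis box0 : in_box s1 s2 k1 k2 th0.
Variables (F : 'M[R]_(m ^ 2, 1 + p)) (mu : 'cV[R]_(m ^ 2)).
Local Notation W0 := (whitener delta m th0).
Local Notation H th := (rel_prec delta m th0 th).
Local Notation C := (prec_bound s1 s2 k1 k2).
Local Notation box := (in_box s1 s2 k1 k2).
Implicit Types (th : R * R) (a : {set 'I_p}).

Lemma in_box_gt0 th : box th -> 0 < th.1 /\ 0 < th.2.
Proof.
by case=> h1 _ h3 _; split; [exact: lt_le_trans s1_gt0 h1|exact: lt_le_trans k1_gt0 h3].
Qed.

Lemma prec_bound_gt0 : 0 < C.
Proof.
have s20 := lt_le_trans s1_gt0 s12; have k20 := lt_le_trans k1_gt0 k12.
by apply: mulr_gt0; [exact: divr_gt0|rewrite exprn_gt0// mulr_gt0// exprn_gt0// divr_gt0].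
Qed.

Definition chaos_matrices : seq 'M[R]_(m ^ 2) := 1%:M :: rel_prec_basis delta m th0.

Definition regressors : seq 'cV[R]_(m ^ 2) :=
  W0 *m mu :: [seq col j (W0 *m F) | j <- enum 'I_(1 + p)].

(** Their span contains [H th *m v] for every parameter and every [v] in the span of the whitened
    mean and regressors. Biases and fits are such [v]; a fit is moreover random, which is harmless
    because the chaos bound holds for the whole span at once. *)
Definition chaos_vectors : seq 'cV[R]_(m ^ 2) :=
  [seq B *m v | B <- rel_prec_basis delta m th0, v <- regressors].

(** There are [64 + 1] matrices, and 64 vectors for each of the mean, the intercept and the [p]
    covariates. The bound does not depend on [m]. *)
Lemma size_chaos : (2 * (size chaos_matrices)%:R + (size chaos_vectors)%:R =
  (130 + 64 * (2 + p))%:R :> R).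
Proof.
have b := size_rel_prec_basis delta m th0.
have -> : size chaos_matrices = 65%N by rewrite -[LHS]/(size (rel_prec_basis delta m th0)).+1 b.
have -> : size chaos_vectors = (64 * (2 + p))%N.
  by rewrite size_allpairs b -[size regressors]/(size _).+1 size_map size_enum_ord.
by rewrite -natrM -natrD; congr (_ %:R); lia.
Qed.

Lemma mxspan_regressors (k : R) (b : 'cV[R]_(1 + p)) :
  mxspan regressors (k *: (W0 *m mu) + W0 *m F *m b).
Proof.
apply: mxspanD.
  by apply: mxspanZ; apply: mxspan_mem; exact: mem_head.
have -> : W0 *m F *m b = \sum_j b j 0 *: col j (W0 *m F).
  apply/colP => i; rewrite summxE mxE; apply: eq_bigr => j _.
  by rewrite [RHS]mxE mulrC [X in _ = _ * X]mxE.
apply: mxspan_sum => j _; apply: mxspanZ; apply: mxspan_mem.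
by rewrite inE; apply/orP; right; apply: map_f; rewrite mem_enum.
Qed.

Lemma mxspan_chaos_vectors th v : box th -> mxspan regressors v ->
  mxspan chaos_vectors (H th *m v).
Proof.
move=> /in_box_gt0[s0 k0] sv.
apply: (@mxspan_bilinear _ _ _ _ _ _ _ mulmx) (sv) => //.
- by move=> x x' y; rewrite mulmxDl.
- by move=> k x y; rewrite -scalemxAl.
- by move=> x y y'; rewrite mulmxDr.
- by move=> k x y; rewrite -scalemxAr.
- exact: mxspan_rel_prec.
Qed.

Lemma mxspan_chaos_matrices th : box th -> mxspan chaos_matrices (H th - 1%:M).
Proof.
move=> /in_box_gt0[s0 k0]; exists (-1); rewrite scaleN1r opprK subrK.
exact: mxspan_rel_prec.
Qed.

Lemma entropy_rel_prec_ge th : box th ->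
  mxdot (H th - 1%:M) (H th - 1%:M) <= 5 * (1 + C) * entropy (H th).
Proof.
move=> b; have [s0 k0] := in_box_gt0 b; have [s00 k00] := in_box_gt0 box0.
apply: (entropy_ge (ltW prec_bound_gt0) (rel_prec_sym _ _ _ _) _ _).2.
- by move=> x; exact: rel_prec_gt0.
- by move=> x; exact: rel_prec_le.
Qed.

Lemma entropy_rel_prec_ge0 th : box th -> 0 <= entropy (H th).
Proof.
move=> b; have := le_trans (mxdot_ge0 _) (entropy_rel_prec_ge b).
by rewrite pmulr_rge0// mulr_gt0// addr_gt0// prec_bound_gt0.
Qed.

Variables (eps : 'cV[R]_(m ^ 2)) (W : R).
Hypothesis W_ge0 : 0 <= W.
Hypothesis chaos2_le : forall B, mxspan chaos_matrices B ->
  (quad B eps - \tr B) ^+ 2 <= W * mxdot B B.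
Hypothesis chaos1_le : forall v, mxspan chaos_vectors v -> dot v eps ^+ 2 <= W * dot v v.

Variables (th : R * R) (a : {set 'I_p}).
Hypothesis bth : box th.
Local Notation A := (W0 *m (F *m selector R a)).
Hypothesis GA : A^T *m H th *m A \in unitmx.

Definition bias : 'cV[R]_(m ^ 2) := W0 *m mu - gls_proj (H th) A *m (W0 *m mu).
Definition fit : 'cV[R]_(m ^ 2) := gls_proj (H th) A *m eps.

Let Hs : (H th)^T = H th. Proof. exact: rel_prec_sym. Qed.
Let Hpos x : x != 0 -> 0 < quad (H th) x.
Proof.
have [s0 k0] := in_box_gt0 bth; have [s00 k00] := in_box_gt0 box0.
exact: rel_prec_gt0.
Qed.
Let Hle x : quad (H th) x <= C * dot x x. Proof. exact: rel_prec_le. Qed.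

Lemma quad_bias_ge0 : 0 <= quad (H th) bias. Proof. exact: quad_ge0. Qed.
Lemma quad_fit_ge0 : 0 <= quad (H th) fit. Proof. exact: quad_ge0. Qed.

Lemma mxspan_proj (k : R) v : mxspan regressors (k *: (W0 *m mu) + gls_proj (H th) A *m v).
Proof. by rewrite gls_projE 2!mulmxA -(mulmxA (W0 *m F)); exact: mxspan_regressors. Qed.

Lemma quad_fit_le_chaos : quad (H th) fit <= C * W.
Proof.
apply: (quad_fit_le Hs GA prec_bound_gt0 Hpos Hle W_ge0).
apply: chaos1_le; apply: mxspan_chaos_vectors => //.
by have := mxspan_proj 0 eps; rewrite scale0r add0r.
Qed.

(** Subtracting [quad 1%:M eps - n], which is common to all models, turns the chaos of [H] into that
    of [H - 1], whose norm the entropy controls. *)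
Lemma criterion_gap_le (eta : R) : 0 < eta ->
  `|(quad (H th) eps - \tr (H th)) + 2 * dot (H th *m bias) eps - 2 * quad (H th) fit
    - (quad 1%:M eps - (m ^ 2)%:R)| <=
  eta * (entropy (H th) / 2 + (quad (H th) bias + quad (H th) fit) / 2)
    + (10 * (1 + C) / eta + 2 * C) * W.
Proof.
move=> eta0.
have -> : (quad (H th) eps - \tr (H th)) + 2 * dot (H th *m bias) eps - 2 * quad (H th) fit
    - (quad 1%:M eps - (m ^ 2)%:R) = (quad (H th - 1%:M) eps - \tr (H th - 1%:M))
      + 2 * dot (H th *m bias) eps - 2 * quad (H th) fit.
  have -> : quad (H th - 1%:M) eps = quad (H th) eps - quad 1%:M eps.
    by rewrite /quad mulmxBl dotDr dotNr.
  have -> : \tr (H th - 1%:M) = \tr (H th) - (m ^ 2)%:R.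
    by rewrite (raddfB (@mxtrace R _)) /= mxtrace1.
  have alg (q t d f q1 n : R) : q - t + 2 * d - 2 * f - (q1 - n) = q - q1 - (t - n) + 2 * d - 2 * f by ring.
  exact: alg.
apply: (criterion_gap prec_bound_gt0 W_ge0 (entropy_rel_prec_ge0 bth) quad_bias_ge0 quad_fit_ge0 eta0).
- apply: le_trans (chaos2_le (mxspan_chaos_matrices bth)) _.
  by rewrite ler_wpM2l// entropy_rel_prec_ge.
- apply: (cross_term_le Hs prec_bound_gt0 Hpos Hle W_ge0).
  apply: chaos1_le; apply: mxspan_chaos_vectors => //.
  rewrite /bias; have := mxspan_proj (-1) (W0 *m mu).
  by rewrite scaleN1r addrC -opprB => /(mxspanZ (-1)); rewrite scaleN1r opprK.
- exact: quad_fit_le_chaos.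
Qed.

Lemma bias_eq0 b : mu = F *m selector R a *m b -> bias = 0.
Proof. by move=> h; rewrite /bias h mulmxA gls_proj_fix. Qed.

Lemma entropy_fit_eq0 : entropy (H th) = 0 -> quad (H th) fit = 0 -> A^T *m eps = 0.
Proof.
move=> h; apply: (quad_fit_eq0 GA Hpos).
have := entropy_rel_prec_ge bth; rewrite h mulr0 => h'; apply/eqP; rewrite -subr_eq0.
by apply/eqP/mxdot_eq0/eqP; rewrite eq_le h' mxdot_ge0.
Qed.
End model_bounds.

Section bias_comparison.
Variables (R : realType) (delta : R) (m p : nat) (s1 s2 k1 k2 : R) (th0 : R * R).
Hypotheses (m0 : (0 < m)%N) (s1_gt0 : 0 < s1) (k1_gt0 : 0 < k1) (s12 : s1 <= s2) (k12 : k1 <= k2).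
Hypothesis box0 : in_box s1 s2 k1 k2 th0.
Variables (F : 'M[R]_(m ^ 2, 1 + p)) (mu : 'cV[R]_(m ^ 2)) (a : {set 'I_p}).
Local Notation H th := (rel_prec delta m th0 th).
Local Notation C := (prec_bound s1 s2 k1 k2).
Local Notation A := (whitener delta m th0 *m (F *m selector R a)).

(** By [gls_min] the residual of the projection for [th'] competes at [th]. One factor [C] passes
    from [H th] to the Euclidean norm, the other from there to [H th']. *)
Lemma quad_bias_compare th th' :
  in_box s1 s2 k1 k2 th -> in_box s1 s2 k1 k2 th' ->
  A^T *m H th *m A \in unitmx -> A^T *m H th' *m A \in unitmx ->
  quad (H th) (bias delta th0 F mu th a) <= C ^+ 2 * quad (H th') (bias delta th0 F mu th' a).
Proof.
move=> b b' G G'; have [s0 k0] := in_box_gt0 s1_gt0 k1_gt0 b.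
have [s00 k00] := in_box_gt0 s1_gt0 k1_gt0 box0.
have pos x : x != 0 -> 0 < quad (H th) x by exact: rel_prec_gt0.
have := rel_prec_ge delta m0 s1_gt0 k1_gt0 k12 (bias delta th0 F mu th' a) box0 b'.
move=> /(ler_wpM2l (ltW (prec_bound_gt0 s1_gt0 k1_gt0 s12 k12))); rewrite mulrA -expr2.
apply: le_trans; apply: le_trans (rel_prec_le delta m0 s1_gt0 k1_gt0 k12 _ box0 b).
rewrite {2}/bias gls_projE.
exact: (gls_min (rel_prec_sym _ _ _ _) G pos _ _).
Qed.
End bias_comparison.

(** The last grid line lies at [m * m^(-(1 - delta)) = m^delta = n^(delta / 2)], exactly on the
    border of the domain. *)
Lemma site_domain (R : realType) (delta : R) (m : nat) (k : 'I_(m ^ 2)) :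
  domain delta m (site delta k).
Proof.
have m0 : (0 < m)%N by have := leq_ltn_trans (leq0n k) (ltn_ord k); rewrite expn_gt0 orbF.
have mr : 0 < m%:R :> R by rewrite ltr0n.
have h (i : nat) : (i < m)%N -> 0 <= i.+1%:R * m%:R `^ (- (1 - delta)) <= (m ^ 2)%:R `^ (delta / 2).
  move=> im; rewrite mulr_ge0 ?powR_ge0//=.
  have -> : (m ^ 2)%:R `^ (delta / 2) = m%:R * m%:R `^ (- (1 - delta)) :> R.
    have -> : (m ^ 2)%:R = m%:R `^ 2 :> R by rewrite powR_mulrn ?ler0n// natrX.
    rewrite -powRrM (_ : 2 * (delta / 2) = 1 + - (1 - delta)); last by field.
    by rewrite powRD ?powRr1 ?ler0n// (gt_eqF mr) implybT.
  by rewrite ler_wpM2r ?powR_ge0// ler_nat.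
by split; apply: h; [rewrite ltn_mod|rewrite ltn_divLR// mulnn].
Qed.

Lemma half_sum_eq0 (R : realFieldType) (a b c : R) : 0 <= a -> 0 <= b -> 0 <= c ->
  a / 2 + (b + c) / 2 <= 0 -> a = 0 /\ c = 0.
Proof. by move=> a0 b0 c0 h; split; lra. Qed.

Lemma loss_bound (R : realFieldType) (K C2 CW e e' b b' f f' : R) :
  0 <= K -> 0 <= C2 -> 0 <= e -> 0 <= b -> 0 <= f ->
  e' <= K * e -> b' <= C2 * b -> f' <= CW ->
  e' / 2 + (b' + f') / 2 <= (K + C2) * (e / 2 + (b + f) / 2) + CW / 2.
Proof.
move=> K0 C0 e0 b0 f0 h1 h2 h3.
have p1 := mulr_ge0 C0 e0; have p2 := mulr_ge0 K0 b0.
have p3 := mulr_ge0 K0 f0; have p4 := mulr_ge0 C0 f0; lra.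
Qed.

Section grid_model.
Context {d : measure_display} {T : measurableType d} {R : realType}.
Context (P : probability T R) {p : nat}.
Variables (delta : R) (mu0 : nat -> R * R -> R).
Variables (x : nat -> 'I_p -> R * R -> R) (eta : nat -> R * R -> {RV P >-> R}).
Variables (m : nat) (s1 s2 k1 k2 : R) (th0 : R * R) (Theta : set (R * R)).
Hypotheses (m0 : (0 < m)%N) (s1_gt0 : 0 < s1) (k1_gt0 : 0 < k1) (s12 : s1 <= s2) (k12 : k1 <= k2).
Local Notation box := (in_box s1 s2 k1 k2).
Local Notation C := (prec_bound s1 s2 k1 k2).
Local Notation H th := (rel_prec delta m th0 th).
Local Notation W0 := (whitener delta m th0).
Local Notation F := (full_design delta x m).
Local Notation mu := (mean_vec delta mu0 m).
Hypothesis Tbox : forall th, Theta th -> box th.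
Hypothesis T0 : Theta th0.
Hypothesis etaG : gaussian_process (domain delta m) (eta m).
Hypothesis etaC : centered (domain delta m) (eta m).
Hypothesis etaS : dispersion P (data delta mu0 eta m) = Sigma delta m th0.
Hypothesis FU : forall th, Theta th -> F^T *m invmx (Sigma delta m th) *m F \in unitmx.
Local Notation loss := (loss delta mu0 x eta m).
Local Notation ell := (ell delta mu0 x eta m).

Let Y (k : 'I_(m ^ 2)) := eta m (site delta k).
Let eps (w : T) : 'cV[R]_(m ^ 2) := white_vec Y W0 w.

Let YG (c : 'I_(m ^ 2) -> R) : gaussian_rv P (fun w => \sum_i c i * Y i w).
Proof. exact: (etaG c (fun k => @site_domain R delta m k)). Qed.

Let YC i : 'E_P[Y i]%E = 0%E.
Proof. by apply: etaC; exact: site_domain. Qed.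

Let pos th : Theta th -> 0 < th.1 /\ 0 < th.2.
Proof. by move=> /Tbox/(in_box_gt0 s1_gt0 k1_gt0). Qed.

Let S0W : W0 *m (\matrix_(i, j) fine (covariance P
  (fun w => mu0 m (site delta i) + Y i w) (fun w => mu0 m (site delta j) + Y j w))) *m W0^T = 1%:M.
Proof.
have [s00 k00] := pos T0; rewrite -(whitenerK delta m0 s00 k00) -etaS.
congr (_ *m _ *m _); apply/matrixP => i j; rewrite !mxE.
by congr (fine (covariance P _ _)); apply/funext => w; rewrite mxE.
Qed.

Let zE w : W0 *m data delta mu0 eta m w = W0 *m mu + eps w.
Proof.
rewrite /eps white_vecE -mulmxDr; congr (_ *m _).
by apply/colP => k; rewrite !mxE.
Qed.

Lemma invmx_Sigma_gt0 th (y : 'cV[R]_(m ^ 2)) : 0 < th.1 -> 0 < th.2 -> y != 0 ->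
  0 < quad (invmx (Sigma delta m th)) y.
Proof.
move=> s0 k0 y0; rewrite invmx_Sigma// lt_neqAle eq_sym.
have -> : quad ((whitener delta m th)^T *m whitener delta m th) y =
    dot (whitener delta m th *m y) (whitener delta m th *m y).
  by rewrite /quad -mulmxA dot_mulmx trmxK.
rewrite dot_ge0 andbT; apply: contraNneq y0 => /dot_eq0.
by move=> /(congr1 (mulmx (invmx (whitener delta m th)))); rewrite mulKmx ?whitener_unit// mulmx0 => ->.
Qed.

Lemma design_Sigma_unit a th : Theta th ->
  (design delta x m a)^T *m invmx (Sigma delta m th) *m design delta x m a \in unitmx.
Proof.
move=> Tth; have [s0 k0] := pos Tth; rewrite design_selector.
by apply: design_unit (FU Tth) => y; exact: invmx_Sigma_gt0.
Qed.

Lemma design_rel_prec_unit a th : Theta th ->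
  (W0 *m (F *m selector R a))^T *m H th *m (W0 *m (F *m selector R a)) \in unitmx.
Proof.
move=> Tth; have [s0 k0] := pos Tth; have [s00 k00] := pos T0.
have := design_Sigma_unit a Tth; rewrite design_selector (invmx_Sigma_rel delta m0 s00 k00 s0 k0) => u.
by rewrite trmx_mul -!mulmxA; rewrite -!mulmxA in u.
Qed.

Definition bias_sq a th : R := quad (H th) (bias delta th0 F mu th a).
Definition fit_sq a th w : R := quad (H th) (fit delta th0 F (eps w) th a).

Lemma loss_decomposition a th w : Theta th ->
  loss a th w = entropy (H th) / 2 + (bias_sq a th + fit_sq a th w) / 2.
Proof.
move=> Tth; have [s0 k0] := pos Tth; have [s00 k00] := pos T0.
rewrite /loss etaS design_selector.
rewrite (kl_loss_whiten (rel_prec_sym _ _ _ _) (invmx_Sigma_rel delta m0 s00 k00 s0 k0)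
  (whitenerK delta m0 s00 k00) (design_rel_prec_unit a Tth) (zE w)).
by rewrite kl_entropy.
Qed.

Let cst w : R := (m ^ 2)%:R * ln (2 * pi) + ln (\det (Sigma delta m th0)) + quad 1%:M (eps w).

Lemma ell_decomposition a th w : Theta th ->
  - 2 * ell a th w - 2 * loss a th w - cst w =
  (quad (H th) (eps w) - \tr (H th)) + 2 * dot (H th *m bias delta th0 F mu th a) (eps w)
  - 2 * fit_sq a th w - (quad 1%:M (eps w) - (m ^ 2)%:R).
Proof.
move=> Tth; have [s0 k0] := pos Tth; have [s00 k00] := pos T0.
rewrite /loss /ell etaS design_selector.
rewrite (loglik_kl_loss (rel_prec_sym _ _ _ _) (invmx_Sigma_rel delta m0 s00 k00 s0 k0)
  (whitenerK delta m0 s00 k00) (design_rel_prec_unit a Tth) (zE w)).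
rewrite /cst -/(bias _ _ _ _ _ _) -/(fit _ _ _ _ _ _) -/(fit_sq _ _ _).
have alg (a1 a2 a3 a4 a5 a6 a7 : R) :
  a1 + a2 + a3 + a4 + a5 - a6 - (a1 + a2 + a7) = a4 + a5 - a6 - (a7 - a3) by ring.
exact: alg.
Qed.
Let fit_sq_ge0 a th w : Theta th -> 0 <= fit_sq a th w.
Proof. by move=> Tth; apply: (quad_fit_ge0 delta m0 s1_gt0 k1_gt0 (Tbox T0)); exact: Tbox. Qed.

Let bias_sq_ge0 a th : Theta th -> 0 <= bias_sq a th.
Proof. by move=> Tth; apply: (quad_bias_ge0 delta m0 s1_gt0 k1_gt0 (Tbox T0)); exact: Tbox. Qed.

Let entropy_ge0 th : Theta th -> 0 <= entropy (H th).
Proof. by move=> Tth; exact: (entropy_rel_prec_ge0 delta m0 s1_gt0 k1_gt0 s12 k12 (Tbox T0) (Tbox Tth)). Qed.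

Lemma loss_ge0 a th w : Theta th -> 0 <= loss a th w.
Proof.
move=> Tth; rewrite loss_decomposition//.
apply: addr_ge0; apply: divr_ge0 => //; first exact: entropy_ge0.
by apply: addr_ge0; [exact: bias_sq_ge0|exact: fit_sq_ge0].
Qed.

(** A vanishing loss forces [H = 1] and noise orthogonal to all whitened regressors, in particular
    to the intercept. This is one event for all models and parameters, so it also covers estimates,
    and it is null because the noise has no atoms. *)
Lemma loss_null : exists N : set T, [/\ measurable N, P N = 0%E &
  forall a th w, Theta th -> ~ N w -> 0 < loss a th w].
Proof.
pose c i := \sum_k W0 i k.
exists [set w | \sum_i c i * white Y W0 i w = 0]; split.
- have mf : measurable_fun [set: T] (fun w => \sum_i c i * white Y W0 i w).
    apply: measurable_sum => i; apply: measurable_funM; first exact: measurable_cst.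
    by apply: measurable_sum => k; apply: measurable_funM => //; exact: measurable_cst.
  by have := mf measurableT _ (measurable_set1 0); rewrite setTI.
- apply: (white_atomless YG YC S0W).
  have [s00 k00] := pos T0.
  have : (const_mx 1 : 'cV[R]_(m ^ 2)) != 0.
    have n0 : (0 < m ^ 2)%N by rewrite expn_gt0 m0.
    by apply/eqP => /colP/(_ (Ordinal n0)); rewrite !mxE => /eqP; rewrite oner_eq0.
  apply: contra_neq => h; apply: (can_inj (mulKmx (whitener_unit delta m0 s00 k00))).
  rewrite mulmx0; apply: dot_eq0; rewrite -[RHS]h /dot mxE; apply: eq_bigr => i _.
  rewrite [_^T _ _]mxE -expr2; congr (_ ^+ 2); rewrite mxE.
  by apply: eq_bigr => k _; rewrite [const_mx _ _ _]mxE mulr1.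
- move=> a th w Tth; apply: contra_notT; rewrite -leNgt loss_decomposition// => l0.
  have h1 := bias_sq_ge0 a Tth; have h2 := fit_sq_ge0 a w Tth; have h3 := entropy_ge0 Tth.
  have [e0 f0] := half_sum_eq0 h3 h1 h2 l0.
  have := entropy_fit_eq0 m0 s1_gt0 k1_gt0 s12 k12 (Tbox T0) (Tbox Tth)
    (design_rel_prec_unit a Tth) e0 f0.
  move=> /matrixP/(_ ord0 0); rewrite !mxE => h; rewrite /= -[RHS]h; apply: eq_bigr => i _.
  rewrite [_^T _ _]mxE [eps w _ _]mxE; congr (_ * _); rewrite -design_selector mxE.
  apply: eq_bigr => k _; rewrite /design.
  rewrite (_ : ord0 = lshift _ (0 : 'I_1)) ?row_mxEl ?mxE ?mulr1//; exact: val_inj.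
Qed.

(** Neither [W] nor [c] depends on the model or the parameter, so random estimates may be
    substituted for [th]. *)
Lemma gaussian_regression_bounds : exists (W c : T -> R) (r : R), [/\ forall w, 0 <= W w,
    hasE P W r, r <= (130 + 64 * (2 + p))%:R,
    forall a th w, Theta th -> fit_sq a th w <= C * W w &
    forall a th w e, Theta th -> 0 < e ->
      `|- 2 * ell a th w - 2 * loss a th w - c w| <=
      e * loss a th w + (10 * (1 + C) / e + 2 * C) * W w].
Proof.
have [W [W_ge0 [r Wr rK] W2 W1]] := white_sup YG YC S0W (chaos_matrices delta m th0)
  (chaos_vectors delta th0 F mu).
exists W, cst, r; split => //.
- by rewrite size_chaos in rK.
- move=> a th w Tth.
  exact: (quad_fit_le_chaos m0 s1_gt0 k1_gt0 s12 k12 (Tbox T0) (W_ge0 w) (W1 w) (Tbox Tth)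
    (design_rel_prec_unit a Tth)).
- move=> a th w e Tth e0; rewrite ell_decomposition// loss_decomposition//.
  exact: (criterion_gap_le m0 s1_gt0 k1_gt0 s12 k12 (Tbox T0) (W_ge0 w) (W2 w) (W1 w) (Tbox Tth)
    (design_rel_prec_unit a Tth) e0).
Qed.

(** At the true parameter a correct model has neither entropy nor bias. This is the competitor that
    bounds its loss at the estimate. *)
Lemma loss_true_model a w : correct delta mu0 x m a ->
  loss a th0 w = fit_sq a th0 w / 2.
Proof.
move=> [b0 [b hb]]; rewrite loss_decomposition//.
have -> : bias_sq a th0 = 0.
  rewrite /bias_sq (@bias_eq0 _ _ _ _ _ _ _ _ _ (design_rel_prec_unit a T0)
    (col_mx (const_mx b0 : 'cV_1) (\col_j b (enum_val j)))) ?/quad ?/dot ?trmx0 ?mul0mx ?mxE//.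
  rewrite -design_selector /design mul_row_col; apply/colP => k.
  rewrite !mxE hb ?big_ord1 ?mxE ?mul1r; last exact: site_domain.
  congr (_ + _); rewrite big_enum_val; apply: eq_bigr => j _.
  by rewrite !mxE mulrC.
have [s0 k0] := pos T0; rewrite rel_prec0// add0r.
rewrite /entropy det1 ln1 subr0 mxtrace1 subrr mul0r add0r//.
Qed.

(** Entropy and bias are deterministic; only the fitted noise is random. Thus the loss at [tha] and
    any outcome [w'] is bounded through the loss at [th] and the fixed outcome [w]. Integration over
    [w'] leaves [w] free, and [th] can later be the estimate at [w]. *)
Lemma risk_le a tha th w (K r : R) (W : T -> R) : Theta th -> Theta tha -> 0 <= K ->
  entropy (H tha) <= K * entropy (H th) ->
  measurable_fun [set: T] (loss a tha) ->
  hasE P W r -> (forall w, fit_sq a tha w <= C * W w) ->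
  (risk delta mu0 x eta m a tha <= ((K + C ^+ 2) * loss a th w + C * r / 2)%:E)%E.
Proof.
move=> Tth Ta K0 eK ml Wr fW.
pose B := (K + C ^+ 2) * loss a th w.
have h : hasE P (fun w' => B + C / 2 * W w') (B + C / 2 * r).
  by apply: hasE_D; [exact: hasE_cst|exact: hasE_Z].
have le w' : loss a tha w' <= B + C / 2 * W w'.
  rewrite (mulrAC C).
  rewrite /B !loss_decomposition//.
  have h1 := bias_sq_ge0 a Tth; have h2 := fit_sq_ge0 a w Tth; have h3 := entropy_ge0 Tth.
  have h4 := quad_bias_compare m0 s1_gt0 k1_gt0 s12 k12 (Tbox T0) mu (Tbox Ta) (Tbox Tth)
    (design_rel_prec_unit a Ta) (design_rel_prec_unit a Tth).
  rewrite -/(bias_sq a tha) -/(bias_sq a th) in h4; have h5 := fW w'.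
  by apply: loss_bound => //; rewrite ?sqr_ge0.
have -> : B + C * r / 2 = B + C / 2 * r by ring.
rewrite /risk unlock -h.2; apply: ge0_le_integral => //.
- by move=> w' _; rewrite lee_fin loss_ge0.
- exact/measurable_EFinP.
- exact: measurable_int h.1.
- by move=> w' _; rewrite lee_fin.
Qed.
End grid_model.

(** * Measurability of the loss *)

Section measurable_matrices.
Context {d : measure_display} {T : measurableType d} {R : realType}.

(** The inverse of [f] is [f * exp (- ln (f^2))], a composition of measurable functions; where [f]
    is 0, both sides are 0. *)
Lemma measurable_funV (f : T -> R) : measurable_fun [set: T] f ->
  measurable_fun [set: T] (fun w => (f w)^-1).
Proof.
move=> mf; have -> : (fun w => (f w)^-1) = (fun w => f w * expR (- ln (f w * f w))).
  apply/funext => w; have [->|f0] := eqVneq (f w) 0; first by rewrite invr0 mul0r.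
  rewrite expRN lnK ?posrE; last by rewrite -expr2 exprn_even_gt0.
  by rewrite invfM mulrA divff// mul1r.
apply: measurable_funM => //; apply: measurableT_comp => //.
apply: measurableT_comp => //; apply: measurableT_comp => //.
exact: measurable_funM.
Qed.

Definition mx_measurable m n (M : T -> 'M[R]_(m, n)) :=
  forall i j, measurable_fun [set: T] (fun w => M w i j).

Lemma mx_measurable_cst m n (M : 'M[R]_(m, n)) : mx_measurable (fun=> M).
Proof. by move=> i j; exact: measurable_cst. Qed.

Lemma mx_measurableM m n k (M : T -> 'M[R]_(m, n)) (N : T -> 'M[R]_(n, k)) :
  mx_measurable M -> mx_measurable N -> mx_measurable (fun w => M w *m N w).
Proof.
move=> mM mN i j; rewrite (_ : (fun w => _) = (fun w => \sum_l M w i l * N w l j)); last first.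
  by apply/funext => w; rewrite mxE.
by apply: measurable_sum => l; apply: measurable_funM; [exact: mM|exact: mN].
Qed.

Lemma mx_measurableB m n (M N : T -> 'M[R]_(m, n)) :
  mx_measurable M -> mx_measurable N -> mx_measurable (fun w => M w - N w).
Proof.
move=> mM mN i j; rewrite (_ : (fun w => _) = (fun w => M w i j - N w i j)); last first.
  by apply/funext => w; rewrite !mxE.
by apply: measurable_funB; [exact: mM|exact: mN].
Qed.

Lemma mx_measurable_tr m n (M : T -> 'M[R]_(m, n)) :
  mx_measurable M -> mx_measurable (fun w => (M w)^T).
Proof.
move=> mM i j; rewrite (_ : (fun w => _) = (fun w => M w j i)); first exact: mM.
by apply/funext => w; rewrite mxE.
Qed.

Lemma measurable_det n (M : T -> 'M[R]_n) :
  mx_measurable M -> measurable_fun [set: T] (fun w => \det (M w)).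
Proof.
move=> mM; apply: measurable_sum => s; apply: measurable_funM; first exact: measurable_cst.
by apply: measurable_prod => i _; exact: mM.
Qed.

Lemma measurable_trace n (M : T -> 'M[R]_n) :
  mx_measurable M -> measurable_fun [set: T] (fun w => \tr (M w)).
Proof. by move=> mM; apply: measurable_sum => i; exact: mM. Qed.

Lemma mx_measurableV n (M : T -> 'M[R]_n) : (forall w, M w \in unitmx) ->
  mx_measurable M -> mx_measurable (fun w => invmx (M w)).
Proof.
move=> uM mM i j.
rewrite (_ : (fun w => _) = (fun w => (\det (M w))^-1 *
    ((-1) ^+ (j + i) * \det (row' j (col' i (M w)))))); last first.
  by apply/funext => w; rewrite /invmx uM !mxE.
apply: measurable_funM; first exact/measurable_funV/measurable_det.
apply: measurable_funM; first exact: measurable_cst.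
apply: measurable_det => i' j'; rewrite (_ : (fun w => _) = (fun w => M w (lift j i') (lift i j'))).
  exact: mM.
by apply/funext => w; rewrite !mxE.
Qed.

Lemma measurable_kl_loss n q (X : 'M[R]_(n, q)) (S : T -> 'M[R]_n) (S0 : 'M[R]_n)
    (mu : 'cV[R]_n) (z : T -> 'cV[R]_n) :
  (forall w, S w \in unitmx) -> (forall w, X^T *m invmx (S w) *m X \in unitmx) ->
  mx_measurable S -> mx_measurable z ->
  measurable_fun [set: T] (fun w => kl_loss X (S w) S0 mu (z w)).
Proof.
move=> uS uX mS mz; have mV := mx_measurableV uS mS.
have mX := mx_measurable_cst X; have mXT := mx_measurable_cst X^T.
have mI := mx_measurableV uX (mx_measurableM (mx_measurableM mXT mV) mX).
have mE : mx_measurable (fun w => gls_mean X (S w) (z w) - mu).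
  apply: mx_measurableB; last exact: mx_measurable_cst.
  exact: mx_measurableM (mx_measurableM (mx_measurableM (mx_measurableM mX mI) mXT) mV) mz.
have mQ := mx_measurableM (mx_measurableM (mx_measurable_tr mE) mV) mE.
rewrite /kl_loss /qform; apply: measurable_funD.
  apply: measurable_funM; last exact: measurable_cst.
  apply: measurable_funB; last exact: measurable_cst.
  apply: measurable_funD.
    apply: measurable_funB; last exact: measurable_cst.
    by apply: measurableT_comp => //; exact: measurable_det.
  exact: measurable_trace (mx_measurableM (mx_measurable_cst S0) mV).
by apply: measurable_funM; [exact: mQ|exact: measurable_cst].
Qed.
End measurable_matrices.

Lemma mx_measurable_Sigma {d : measure_display} {T : measurableType d} {R : realType}
  (delta : R) m (th : T -> R * R) :
  measurable_fun [set: T] th -> mx_measurable (fun w => Sigma delta m (th w)).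
Proof.
move=> mth k l; rewrite (_ : (fun w => _) = (fun w => (th w).1 * expR (- (th w).2 *
   (`|(site delta k).1 - (site delta l).1| + `|(site delta k).2 - (site delta l).2|)))); last first.
  by apply/funext => w; rewrite !mxE.
apply: measurable_funM; first exact: measurableT_comp measurable_fst mth.
apply: measurableT_comp => //; apply: measurable_funM; last exact: measurable_cst.
by apply: measurableT_comp => //; exact: measurableT_comp measurable_snd mth.
Qed.

Lemma measurable_loss {d : measure_display} {T : measurableType d} {R : realType}
    (P : probability T R) (p : nat) (delta : R) mu0 (x : nat -> 'I_p -> R * R -> R)
    (eta : nat -> R * R -> {RV P >-> R}) m a (th : T -> R * R) :
  (forall w, Sigma delta m (th w) \in unitmx) ->
  (forall w, (design delta x m a)^T *m invmx (Sigma delta m (th w)) *m design delta x m a \in unitmx) ->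
  measurable_fun [set: T] th ->
  measurable_fun [set: T] (fun w => loss delta mu0 x eta m a (th w) w).
Proof.
move=> uS uX mth; apply: measurable_kl_loss => //; first exact: mx_measurable_Sigma.
move=> k j; rewrite (_ : (fun w => _) = (fun w => mu0 m (site delta k) + eta m (site delta k) w)).
  by apply: measurable_funD => //; exact: measurable_cst.
by apply/funext => w; rewrite mxE.
Qed.

(** * Comparison of the criteria *)

Lemma min_over_attained (R : realType) (I : finType) (A : {set I}) (L : I -> R) (i : I) :
  i \in A -> exists2 b, b \in A & (forall j, j \in A -> L b <= L j) /\
    min_over A (fun j => (L j)%:E) = (L b)%:E.
Proof.
move=> iA; case: (@arg_minP _ _ _ i (mem A) L iA) => b bA bL.
exists b => //; split; first by move=> j; exact: bL.
apply/eqP; rewrite eq_le; apply/andP; split; first exact: bigmin_le_cond.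
by apply: le_bigmin => [|j jA]; rewrite ?leey// lee_fin; exact: bL.
Qed.

Lemma ratio_close (R : realType) (I : finType) (A : {set I}) (L : I -> R) (a : I) (e : R) :
  a \in A -> (forall b, b \in A -> 0 < L b) -> (forall b, b \in A -> L a <= (1 + e) * L b) ->
  `|L a / fine (min_over A (fun b => (L b)%:E)) - 1| <= e.
Proof.
move=> aA L0 Le; have [b bA [bL ->]] := min_over_attained L aA.
have b0 := L0 b bA; have h1 := bL a aA; have h2 := Le b bA => /=.
have d1 : 1 <= L a / L b by rewrite ler_pdivlMr// mul1r.
have d2 : L a / L b <= 1 + e by rewrite ler_pdivrMr.
by rewrite ger0_norm; lra.
Qed.

(** [(2 - e) (1 + 4 e) - (2 + 2 e) = e (5 - 4 e)], which is nonnegative for [e <= 1]. *)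
Lemma selection_arith (R : realFieldType) (e l l' : R) : 0 < e -> e <= 1 -> 0 <= l ->
  (2 - e) * l' <= (2 + 2 * e) * l -> l' <= (1 + 4 * e) * l.
Proof.
move=> e0 e1 l0 h; have p : 0 < 2 - e by lra.
have q := mulr_ge0 (mulr_ge0 (ltW e0) l0) (_ : 0 <= 5 - 4 * e).
rewrite -(ler_pM2l p) (le_trans h)//.
have : 0 <= e * l * (5 - 4 * e) by apply: q; lra.
by lra.
Qed.

Lemma consistency_arith (R : realFieldType) (K l l0 t t0 t1 : R) : 0 < K -> 0 < l -> l0 <= K ->
  t0 + t <= t1 -> 8 * K <= t ->
  (2 - 1) * l <= (2 + 1) * l0 + 2 * (K / 1 + K) + (t0 - t1) -> False.
Proof. by rewrite divr1; lra. Qed.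

(* The criterion of [a] is [2 * L a + cst] up to a small relative error, a
   bounded error and the penalty; on the good event incorrect models have a
   loss that dominates both the bounded error and the penalty. *)
Definition good_set {R : realType} {p : nat} {T : Type} (A A0 : {set {set 'I_p}})
    (L ell : {set 'I_p} -> T -> R) (cst : T -> R) (Rmin : \bar R) (K : R) (g : set T) :=
  forall w, g w -> [/\ forall a, a \in A -> 0 < L a w,
    forall a e, a \in A -> 0 < e ->
      `|- 2 * ell a w - 2 * L a w - cst w| <= e * L a w + (K / e + K),
    forall a, a \in A0 -> L a w <= K &
    forall a, a \in A :\: A0 -> (Rmin <= (K * L a w + K)%:E)%E].

Section selection.
Context {R : realType} {p : nat} {T : Type}.
Variables (A A0 : {set {set 'I_p}}) (L ell : nat -> {set 'I_p} -> T -> R).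
Variables (cst : nat -> T -> R) (Rmin : nat -> \bar R) (good : nat -> set T) (K : R).
Variables (tau : nat -> R) (ahat : nat -> T -> {set 'I_p}).
Hypothesis K0 : 0 < K.
Hypothesis goodP : \forall m \near \oo,
  good_set A A0 (L m) (ell m) (cst m) (Rmin m) K (good m).
Hypothesis A0A : A0 \subset A.
Hypothesis Rmin_cvg : Rmin m @[m --> \oo] --> +oo%E.
Hypothesis tau_small : forall e : R, 0 < e ->
  \forall m \near \oo, (`|tau m|%:E <= e%:E * Rmin m)%E.
Hypothesis ahat_min : \forall m \near \oo, forall w, ahat m w \in A /\
  forall a, a \in A -> - 2 * ell m (ahat m w) w + tau m * #|ahat m w|%:R <=
    - 2 * ell m a w + tau m * #|a|%:R.

Lemma incorrect_ge (M : R) : \forall m \near \oo, forall w, good m w ->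
  forall a, a \in A :\: A0 -> M <= L m a w.
Proof.
have h : \forall m \near \oo, ((K * M + K)%:E <= Rmin m)%E.
  by move/cvgeyPge : Rmin_cvg; exact.
apply: filterS2 h goodP => m h1 h2 w gw a aA.
have [_ _ _ /(_ a aA)/(le_trans h1)] := h2 w gw.
by rewrite lee_fin lerD2r ler_pM2l.
Qed.

(** On the good event [Rmin <= K L + K], and eventually [L >= 1]; so a penalty negligible against
    [Rmin] is negligible against each incorrect loss. *)
Lemma penalty_le (e : R) : 0 < e -> \forall m \near \oo, forall w, good m w ->
  forall a, a \in A :\: A0 -> `|tau m| <= e * L m a w.
Proof.
move=> e0; have d0 : 0 < e / (2 * K) by rewrite divr_gt0// mulr_gt0.
apply: filterS3 (incorrect_ge 1) goodP (tau_small d0) => m l1 l2 h1 w gw a aA.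
have h3 := l1 w gw a aA; have [_ _ _ /(_ a aA) h2] := l2 w gw.
have : (`|tau m|%:E <= (e / (2 * K))%:E * (K * L m a w + K)%:E)%E.
  by apply: le_trans h1 _; rewrite lee_wpmul2l// lee_fin ltW.
rewrite -EFinM lee_fin => /le_trans; apply.
have -> : e / (2 * K) * (K * L m a w + K) = e / 2 * (L m a w + 1) by field; rewrite gt_eqF.
have -> : e * L m a w = e / 2 * (2 * L m a w) by field.
by rewrite ler_pM2l ?divr_gt0//; lra.
Qed.

Lemma card_model (a : {set 'I_p}) : (0 <= #|a|%:R :> R) && (#|a|%:R <= p%:R :> R).
Proof. by rewrite ler0n ler_nat; have := max_card (mem a); rewrite card_ord. Qed.

Lemma penalty_bound (t : R) (a : {set 'I_p}) : `|t * #|a|%:R| <= `|t| * p%:R.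
Proof.
have /andP[h1 h2] := card_model a.
by rewrite normrM [`|#|a|%:R|]ger0_norm// ler_wpM2l.
Qed.

(** The gap bound is applied to the selected model and to its competitor, and the random constant
    [cst] cancels between the two criteria. *)
Lemma selection_le (e : R) : 0 < e -> \forall m \near \oo, forall w, good m w ->
  forall b, b \in A -> (2 - e) * L m (ahat m w) w <=
    (2 + e) * L m b w + 2 * (K / e + K) + (tau m * #|b|%:R - tau m * #|ahat m w|%:R).
Proof.
move=> e0; apply: filterS2 goodP ahat_min => m gP sel w gw b bA; have [_ gap _ _] := gP w gw.
have [aA /(_ b bA) h] := sel w.
have := gap _ e aA e0; have := gap _ e bA e0.
rewrite !ler_norml => /andP[_ h2] /andP[h1 _].
move: (L m b w) (L m (ahat m w) w) (K / e) h1 h2 h => l l' k h1 h2 h.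
rewrite mulrBl [(2 + e) * _]mulrDl; lra.
Qed.

Lemma loss_le_of_incorrect (e : R) : 0 < e <= 1 -> \forall m \near \oo, forall w, good m w ->
  forall b, b \in A :\: A0 -> L m (ahat m w) w <= (1 + 4 * e) * L m b w.
Proof.
(* This value makes each of the two penalties at most [e / 4] of the loss, with [p + 1] covering
   [p = 0]; the threshold on the loss makes the bounded error at most [e / 2] of it. *)
move=> /andP[e0 e1]; have p0 : 0 < e / (4 * (p%:R + 1)) by rewrite divr_gt0// mulr_gt0// ltr_wpDl.
have := incorrect_ge (4 * (K / e + K) / e).
apply: filterS3 (selection_le e0) (penalty_le p0) => m s t l w gw b bA.
have bA' : b \in A by move: bA; rewrite inE => /andP[].
have h1 := s w gw b bA'; have h2 := t w gw b bA; have h3 := l w gw b bA.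
have := penalty_bound (tau m) b; have := penalty_bound (tau m) (ahat m w).
rewrite !ler_norml => /andP[q1 _] /andP[_ q2].
have h4 : `|tau m| * p%:R <= e / 4 * L m b w.
  apply: (@le_trans _ _ (e / (4 * (p%:R + 1)) * L m b w * (p%:R + 1))).
    apply: le_trans (ler_wpM2r (ler0n _ p) h2) _.
    by rewrite ler_wpM2l ?lerDl// (le_trans (normr_ge0 _) h2).
  by apply: eq_lew; field; rewrite gt_eqF// ltr_wpDl.
have l0 : 0 <= L m b w.
  apply: le_trans h3; rewrite divr_ge0 ?(ltW e0)// mulr_ge0// addr_ge0 ?(ltW K0)//.
  by rewrite divr_ge0 ?ltW.
have h5 : 2 * (K / e + K) <= e / 2 * L m b w by move: h3; rewrite ler_pdivrMr//; lra.
have h6 := le_trans h1 (lerD (lerD (lexx _) h5) (lerB (le_trans q2 (lexx _)) q1)).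
apply: selection_arith e0 e1 l0 _; apply: le_trans h6 _.
move: h4; move: (L m b w) (`|tau m| * p%:R) => l' k; rewrite !mulrDl; lra.
Qed.

Lemma ahat_correct (b : {set 'I_p}) : b \in A0 ->
  \forall m \near \oo, forall w, good m w -> ahat m w \in A0.
Proof.
move=> bA0; have bA := fintype.subsetP A0A b bA0.
have p0 : 0 < (4 * (p%:R + 1))^-1 :> R by rewrite invr_gt0 mulr_gt0// ltr_wpDl.
have sl := filterI (selection_le ltr01) (penalty_le p0).
(* With [e = 1], selecting an incorrect model of loss [L] would mean [L <= 3 K + 4 K + L / 2], that
   is [L <= 14 K]. *)
have si := filterI (incorrect_ge (16 * K)) goodP.
apply: filterS3 ahat_min (sl _) (si _) => m sel [s t] [inc corr] w gw; apply/negPn/negP => na.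
have aA : ahat m w \in A :\: A0 by rewrite inE na (sel w).1.
have h1 := s w gw b bA; have h2 := t w gw _ aA; have h3 := inc w gw _ aA.
have [_ _ /(_ b bA0) h4 _] := corr w gw.
have := penalty_bound (tau m) b; have := penalty_bound (tau m) (ahat m w).
rewrite !ler_norml => /andP[q1 _] /andP[_ q2].
have h5 : `|tau m| * p%:R <= L m (ahat m w) w / 4.
  apply: (@le_trans _ _ ((4 * (p%:R + 1))^-1 * L m (ahat m w) w * (p%:R + 1))).
    apply: le_trans (ler_wpM2r (ler0n _ p) h2) _.
    by rewrite ler_wpM2l ?lerDl// (le_trans (normr_ge0 _) h2).
  by apply: eq_lew; field; rewrite gt_eqF// ltr_wpDl.
have h6 := le_trans h1 (lerD (lexx _) (lerB q2 q1)).
by move: (L m b w) (L m (ahat m w) w) (`|tau m| * p%:R) h3 h4 h5 h6 => l l' k; rewrite divr1; have := K0; lra.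
Qed.

Lemma ahat_smallest (a0 : {set 'I_p}) : smallest_model A0 a0 ->
  tau m @[m --> \oo] --> +oo ->
  \forall m \near \oo, forall w, good m w -> ahat m w = a0.
Proof.
move=> [a0A0 a0min] tauy; have a0A := fintype.subsetP A0A a0 a0A0.
(* A larger correct model can be selected only if its additional penalty is below [3 K + 4 K]. *)
have ty : \forall m \near \oo, 8 * K <= tau m by move/cvgryPge : tauy; exact.
have ap := filterI (ahat_correct a0A0) goodP.
apply: filterS3 ty (selection_le ltr01) (ap _) => m tm s [ac gP] w gw.
have [l0 _ corr _] := gP w gw.
have aA0 := ac w gw; have [//|na] := eqVneq (ahat m w) a0.
have := a0min _ aA0 na; rewrite -(ler_nat R) -natr1 => h1.
have h2 := s w gw a0 a0A; have h3 := corr a0 a0A0.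
have h4 := l0 _ (fintype.subsetP A0A _ aA0).
have t0 : 0 <= tau m by apply: le_trans tm; rewrite mulr_ge0// ltW.
have h5 := ler_wpM2l t0 h1; rewrite mulrDr mulr1 in h5.
by have := consistency_arith K0 h4 h3 h5 tm h2.
Qed.

(** Without a correct model, [loss_le_of_incorrect] covers all competitors. A single correct model
    is eventually selected, and its loss, at most [K], is below all incorrect ones, so it attains
    the minimum. Two correct models would both have losses of the size of the error [K], which could
    not rank them. *)
Lemma ratio_near1 (e : R) : (#|A0| <= 1)%N -> 0 < e <= 1 ->
  \forall m \near \oo, forall w, good m w ->
  `|L m (ahat m w) w / fine (min_over A (fun b => (L m b w)%:E)) - 1| <= 4 * e.
Proof.
move=> A01 e01; have /andP[e0 _] := e01.
have [A00|[b0 b0A0]] := set_0Vmem A0.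
  apply: filterS3 ahat_min goodP (loss_le_of_incorrect e01) => m sel gP h w gw.
  have [l0 _ _ _] := gP w gw.
  apply: ratio_close => [|b bA|b bA]; [exact: (sel w).1|exact: l0|].
  by apply: h => //; rewrite inE A00 inE.
have AE : A0 = [set b0]%SET.
  by apply/eqP; rewrite eq_sym eqEcard finset.sub1set b0A0 cards1.
have sa := filterI (ahat_correct b0A0) ahat_min.
apply: filterS3 (sa _) goodP (incorrect_ge K) => m [ac sel] gP inc w gw.
have [l0 _ corr _] := gP w gw.
have aA0 := ac w gw; have aE : ahat m w = b0 by move: aA0; rewrite AE inE => /eqP.
apply: ratio_close => [|b bA|b bA]; [exact: (sel w).1|exact: l0|].
apply: (@le_trans _ _ (L m b w)); last first.
  by rewrite ler_peMl ?(ltW (l0 b bA))// lerDl mulr_ge0// ltW.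
have [bA0|bA0] := boolP (b \in A0); first by move: bA0; rewrite aE AE inE => /eqP ->.
apply: le_trans (corr _ aA0) _; apply: inc => //.
by rewrite inE bA0.
Qed.
End selection.

Lemma compact_in_box (R : realType) (Theta : set (R * R)) (th0 : R * R) : Theta th0 ->
  compact Theta -> (forall th, Theta th -> 0 < th.1 /\ 0 < th.2) ->
  exists s1 s2 k1 k2 : R, [/\ 0 < s1, 0 < k1, s1 <= s2, k1 <= k2 &
    forall th, Theta th -> in_box s1 s2 k1 k2 th].
Proof.
move=> T0 cT pos; have T00 : Theta !=set0 by exists th0.
have c1 : {within Theta, continuous (fst : R * R -> R)}.
  by apply: continuous_subspaceT => y; exact: cvg_fst.
have c2 : {within Theta, continuous (snd : R * R -> R)}.
  by apply: continuous_subspaceT => y; exact: cvg_snd.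
have [a1 /set_mem a1T h1] := compact_EVT_min T00 cT c1.
have [a2 /set_mem a2T h2] := compact_EVT_max T00 cT c1.
have [a3 /set_mem a3T h3] := compact_EVT_min T00 cT c2.
have [a4 /set_mem a4T h4] := compact_EVT_max T00 cT c2.
exists a1.1, a2.1, a3.2, a4.2; split.
- exact: (pos _ a1T).1.
- exact: (pos _ a3T).2.
- exact/h1/mem_set.
- exact/h3/mem_set.
- by move=> th /mem_set Tth; split; [exact: h1|exact: h2|exact: h3|exact: h4].
Qed.

Lemma measurable_gt {d : measure_display} {T : measurableType d} {R : realType}
    (f : T -> R) (K : R) : measurable_fun [set: T] f -> measurable [set w | K < f w].
Proof.
move=> mf; have := mf measurableT _ (measurable_itv `]K, +oo[); rewrite setTI.
by congr measurable; apply/seteqP; split => w /=; rewrite in_itv/= andbT.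
Qed.

Section probability_bounds.
Context {d : measure_display} {T : measurableType d} {R : realType}.
Variable P : probability T R.

Lemma prob_gt_le (W : T -> R) (r K : R) : (forall w, 0 <= W w) -> hasE P W r -> 0 < K ->
  (P [set w | (K < W w)%R] <= (r / K)%:E)%E.
Proof.
move=> W0 Wr K0; have mW := hasE_measurable Wr.
have mA : measurable [set w | (K < W w)%R] by exact: measurable_gt.
have h : hasE P (\1_[set w | K < W w]) (fine (P [set w | K < W w])).
  apply: hasE_ge0 => //; rewrite integral_indic// setIT fineK//.
  exact: fin_num_measure.
rewrite -[leLHS]fineK ?fin_num_measure// lee_fin ler_pdivlMr// mulrC.
apply: hasE_le (hasE_Z K h) Wr => w.
rewrite indicE; case: (boolP (w \in _)) => [|_]; last by rewrite mulr0.
by rewrite inE mulr1 => /ltW.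
Qed.

Lemma prob_bigU (I : Type) (s : seq I) (F : I -> set T) (t : R) :
  (forall i, measurable (F i)) -> (forall i, (P (F i) <= t%:E)%E) ->
  (P (\big[setU/set0]_(i <- s) F i) <= ((size s)%:R * t)%:E)%E.
Proof.
move=> mF h; elim: s => [|i s ih]; first by rewrite big_nil measure0 mul0r.
rewrite big_cons; have mU : measurable (\big[setU/set0]_(i <- s) F i).
  by apply: bigsetU_measurable.
apply: le_trans (measureU2 P (mF i) mU) _.
rewrite (_ : (size (i :: s))%:R * t = t + (size s)%:R * t); last by rewrite /= -natr1; ring.
by rewrite EFinD; apply: leeD; [exact: h|exact: ih].
Qed.

Lemma prob_cvg0 (S : nat -> set T) :
  (forall t : R, 0 < t -> \forall m \near \oo, (P (S m) <= t%:E)%E) ->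
  P (S m) @[m --> \oo] --> 0%E.
Proof.
move=> h; apply/fine_cvgP.
have f : \forall m \near \oo, P (S m) \is a fin_num.
  apply: filterS (h 1 ltr01) => m h1; rewrite ge0_fin_numE ?measure_ge0//.
  exact: le_lt_trans h1 (ltry _).
split=> //; apply/cvgrPdist_le => e e0; apply: filterS2 f (h e e0) => m fm hm.
rewrite sub0r normrN ger0_norm ?fine_ge0 ?measure_ge0//.
by rewrite -lee_fin fineK.
Qed.
End probability_bounds.

Lemma in_prob_measurable {d : measure_display} {T : measurableType d} {R : realType}
    (th : T -> R * R) (l : R * R) (e : R) : measurable_fun [set: T] th ->
  measurable [set w | e < `|th w - l|].
Proof.
move=> mth; apply: measurable_gt.
rewrite (_ : (fun w => _) = (fun w => Num.max `|(th w).1 - l.1| `|(th w).2 - l.2|)); last first.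
  by apply/funext => w; rewrite prod_normE.
apply: measurable_maxr; apply: measurableT_comp => //; apply: measurable_funB => //.
  exact: measurableT_comp measurable_fst mth.
exact: measurableT_comp measurable_snd mth.
Qed.

(** Index 1 is the estimate and 0 the truth. The likelihood is larger at the estimate, so the gap
    bounds with [e = 1] give [L1 <= 3 L0 + 2 (10 + 12 C) W], and [L0 <= C W / 2]. *)
Lemma ml_loss_le (R : realFieldType) (C W KW L0 L1 l0 l1 c : R) : 0 < C -> W <= KW ->
  `|- 2 * l1 - 2 * L1 - c| <= 1 * L1 + (10 * (1 + C) / 1 + 2 * C) * W ->
  `|- 2 * l0 - 2 * L0 - c| <= 1 * L0 + (10 * (1 + C) / 1 + 2 * C) * W ->
  l0 <= l1 -> L0 <= C * W / 2 -> 0 <= W -> L1 <= 30 * ((1 + C) * KW).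
Proof.
move=> C0 WK; rewrite !divr1 !ler_norml => /andP[h1 _] /andP[_ h2] h3 h4 W0.
have p : (1 + C) * W <= (1 + C) * KW by rewrite ler_wpM2l// addr_ge0// ltW.
apply: le_trans (_ : 30 * ((1 + C) * W) <= _); last by rewrite ler_wpM2l.
have q := mulr_ge0 (ltW C0) W0.
have E : (10 * (1 + C) + 2 * C) * W = 10 * W + 12 * (C * W) by ring.
rewrite E in h1 h2; rewrite mulrDl mul1r; lra.
Qed.

Lemma gap_const_le (R : realFieldType) (C W KW X e : R) : 0 < C -> 0 <= W -> W <= KW ->
  0 <= X -> 0 < e ->
  (10 * (1 + C) / e + 2 * C) * W <=
  (X + 30 * ((1 + C) * KW)) / e + (X + 30 * ((1 + C) * KW)).
Proof.
move=> C0 W0 WK X0 e0.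
have p : (1 + C) * W <= (1 + C) * KW by rewrite ler_wpM2l// addr_ge0// ltW.
have q := mulr_ge0 (ltW C0) W0; rewrite mulrDl mul1r in p.
have E : (10 * (1 + C) / e + 2 * C) * W = 10 * (W + C * W) / e + 2 * (C * W) by ring.
rewrite E; apply: lerD; last by lra.
by rewrite ler_pM2r ?invr_gt0//; lra.
Qed.

Lemma risk_const_le (R : realFieldType) (k S C2 C r r0 X L : R) : 0 <= L -> k <= S -> 0 <= C2 ->
  0 < C -> r <= r0 -> 0 <= X -> 0 <= S -> 0 < C * r0 ->
  (k + C2) * L + C * r / 2 <= (S + C2 + C * r0 + X) * L + (S + C2 + C * r0 + X).
Proof.
move=> L0 kS C20 C0 rr X0 S0 Cr; have p : C * r <= C * r0 by rewrite ler_pM2l.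
apply: lerD; last by lra.
by rewrite ler_wpM2r//; lra.
Qed.

Lemma measurable_min_over {d : measure_display} {T : measurableType d} {R : realType}
    (I : finType) (A : {set I}) (F : I -> T -> R) :
  (forall a, a \in A -> measurable_fun [set: T] (F a)) ->
  measurable_fun [set: T] (fun w => min_over A (fun a => (F a w)%:E)).
Proof.
move=> mF; rewrite /min_over (_ : (fun w => _) =
  (fun w => \big[Order.min/+oo%E]_(a <- enum A) (F a w)%:E)); last first.
  by apply/funext => w; rewrite big_enum.
have : {subset enum A <= A} by move=> a; rewrite mem_enum.
elim: (enum A) => [_|a s ih sA].
  by rewrite (_ : (fun w => _) = fun=> +oo%E)//; apply/funext => w; rewrite big_nil.
rewrite (_ : (fun w => _) = (fun w => Order.min (F a w)%:E
    (\big[Order.min/+oo%E]_(b <- s) (F b w)%:E))); last first.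
  by apply/funext => w; rewrite big_cons.
apply: measurable_mine; first by apply/measurable_EFinP/mF/sA; exact: mem_head.
by apply: ih => b bs; apply: sA; rewrite inE bs orbT.
Qed.

(** * The good event and the properties of the selectors *)

Section good_event.
Context {R : realType} {d : measure_display} {T : measurableType d}.
Context (P : probability T R) {p : nat}.
Variables (delta : R) (mu0 : nat -> R * R -> R) (x : nat -> 'I_p -> R * R -> R).
Variables (eta : nat -> R * R -> {RV P >-> R}) (A A0 : {set {set 'I_p}}).
Variables (Theta : set (R * R)) (theta0 : R * R).
Variables (thhat : nat -> {set 'I_p} -> T -> R * R) (thlim : {set 'I_p} -> R * R).
Let Rmin := fun m : nat => min_over (A :\: A0) (fun a => risk delta mu0 x eta m a (thlim a)).
Let full_rank m := forall th, Theta th ->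
  (full_design delta x m)^T *m invmx (Sigma delta m th) *m full_design delta x m \in unitmx.
Let estimates m := forall a, a \in A -> ml_estimate delta mu0 x eta Theta m a (thhat m a).
Hypothesis delta01 : 0 <= delta < 1.
Hypothesis cT : compact Theta.
Hypothesis posT : forall th, Theta th -> 0 < th.1 /\ 0 < th.2.
Hypothesis T0 : Theta theta0.
Hypothesis etaG : \forall m \near \oo, gaussian_process (domain delta m) (eta m).
Hypothesis etaC : \forall m \near \oo, centered (domain delta m) (eta m).
Hypothesis etaS : \forall m \near \oo,
  dispersion P (data delta mu0 eta m) = Sigma delta m theta0.
Hypothesis FU : \forall m \near \oo, full_rank m.
Hypothesis A0E : \forall m \near \oo, forall a,
  a \in A0 <-> a \in A /\ correct delta mu0 x m a.
Hypothesis mthhat : forall m a, a \in A -> measurable_fun [set: T] (thhat m a).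
Hypothesis mle : \forall m \near \oo, estimates m.
Hypothesis Tlim : forall a, a \in A -> Theta (thlim a).
Hypothesis cvgth : forall a, a \in A -> cvg_in_prob P (fun m => thhat m a) (thlim a).

Let L m a w := loss delta mu0 x eta m a (thhat m a w) w.
Let l m a w := ell delta mu0 x eta m a (thhat m a w) w.

Lemma thhat_close (e : {set 'I_p} -> R) (t : R) : (forall a, 0 < e a) -> 0 < t ->
  \forall m \near \oo, exists B : set T, [/\ measurable B, (P B <= t%:E)%E &
    forall w a, a \in A -> ~ B w -> `|thhat m a w - thlim a| <= e a].
Proof.
move=> e0 t0; pose G m a := if a \in A then [set w | e a < `|thhat m a w - thlim a|] else set0.
pose s := t / ((size (index_enum {set 'I_p}))%:R + 1).
have s0 : 0 < s by rewrite divr_gt0// ltr_wpDl.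
have mG m a : measurable (G m a).
  by rewrite /G; case: ifP => // aA; apply: in_prob_measurable; exact: mthhat.
have h : \forall m \near \oo, forall a, (P (G m a) <= s%:E)%E.
  apply: filter_forall => a; rewrite /G; case: (boolP (a \in A)) => aA; last first.
    by near=> m; rewrite measure0 lee_fin ltW.
  have /fine_cvgP[f /cvgrPdist_le/(_ s s0)] := cvgth aA (e0 a).
  apply: filterS2 f => m fm; rewrite sub0r normrN ger0_norm ?fine_ge0 ?measure_ge0//.
  by rewrite -lee_fin fineK.
apply: filterS h => m h; exists (\big[setU/set0]_(a : {set 'I_p}) G m a); split.
- exact: bigsetU_measurable.
- apply: le_trans (prob_bigU _ (mG m) h) _.
  rewrite lee_fin /s mulrCA; apply: ler_piMr; first exact: ltW.
  by rewrite ler_pdivrMr ?mul1r ?lerDl// ltr_wpDl.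
- move=> w a aA; apply: contra_notP => /negP; rewrite -ltNge => h'.
  by rewrite (bigD1 a)//=; left; rewrite /G aA.
Unshelve. all: by end_near. Qed.

Lemma good_event (t : R) : 0 < t -> exists K : R, 0 < K /\
  \forall m \near \oo, exists (g : set T) (c : T -> R),
  [/\ measurable g, (P (~` g) <= t%:E)%E & good_set A A0 (L m) (l m) c (Rmin m) K g].
Proof.
move=> t0; have [s1 [s2 [k1 [k2 [s10 k10 s12 k12 Tbox]]]]] := compact_in_box T0 cT posT.
pose C := prec_bound s1 s2 k1 k2; have C0 : 0 < C by exact: prec_bound_gt0.
(* The default [theta0] makes [entropy_compare] applicable to every index, so that its constants can
   be chosen as total functions. *)
pose tha a := if a \in A then thlim a else theta0.
have Ttha a : Theta (tha a) by rewrite /tha; case: ifP => // aA; exact: Tlim.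
have [e] := choice (fun a => entropy_compare delta01 s10 k10 s12 k12 (Tbox _ T0) (Tbox _ (Ttha a))).
move=> /choice[Ke eKe].
have e0 a : 0 < e a by have [] := eKe a.
have Ke0 a : 0 < Ke a by have [] := eKe a.
pose compares m := forall a th, in_box s1 s2 k1 k2 th ->
    `|th.1 - (tha a).1| <= e a -> `|th.2 - (tha a).2| <= e a ->
    entropy (rel_prec delta m theta0 (tha a)) <= Ke a * entropy (rel_prec delta m theta0 th).
have cmp : \forall m \near \oo, compares m.
  by apply: filter_forall => a; have [] := eKe a.
pose r0 : R := (130 + 64 * (2 + p))%:R.
have r00 : 0 < r0 by rewrite ltr0n.
(* By Markov's inequality [W] exceeds [KW] with probability at most [t / 2]; the other half is left
   for estimates far from their limits. *)
pose KW := 2 * r0 / t; have KW0 : 0 < KW by rewrite divr_gt0// mulr_gt0.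
have t20 : 0 < t / 2 by rewrite divr_gt0.
pose SK := \sum_a Ke a; have SK0 : 0 <= SK by apply: sumr_ge0 => a _; exact: ltW.
have KeS a : Ke a <= SK by rewrite /SK (bigD1 a)//= lerDl sumr_ge0// => b _; exact: ltW.
(* The first three terms come from the comparison with the risk, the last from the gap bound and
   from the loss of correct models. None depends on [m]. *)
pose K := SK + C ^+ 2 + C * r0 + 30 * ((1 + C) * KW).
have p1 : 0 <= C ^+ 2 by exact: sqr_ge0.
have p2 : 0 < C * r0 by exact: mulr_gt0.
have p3 : 0 < (1 + C) * KW by rewrite mulr_gt0// addr_gt0.
exists K; split; first by rewrite /K; move: SK0 p1 p2 p3; lra.
have close := thhat_close e0 t20.
near=> m.
have m0 : (0 < m)%N by near: m; exact: nbhs_infty_gt.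
have G : gaussian_process (domain delta m) (eta m) by near: m.
have Ce : centered (domain delta m) (eta m) by near: m.
have S : dispersion P (data delta mu0 eta m) = Sigma delta m theta0 by near: m.
have U : full_rank m by near: m.
have AE : forall a, a \in A0 <-> a \in A /\ correct delta mu0 x m a by near: m.
have ML : estimates m by near: m.
have CM : compares m by near: m.
have [B [mB PB Bclose]] : exists B : set T, [/\ measurable B, (P B <= (t / 2)%:E)%E &
    forall w a, a \in A -> ~ B w -> `|thhat m a w - thlim a| <= e a] by near: m.
have Th a w : a \in A -> Theta (thhat m a w) by move=> aA; have [] := ML a aA w.
have [N [mN PN Npos]] := loss_null m0 s10 k10 s12 k12 Tbox T0 G Ce S U.
have [W [c [r [W0 Wr rr0 fitW gap]]]] :=
  gaussian_regression_bounds m0 s10 k10 s12 k12 Tbox T0 G Ce S U.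
have mW : measurable [set w | KW < W w] by exact/measurable_gt/(hasE_measurable Wr).
exists (~` ([set w | KW < W w] `|` (N `|` B))), c.
have mNB : measurable (N `|` B) by exact: measurableU.
split; first by apply: measurableC; exact: measurableU.
- rewrite setCK; apply: le_trans (measureU2 P mW mNB) _.
  have -> : t = t / 2 + (0 + t / 2) by field.
  rewrite EFinD; apply: leeD.
    apply: le_trans (prob_gt_le W0 Wr KW0) _; rewrite lee_fin ler_pdivrMr// /KW.
    by rewrite (_ : t / 2 * _ = r0)//; field; rewrite gt_eqF.
  by apply: le_trans (measureU2 P mN mB) _; rewrite EFinD; apply: leeD; [apply: eq_lew; exact: PN|exact: PB].
- move=> w gw; have WK : W w <= KW by rewrite leNgt; apply/negP => h; apply: gw; left.
  split=> [a aA|a e' aA e'0|a aA0|a].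
  + apply: Npos; first exact: Th.
    by apply: contra_not gw => Nw; right; left.
  + apply: le_trans (gap a _ w _ (Th a w aA) e'0) _.
    rewrite lerD2l; apply: (gap_const_le C0 (W0 w) WK _ e'0).
    by rewrite !addr_ge0// ltW.
  + have [aA ca] := (AE a).1 aA0.
    have h1 := gap a _ w _ (Th a w aA) ltr01; have h2 := gap a _ w _ T0 ltr01.
    apply: le_trans (ml_loss_le C0 WK h1 h2 _ _ (W0 w)) _.
    * have [_ mlE] := ML a aA w; rewrite -lee_fin mlE; apply: ereal_sup_ubound.
      by exists theta0.
    * rewrite (loss_true_model m0 s10 k10 Tbox T0 S U _ ca).
      by rewrite ler_pM2r// fitW.
    * by rewrite /K; move: SK0 p1 p2; lra.
  + rewrite inE => /andP[aA0 aA].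
    have nB : ~ B w by apply: contra_not gw => Bw; right; right.
    have hc := Bclose w a aA nB; rewrite prod_normE ge_max in hc; have /andP[c1 c2] := hc.
    have thE : tha a = thlim a by rewrite /tha aA.
    have ce := CM a _ (Tbox _ (Th a w aA)); rewrite thE in ce.
    have ml : measurable_fun [set: T] (loss delta mu0 x eta m a (thlim a)).
      apply: measurable_loss (measurable_cst (thlim a)) => w'.
        by have [? ?] := posT (Tlim aA); exact: Sigma_unit.
      exact: (design_Sigma_unit m0 s10 k10 Tbox U a (Tlim aA)).
    apply: (@le_trans _ _ (risk delta mu0 x eta m a (thlim a))).
      by apply: bigmin_le_cond; rewrite inE aA0.
    apply: le_trans (risk_le m0 s10 k10 s12 k12 Tbox T0 S U w (Th a w aA) (Tlim aA)
      (ltW (Ke0 a)) (ce c1 c2) ml Wr _) _; first by move=> w'; apply: fitW; exact: Tlim.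
    have l0 := loss_ge0 m0 s10 k10 s12 k12 Tbox T0 S U a w (Th a w aA).
    rewrite lee_fin; apply: (risk_const_le l0 (KeS a) p1 C0 rr0 _ SK0 p2).
    by rewrite mulr_ge0 ?(ltW p3).
Unshelve. all: by end_near. Qed.

Lemma measurable_loss_ml : \forall m \near \oo, forall a, a \in A ->
  measurable_fun [set: T] (L m a).
Proof.
have [s1 [s2 [k1 [k2 [s10 k10 s12 k12 Tbox]]]]] := compact_in_box T0 cT posT.
near=> m => a aA.
have m0 : (0 < m)%N by near: m; exact: nbhs_infty_gt.
have ML : estimates m by near: m.
have U : full_rank m by near: m.
have Th w : Theta (thhat m a w) by have [] := ML a aA w.
apply: measurable_loss (mthhat m aA) => w.
  by have [? ?] := posT (Th w); exact: Sigma_unit.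
exact: (design_Sigma_unit m0 s10 k10 Tbox U a (Th w)).
Unshelve. all: by end_near. Qed.

(** The events and constants, which exist for each large [m], are chosen as sequences, the form in
    which the criteria are compared. *)
Lemma good_event_fun (t : R) : 0 < t -> exists (K : R) (g : nat -> set T) (c : nat -> T -> R),
  [/\ 0 < K, \forall m \near \oo, measurable (g m) /\ (P (~` g m) <= t%:E)%E &
    \forall m \near \oo, good_set A A0 (L m) (l m) (c m) (Rmin m) K (g m)].
Proof.
move=> t0; have [K [K0 h]] := good_event t0.
pose Q m (gc : set T * (T -> R)) := [/\ measurable gc.1, (P (~` gc.1) <= t%:E)%E &
  good_set A A0 (L m) (l m) gc.2 (Rmin m) K gc.1].
have [f hf] : {f : nat -> set T * (T -> R) & forall m, (exists gc, Q m gc) -> Q m (f m)}.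
  apply: (@choice _ _ (fun m fm => (exists gc, Q m gc) -> Q m fm)) => m.
  have [[gc qgc]|nq] := pselect (exists gc, Q m gc); first by exists gc.
  by exists (set0, fun=> 0) => /nq.
have {}h : \forall m \near \oo, Q m (f m).
  by apply: filterS h => m [g [c q]]; apply: hf; exists (g, c).
by exists K, (fun m => (f m).1), (fun m => (f m).2); split => //; apply: filterS h => m [].
Qed.

Hypothesis Rmin_cvg : Rmin m @[m --> \oo] --> +oo%E.

Let A0A : A0 \subset A.
Proof.
have [m h] := filter_ex A0E.
by apply/fintype.subsetP => a /h[].
Qed.

Section criterion.
Variables (tau : nat -> R) (ahat : nat -> T -> {set 'I_p}).
Hypothesis tau_small : forall e : R, 0 < e ->
  \forall m \near \oo, (`|tau m|%:E <= e%:E * Rmin m)%E.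
Hypothesis sel : gic_selector delta mu0 x eta thhat A tau ahat.

Lemma gic_loss_efficient : (#|A0| <= 1)%N -> loss_efficient delta mu0 x eta thhat A ahat.
Proof.
move=> A01 e e0; apply: prob_cvg0 => t t0.
have [K [g [c [K0 hP hg]]]] := good_event_fun t0.
pose e1 := Num.min (e / 4) 1.
have e1P : 0 < e1 <= 1 by rewrite /e1 lt_min ge_min lexx orbT andbT divr_gt0//=.
have near1 := ratio_near1 K0 hg A0A Rmin_cvg tau_small sel.2 A01 e1P.
near=> m.
have [mg Pg] : measurable (g m) /\ (P (~` g m) <= t%:E)%E by near: m.
have r1 : forall w, g m w ->
  `|L m (ahat m w) w / fine (min_over A (fun b => (L m b w)%:E)) - 1| <= 4 * e1 by near: m.
have mL : forall a, a \in A -> measurable_fun [set: T] (L m a).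
  by near: m; exact: measurable_loss_ml.
have aA w : ahat m w \in A.
  by have [] : ahat m w \in A /\ forall a, a \in A ->
    gic delta mu0 x eta thhat tau m (ahat m w) w <= gic delta mu0 x eta thhat tau m a w
    by move: w; near: m; exact: sel.2.
(* Monotonicity of [P] is applied to measurable sets: the deviation is measurable for a fixed model,
   and the event is split along the finitely many values of [ahat]. *)
pose F a w := `|L m a w / fine (min_over A (fun b => (L m b w)%:E)) - 1|.
have mF a : a \in A -> measurable [set w | e < F a w].
  move=> aA'; apply: measurable_gt.
  apply: measurableT_comp => //; apply: measurable_funB => //.
  apply: measurable_funM; first exact: mL.
  apply: measurable_funV; apply: measurableT_comp => //.
  exact: measurable_min_over.
apply: le_trans Pg; apply: le_measure.
- rewrite inE (_ : [set w | _] = \bigcup_(a in [set a | a \in A])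
    ((ahat m @^-1` [set a]) `&` [set w | e < F a w])).
    apply: fin_bigcup_measurable; first exact: finite_finset.
    by move=> a aA'; apply: measurableI; [exact: sel.1|exact: mF].
  apply/seteqP; split => w /=.
    by move=> ew; exists (ahat m w) => //=; exact: aA.
  by move=> [a aA' [<-]].
- by rewrite inE; exact: measurableC.
- move=> w /= ew gw; have := r1 w gw; rewrite leNgt => /negP; apply.
  apply: le_lt_trans ew; rewrite mulrC -ler_pdivlMr//.
  by rewrite /e1 ge_min lexx.
Unshelve. all: by end_near. Qed.

Lemma gic_consistent a0 : smallest_model A0 a0 -> tau m @[m --> \oo] --> +oo ->
  consistent P a0 ahat.
Proof.
move=> a0P tauy.
have mS m : measurable (ahat m @^-1` [set a0]) by exact: sel.1.
have c0 : P (~` (ahat m @^-1` [set a0])) @[m --> \oo] --> 0%E.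
  apply: prob_cvg0 => t t0.
  have [K [g [c [K0 hP hg]]]] := good_event_fun t0.
  have near1 := ahat_smallest K0 hg A0A Rmin_cvg tau_small sel.2 a0P tauy.
  apply: filterS2 near1 hP => m r1 [mg Pg].
  apply: le_trans Pg; apply: le_measure; rewrite ?inE.
  - exact: measurableC.
  - exact: measurableC.
  - by move=> w /= nw gw; apply: nw; exact: r1.
rewrite /consistent; have -> : (fun m => P [set w | ahat m w = a0]) = (fun m => 1 - P (~` (ahat m @^-1` [set a0])))%E.
  by apply/funext => m; rewrite -probability_setC ?setCK//; exact: measurableC.
rewrite -[X in _ --> X]sube0.
by apply: (@cvgeB _ _ _ R (fun=> 1%E) _ 1%E 0%E _ _ c0) => //; exact: cvg_cst.
Qed.
End criterion.

(** [Rmin] tends to infinity, so every constant is negligible against it, and the penalty 2 falls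
    under the same comparison as a growing one. *)
Lemma gic_constant_penalty (t : R) : forall e : R, 0 < e ->
  \forall m \near \oo, (`|t|%:E <= e%:E * Rmin m)%E.
Proof.
move=> e e0; have h : \forall m \near \oo, ((`|t| / e)%:E <= Rmin m)%E.
  by move/cvgeyPge : Rmin_cvg; exact.
apply: filterS h => m h; rewrite -lee_pdivrMl//.
by rewrite -EFinM mulrC.
Qed.
End good_event.

Theorem theorem5p6 (R : realType) (d : measure_display) (T : measurableType d)
    (P : probability T R) (p : nat) (delta : R)
    (mu0 : nat -> R * R -> R) (x : nat -> 'I_p -> R * R -> R)
    (eta : nat -> R * R -> {RV P >-> R})
    (A A0 : {set {set 'I_p}}) (Theta : set (R * R)) (theta0 : R * R)
    (thhat : nat -> {set 'I_p} -> T -> R * R)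
    (thlim : {set 'I_p} -> R * R)
    (Rmin := fun m : nat =>
       min_over (A :\: A0) (fun a => risk delta mu0 x eta m a (thlim a))) :
  0 <= delta < 1 ->
  compact Theta ->
  (forall th, Theta th -> 0 < th.1 /\ 0 < th.2) ->
  Theta theta0 ->
  (\forall m \near \oo, gaussian_process (domain delta m) (eta m)) ->
  (\forall m \near \oo, centered (domain delta m) (eta m)) ->
  (\forall m \near \oo,
     dispersion P (data delta mu0 eta m) = Sigma delta m theta0) ->
  (\forall m \near \oo, forall th, Theta th ->
     (full_design delta x m)^T *m invmx (Sigma delta m th)
       *m full_design delta x m \in unitmx) ->
  (\forall m \near \oo, forall a,
     a \in A0 <-> a \in A /\ correct delta mu0 x m a) ->
  (forall m a, a \in A -> measurable_fun [set: T] (thhat m a)) ->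
  (\forall m \near \oo, forall a, a \in A ->
     ml_estimate delta mu0 x eta Theta m a (thhat m a)) ->
  (forall a, a \in A -> Theta (thlim a)) ->
  (forall a, a \in A -> cvg_in_prob P (fun m => thhat m a) (thlim a)) ->
  Rmin m @[m --> \oo] --> +oo%E ->
  ((#|A0| <= 1)%N ->
     forall ahat, gic_selector delta mu0 x eta thhat A (fun=> 2) ahat ->
       loss_efficient delta mu0 x eta thhat A ahat) /\
  (forall tau : nat -> R,
     tau m @[m --> \oo] --> +oo ->
     (forall e : R, 0 < e ->
        \forall m \near \oo, (`|tau m|%:E <= e%:E * Rmin m)%E) ->
     forall ahat, gic_selector delta mu0 x eta thhat A tau ahat ->
       (#|A0| = 0%N -> loss_efficient delta mu0 x eta thhat A ahat) /\
       ((1 <= #|A0|)%N -> forall a0, smallest_model A0 a0 ->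
          consistent P a0 ahat)).
Proof.
move=> delta01 cT posT T0 etaG etaC etaS FU A0E mthhat mle Tlim cvgth Rmin_cvg.
have eff tau ahat := gic_loss_efficient delta01 cT posT T0 etaG etaC etaS FU A0E mthhat mle
  Tlim cvgth Rmin_cvg (tau := tau) (ahat := ahat).
split=> [A01 ahat sel|tau tauy tau_small ahat sel].
  apply: eff sel A01; exact: gic_constant_penalty.
split=> [A00|_ a0 a0P]; first by apply: eff tau_small sel _; rewrite A00.
exact: (gic_consistent delta01 cT posT T0 etaG etaC etaS FU A0E mthhat mle
  Tlim cvgth Rmin_cvg tau_small sel a0P tauy).
Qed.
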